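(* Let $T>0$, let $d,e\ge 1$ be integers, let $1\le q<2$ and $q-1<\gamma\le 1$. Let $U\subseteq\mathbb{R}^e$ be open, let $F:U\to\mathcal{K}(\mathbb{R}^{e\times d})$ be locally $\gamma$-Hölder, and set $\Omega=U\times\mathcal{V}^q([0,T]\to\mathbb{R}^d)$. Then for all $\omega=(\xi,x)\in\Omega$ there exist $T_*(\omega)\in(0,T]$ and a local solution $z(\omega)\in\mathcal{V}^q([0,T_*(\omega)]\to U)$ to the Young differential inclusion $\mathrm{d}z_t\in F(z_t)\,\mathrm{d}x_t$ started at $\xi$, with velocity $v(\omega)\in\mathbf{V}^{q/\gamma+}([0,T_*(\omega)]\to\mathbb{R}^{e\times d})$. Moreover, these can be chosen in such a way that the maps $T_*:\Omega\to(0,T]$ and $(z,v)\mathbf{1}_{[0,T_*]}$ are measurable.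
   Context: $\mathbb{R}^{e\times d}$ is the space of real $e\times d$ matrices. For a topological space $Y$, $\mathcal{K}(Y)$ is the set of nonempty compact subsets of $Y$; $\mathcal{K}(\mathbb{R}^{e\times d})$ carries the Hausdorff distance $h$. $F$ is $\gamma$-Hölder on a set $A$ if $\sup_{a\ne b\in A}h(F(a),F(b))/|a-b|^\gamma<\infty$, and locally $\gamma$-Hölder if it is $\gamma$-Hölder on every compact subset of $U$. For a path $x:E\to X$ with $E\subseteq\mathbb{R}$, $X$ a normed space, and $F'\subseteq E$, $V_p(x,F')=\sup\big(\sum_{k=1}^n|x_{\sigma_k}-x_{\sigma_{k-1}}|^p\big)^{1/p}$, the supremum being over all finite sets $\sigma_0<\dots<\sigma_n$ in $F'$; $V_p(x)=V_p(x,E)$. $V^p(E\to X)$ is the set of paths with $V_p(x)<\infty$; $V^p_{\rm loc}$ the set of paths having finite $p$-variation on every compact subset of $E$; $\mathcal{V}^p$ (resp. $\mathcal{V}^p_{\rm loc}$) the subset of continuous paths of $V^p$ (resp. $V^p_{\rm loc}$); $\mathbf{V}^p$ the subset of càdlàg (right-continuous with left limits) paths of $V^p$; $\mathbf{V}^{r+}=\bigcap_{p>r}\mathbf{V}^p$. A path taking values in $U$ is regarded as a path in $\mathbb{R}^e$. Young integral: if $x$ is continuous of finite $q$-variation and $v$ has finite $p$-variation with $1/p+1/q>1$ on $[0,t]$, $\int_0^t v_s\,\mathrm{d}x_s$ is the limit of $\sum_k v_{\sigma_{k-1}}(x_{\sigma_k}-x_{\sigma_{k-1}})$ over subdivisions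 $0=\sigma_0<\dots<\sigma_n=t$ as the mesh tends to $0$. Solution: for $\xi\in U$ and $x\in\mathcal{V}^q([0,T]\to\mathbb{R}^d)$, a (local) solution started from $\xi$ on $I=[0,T_*]$, $T_*\le T$, to $\mathrm{d}z_t\in F(z_t)\,\mathrm{d}x_t$ is a path $z\in\mathcal{V}^q_{\rm loc}(I\to U)$ such that there is $v\in V^p_{\rm loc}(I\to\mathbb{R}^{e\times d})$, for some $p\ge1$ with $1/p+1/q>1$, satisfying for all $t\in I$: $z_t=\xi+\int_0^t v_s\,\mathrm{d}x_s$ and $v_t\in F(z_t)$. One then says $z$ is a solution with velocity $v$. Measurability: subsets of $\mathbb{R}^k$ carry the Borel $\sigma$-algebra; every path space (a subset of $(\mathbb{R}^k)^{[0,T]}$) carries the cylindrical $\sigma$-algebra, i.e. the smallest one making all evaluations $x\mapsto x_t$, $t\in[0,T]$, measurable; $\Omega$ carries the product $\sigma$-algebra. $(z,v)\mathbf{1}_{[0,T_*]}$ denotes the map sending $\omega$ to the path $[0,T]\to\mathbb{R}^e\times\mathbb{R}^{e\times d}$ equal to $(z_t(\omega),v_t(\omega))$ for $t\le T_*(\omega)$ and to $(0,0)$ otherwise. *)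

(* Defs.v *)
From HB Require Import structures.
From mathcomp Require Import all_boot all_order all_algebra.
From mathcomp Require Import all_classical all_reals all_analysis.

Set Implicit Arguments.
Unset Strict Implicit.
Unset Printing Implicit Defensive.
Import Order.TTheory GRing.Theory Num.Theory.
Import numFieldNormedType.Exports.
Local Open Scope classical_set_scope.
Local Open Scope ring_scope.

(* R^e is 'cV[R]_e and R^(e x d) is 'M[R]_(e, d), with the library norm
   (maximum of the absolute values of the entries); none of the notions below
   depends on the choice of the norm, up to the value of finite constants. *)

(* A path E -> V, with E a set of reals, is given by a total function R -> V
   of which only the values on E are considered. *)

Section path_regularity.
Context {R : realType} {V : normedModType R}.
Implicit Types (p : R) (E : set R) (x : R -> V).

(* The list s is the finite set sigma_0 < ... < sigma_n. *)
Definition pvar_sum p x (s : seq R) : R :=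
  \sum_(k < (size s).-1) `|x s`_k.+1 - x s`_k| `^ p.

Definition pvar p E x : \bar R :=
  ((ereal_sup [set (pvar_sum p x s)%:E |
      s in [set s : seq R | sorted <%R s /\ (forall u, u \in s -> E u)]])
   `^ p^-1)%E.

Definition finite_pvar p E x : Prop := (pvar p E x < +oo)%E.

Definition loc_finite_pvar p E x : Prop :=
  forall K : set R, compact K -> K `<=` E -> finite_pvar p K x.

Definition cont_finite_pvar p E x : Prop :=
  {within E, continuous x} /\ finite_pvar p E x.

Definition cont_loc_finite_pvar p E x : Prop :=
  {within E, continuous x} /\ loc_finite_pvar p E x.

(* When t is not a limit point of E from the relevant side, the filter is
   trivial and the condition is void. *)
Definition cadlag_on E x : Prop :=
  forall t, E t ->
    (x @ within E t^'+ --> x t) /\ (exists l : V, x @ within E t^'- --> l).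

Definition cadlag_finite_pvar p E x : Prop :=
  cadlag_on E x /\ finite_pvar p E x.

Definition cadlag_finite_pvar_plus (r : R) E x : Prop :=
  forall p, r < p -> cadlag_finite_pvar p E x.

End path_regularity.

Section hausdorff_hoelder.
Context {R : realType} {V W : normedModType R}.

Definition dist_to_set (a : W) (B : set W) : R := inf [set `|a - b| | b in B].

(* Meant for nonempty bounded sets, for which the suprema and infima are the
   genuine ones. *)
Definition hausdorff_dist (A B : set W) : R :=
  Num.max (sup [set dist_to_set a B | a in A])
          (sup [set dist_to_set b A | b in B]).

Definition hoelder_on (gamma : R) (A : set V) (F : V -> set W) : Prop :=
  (ereal_sup [set (hausdorff_dist (F ab.1) (F ab.2) /
                     `|ab.1 - ab.2| `^ gamma)%:E |
      ab in [set ab : V * V | [/\ A ab.1, A ab.2 & ab.1 <> ab.2]]] < +oo)%E.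

Definition loc_hoelder_on (gamma : R) (U : set V) (F : V -> set W) : Prop :=
  forall K : set V, compact K -> K `<=` U -> hoelder_on gamma K F.

Definition nonempty_compact : set (set W) :=
  [set A | A !=set0 /\ compact A].

End hausdorff_hoelder.

Section young.
Context {R : realType} {d e : nat}.
Implicit Types (v : R -> 'M[R]_(e, d)) (x : R -> 'cV[R]_d).

(* As in [itv_partition 0 t s], the list s does not contain the initial point
   sigma_0 = 0 of the subdivision. *)
Definition young_sum v x (s : seq R) : 'cV[R]_e :=
  \sum_(k < size s) v (0 :: s)`_k *m (x (0 :: s)`_k.+1 - x (0 :: s)`_k).

Definition mesh (s : seq R) : R :=
  \big[Num.max/0]_(k < size s) ((0 :: s)`_k.+1 - (0 :: s)`_k).

Definition mesh_to_0 (t : R) : set_system (seq R) :=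
  filter_from [set delta : R | 0 < delta]
    (fun delta => [set s | itv_partition 0 t s /\ mesh s < delta]).

Definition is_young_integral v x (t : R) (I : 'cV[R]_e) : Prop :=
  young_sum v x @ mesh_to_0 t --> I.

(* z is a solution on [0, Ts] of dz in F(z) dx started from xi, with velocity
   v. *)
Definition solution_with_velocity (q : R) (U : set 'cV[R]_e)
    (F : 'cV[R]_e -> set 'M[R]_(e, d)) (xi : 'cV[R]_e) x (Ts : R)
    (z : R -> 'cV[R]_e) v : Prop :=
  [/\ forall t : R, t \in `[0, Ts] -> U (z t),
      cont_loc_finite_pvar q `[0, Ts] z,
      exists p : R,
        [/\ 1 <= p, 1 < p^-1 + q^-1 & loc_finite_pvar p `[0, Ts] v] &
      forall t : R, t \in `[0, Ts] ->
        (exists2 I : 'cV[R]_e, is_young_integral v x t I & z t = xi + I) /\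
        F (z t) (v t)].

End young.

(* Missing join: products of pointed topological spaces. *)
HB.instance Definition _ (T1 T2 : ptopologicalType) :=
  Pointed.on (T1 * T2)%type.

Section measurability.
Context {R : realType}.

Definition borel (T : ptopologicalType) := g_sigma_algebraType (@open T).

Definition cylinders (E : set R) (T : ptopologicalType) : set (set (R -> T)) :=
  \bigcup_(t in E)
    preimage_set_system setT (fun x : R -> T => x t)
      (@measurable _ (borel T)).

(* The functions R -> T, with the sigma-algebra generated by the evaluations at
   the points of E. *)
Definition path_space (E : set R) (T : ptopologicalType) :=
  g_sigma_algebraType (@cylinders E T).

(* Measurability of the restriction of f to D, where D carries the trace
   sigma-algebra. The library's [measurable_fun D f] is void when D is not
   measurable, as is the case of sets of continuous paths in a path space. *)
Definition trace_measurable (d1 d2 : measure_display) (T1 : measurableType d1)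
    (T2 : measurableType d2) (D : set T1) (f : T1 -> T2) : Prop :=
  forall Y, measurable Y ->
    exists2 X, measurable X & D `&` f @^-1` Y = D `&` X.

Definition input_space (d e : nat) (T : R) : Type :=
  (borel 'cV[R]_e * path_space `[0, T] 'cV[R]_d)%type.

(* U x {continuous paths of finite q-variation on [0, T]}, as a subset of the
   product of measurable spaces R^e x path_space; a path on [0, T] is
   identified with its extension by 0. *)
Definition Omega (d e : nat) (q T : R) (U : set 'cV[R]_e) :
    set (input_space d e T) :=
  [set w | [/\ U w.1,
     cont_finite_pvar q `[0, T] (w.2 : R -> 'cV[R]_d) &
     forall t : R, t \notin `[0, T] -> w.2 t = 0]].

(* (z, v) 1_[0, Ts] *)
Definition cut_path (d e : nat) (Ts : R) (z : R -> 'cV[R]_e)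
    (v : R -> 'M[R]_(e, d)) : R -> 'cV[R]_e * 'M[R]_(e, d) :=
  fun t => if t \in `[0, Ts] then (z t, v t) else (0, 0).

End measurability.

Arguments input_space R d e T : clear implicits.
Arguments Omega {R} d {e} q T U.

(* Main.v *)
Require Import Defs.
From HB Require Import structures.
From mathcomp Require Import all_boot all_order all_algebra.
From mathcomp Require Import all_classical all_reals all_analysis.
From mathcomp Require Import ring lra zify.

Set Implicit Arguments.
Unset Strict Implicit.
Unset Printing Implicit Defensive.
Import Order.TTheory GRing.Theory Num.Theory.
Import numFieldNormedType.Exports.
Local Open Scope classical_set_scope.
Local Open Scope ring_scope.

(** Euler's scheme, with the velocity selected along a binary tree of times, has
    a convergent subsequence whose limit is a solution; all choices are made by
    countable rules, so that the limit depends measurably on the data.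

    The obstruction is that a Hoelder family of compact nonconvex sets has in
    general no selection as regular as itself: choosing at each grid point the
    velocity nearest to the previous one lets the errors accumulate over all the
    steps.  Instead, at the time i / 2 ^ n the velocity is chosen near the one
    at the time obtained by clearing the lowest bit of i ([parent],
    [select_near]).  If z is 1 / q - Hoelder, a time with lowest bit at level l
    thus has a velocity within B * a ^+ l of its parent's, with
    a = 2 ^ (- gamma / q), and a velocity differs by O(a ^+ l) from the one at the
    left end of its dyadic interval of level l.  The selected path jumps at dyadic times, and the
    2 ^ l jumps of level l, of size a ^+ l, have summable r-th powers exactly
    when r > q / gamma: hence a cadlag velocity of finite r-variation for
    these r ([limit_v_finite_pvar], [limit_v_cadlag]).

    Let b = 2 ^ (- 1 / q).  The defect of the Euler scheme on a dyadic
    interval of level l, namely the increment of z minus the increment of x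
    multiplied by the velocity at its left end, is O((a * b) ^+ l): it is the sum of
    two defects of level l.+1 and of one product of a velocity increment with an
    increment of x, and 2 * (a * b) < 1 because 1 + gamma > q ([dyadic_sewing]).
    This bound returns the Hoelder bound on z that it assumed, provided x is small
    on the interval considered, whence the a priori estimate ([euler_goodP]).

    To have x 1 / q - Hoelder, time is replaced by a clock, the q-th power of the
    q-variation of x on [0, t] ([clock]).  Only rational times enter its
    definition, so that it depends measurably on x, and it is made
    right-continuous by construction.
    The levels crossed in a jump of the clock are all hit at the same time, so
    that neither x nor z moves while they are crossed ([limit_z_modulus]).  At the
    hitting times of the levels ([hit]), x has increments controlled by those of
    the levels ([hit_path_control]).

    The values of z and of v at dyadic clock times lie in a compact set, and a
    cluster point of their sequence is selected measurably
    ([measurable_subsequence_limit]).  The bounds above are closed conditions on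
    finitely many values, so they hold for the limit and extend from dyadic
    clock times to all times.  The Young integral is identified by summing the
    defects over an arbitrary subdivision: within one dyadic cell of level l they
    add up to O((a * b) ^+ l) whatever the subdivision ([chain_sum_cell]), there
    are at most 2 ^ l cells, and the terms that cross from a cell to another are
    small with the mesh ([limit_young]).

    Finally the constants depend only on a ball in which the initial point lies,
    and the horizon may be taken of the form T / 2 ^ k; the input space is thus
    cut into countably many measurable pieces on which these data are constant
    ([local_solution]). *)

(** * Events of a trace sigma-algebra *)

Section trace_measurability.
Context {d : measure_display} {S : measurableType d}.
Implicit Types (D : set S) (P Q : S -> Prop).

(** Events of the trace sigma-algebra on D, as predicates considered on D only.
    D itself need not be measurable: continuity of a path is not determined by
    countably many of its values. *)
Definition tmeas D P := exists2 X, measurable X & D `&` P = D `&` X.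

Lemma tmeas_ext D P Q :
  (forall w, D w -> P w <-> Q w) -> tmeas D P -> tmeas D Q.
Proof.
move=> PQ [X mX e]; exists X => //; rewrite -e.
by apply/seteqP; split=> w [Dw] /=; [move/(PQ _ Dw)|move/(PQ _ Dw)].
Qed.

Lemma tmeas_cst D (A : Prop) : tmeas D (fun=> A).
Proof.
have [a|na] := pselect A; [exists setT|exists set0] => //;
  by apply/seteqP; split=> w [].
Qed.

Lemma tmeas_not D P : tmeas D P -> tmeas D (fun w => ~ P w).
Proof.
move=> [X mX e]; exists (~` X); first exact: measurableC.
apply/seteqP; split=> w [Dw] /= nP; split=> // h; apply: nP.
  by have [] : (D `&` P) w by rewrite e.
by have [] : (D `&` X) w by rewrite -e.
Qed.

Lemma tmeas_ex D (I : countType) (P : I -> S -> Prop) :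
  (forall i, tmeas D (P i)) -> tmeas D (fun w => exists i, P i w).
Proof.
move=> mP; have /choice[X mX] : forall i, exists X,
    measurable X /\ D `&` P i = D `&` X.
  by move=> i; have [X mX e] := mP i; exists X.
exists (\bigcup_n if unpickle n is Some i then X i else set0).
  by apply: bigcupT_measurable => n; case: unpickle => // i; exact: (mX i).1.
apply/seteqP; split=> w [Dw].
  move=> [i Pi]; split=> //; exists (pickle i) => //=; rewrite pickleK.
  by have [] : (D `&` X i) w by rewrite -(mX i).2.
move=> [n _]; case: unpickle => // i Xi; split=> //; exists i.
by have [] : (D `&` P i) w by rewrite (mX i).2.
Qed.

Lemma tmeas_all D (I : countType) (P : I -> S -> Prop) :
  (forall i, tmeas D (P i)) -> tmeas D (fun w => forall i, P i w).
Proof.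
move=> mP; apply: (@tmeas_ext _ (fun w => ~ exists i, ~ P i w)).
  move=> w _; split=> [nP i|aP [i]]; last by apply.
  by apply: contrapT => nPi; apply: nP; exists i.
by apply/tmeas_not/tmeas_ex => i; exact/tmeas_not.
Qed.

Lemma tmeas_or D P Q : tmeas D P -> tmeas D Q -> tmeas D (fun w => P w \/ Q w).
Proof.
move=> mP mQ.
apply: (@tmeas_ext _ (fun w => exists b : bool, (if b then P else Q) w)).
  move=> w _; split=> [[[]]|[?|?]]; [by left|by right|by exists true|by exists false].
by apply: tmeas_ex => -[].
Qed.

Lemma tmeas_and D P Q : tmeas D P -> tmeas D Q -> tmeas D (fun w => P w /\ Q w).
Proof.
move=> mP mQ.
apply: (@tmeas_ext _ (fun w => forall b : bool, (if b then P else Q) w)).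
  move=> w _; split=> [h|[? ?] []] //.
  by split; [exact: (h true)|exact: (h false)].
by apply: tmeas_all => -[].
Qed.

Lemma tmeas_imp D P Q : tmeas D P -> tmeas D Q -> tmeas D (fun w => P w -> Q w).
Proof.
move=> mP mQ; apply: (@tmeas_ext _ (fun w => ~ P w \/ Q w)).
  move=> w _; split=> [[nP /nP|//]//|PQ].
  by have [/PQ|] := pselect (P w); [right|left].
by apply: tmeas_or => //; exact: tmeas_not.
Qed.

(** An event may be described separately on each piece of a countable partition
    of D into events of its trace. *)
Lemma tmeas_glue D (I : countType) (J : S -> I) (P : I -> S -> Prop) :
  (forall i, tmeas D (fun w => J w = i)) ->
  (forall i, tmeas (D `&` [set w | J w = i]) (P i)) ->
  tmeas D (fun w => P (J w) w).
Proof.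
move=> mJ mP.
apply: (@tmeas_ext _ (fun w => exists i, J w = i /\ P i w)).
  by move=> w _; split=> [[i [<-]]//|h]; exists (J w).
apply: tmeas_ex => i; have [X mX e] := mP i; have [Y mY e'] := mJ i.
exists (X `&` Y); first exact: measurableI.
apply/seteqP; split=> w [Dw] /= [].
  move=> Ji Pi; split=> //; split.
    by have [] : ((D `&` [set w | J w = i]) `&` X) w by rewrite -e.
  by have [] : (D `&` Y) w by rewrite -e'.
move=> Xw Yw; have [_ Ji] : (D `&` (fun w => J w = i)) w by rewrite e'.
split=> //; split=> //.
by have [] : ((D `&` [set w | J w = i]) `&` P i) w by rewrite e.
Qed.

Lemma tmeas_sub D D' P : D' `<=` D -> tmeas D P -> tmeas D' P.
Proof.
move=> DD [X mX e]; exists X => //.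
apply/seteqP; split=> w [Dw] /= h; split => //.
  by have [] : (D `&` X) w by rewrite -e; split=> //; exact: DD.
by have [] : (D `&` P) w by rewrite e; split=> //; exact: DD.
Qed.

(** Substitution of a discrete random index. *)
Lemma tmeas_sel D (I : countType) (J : S -> I) (P : I -> S -> Prop) :
  (forall i, tmeas D (fun w => J w = i)) -> (forall i, tmeas D (P i)) ->
  tmeas D (fun w => P (J w) w).
Proof.
move=> mJ mP; apply: tmeas_glue => // i.
by apply: tmeas_sub (mP i) => w [].
Qed.

(** Measurability for the Borel sigma-algebra of V: the preimages of open sets
    suffice. *)
Definition tmeas_fun D (V : topologicalType) (f : S -> V) :=
  forall O : set V, open O -> tmeas D (fun w => O (f w)).

Lemma tmeas_fun_ext D (V : topologicalType) (f g : S -> V) :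
  (forall w, D w -> f w = g w) -> tmeas_fun D f -> tmeas_fun D g.
Proof.
move=> fg mf O oO; apply: tmeas_ext (mf O oO) => w Dw.
by rewrite (fg _ Dw).
Qed.

Lemma tmeas_fun_cst D (V : topologicalType) (v : V) : tmeas_fun D (fun=> v).
Proof. by move=> O oO; exact: tmeas_cst. Qed.

Lemma tmeas_fun_comp D (V W : topologicalType) (f : S -> V) (h : V -> W) :
  continuous h -> tmeas_fun D f -> tmeas_fun D (h \o f).
Proof.
move=> /continuousP ch mf O oO.
exact: (mf _ (ch _ oO)).
Qed.

Lemma tmeas_fun_sel D (I : countType) (V : topologicalType) (J : S -> I)
    (f : I -> S -> V) :
  (forall i, tmeas D (fun w => J w = i)) -> (forall i, tmeas_fun D (f i)) ->
  tmeas_fun D (fun w => f (J w) w).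
Proof.
move=> mJ mf O oO.
by apply: (@tmeas_sel _ _ J (fun i w => O (f i w))) => // i; exact: mf.
Qed.

End trace_measurability.

(** Selections are made by taking the least index that fits: this rule is
    measurable. The value is 0 when no index fits. *)
Definition least (P : nat -> Prop) : nat :=
  xget 0%N [set j | P j /\ forall i, (i < j)%N -> ~ P i].

Lemma leastP (P : nat -> Prop) : (exists j, P j) ->
  P (least P) /\ forall i, (i < least P)%N -> ~ P i.
Proof.
move=> [j Pj]; rewrite /least; case: xgetP => [k _ []//|nex].
have ex : exists k, `[< P k >] by exists j; exact/asboolP.
have /asboolP Pm := ex_minnP ex.
case: (ex_minnP ex) => m /asboolP Pm' mmin.
exfalso; apply: (nex m) => /=; split=> // i im Pi.
by have := mmin i (introT (asboolP _) Pi); rewrite leqNgt im.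
Qed.

Lemma tmeas_least d (S : measurableType d) (D : set S) (P : S -> nat -> Prop) :
  (forall j, tmeas D (P^~ j)) -> forall j, tmeas D (fun w => least (P w) = j).
Proof.
move=> mP j.
apply: (@tmeas_ext _ _ _ (fun w => (P w j /\ forall i : nat, (i < j)%N -> ~ P w i)
   \/ (j = 0%N /\ forall i : nat, ~ P w i))).
  move=> w _; split.
    move=> [[Pj nPi]|[-> nP]].
      have [Pf nf] := leastP (ex_intro _ j Pj).
      have [jlt|jgt|//] := ltngtP (least (P w)) j; first by case: (nPi _ jlt).
      by case: (nf _ jgt).
    by rewrite /least; case: xgetP => // k _ [/nP].
  move=> <-; have [ex|nex] := pselect (exists j, P w j).
    by left; exact: leastP.
  right; split; last by move=> i Pi; apply: nex; exists i.
  by rewrite /least; case: xgetP => // k _ [Pk _]; case: nex; exists k.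
apply: tmeas_or.
  apply: tmeas_and => //; apply: tmeas_all => i.
  by apply: tmeas_imp; [exact: tmeas_cst|exact: tmeas_not].
apply: tmeas_and; first exact: tmeas_cst.
by apply: tmeas_all => i; exact: tmeas_not.
Qed.

(** * Measurable maps into separable normed spaces *)

Definition dense_seq {R : realType} {V : normedModType R} (c : nat -> V) :=
  forall (v : V) (eps : R), 0 < eps -> exists j, `|v - c j| < eps.

Lemma open_normP {R : realType} {V : normedModType R} (O : set V) : open O <->
  forall x, O x -> exists2 eps : R, 0 < eps & forall y, `|x - y| < eps -> O y.
Proof.
rewrite openE; split=> oO x /oO.
  by move=> /nbhs_normP[eps /= e0 h]; exists eps => // y /h.
by move=> [eps e0 h]; apply/nbhs_normP; exists eps => //.
Qed.

Lemma harmonic_lt {R : realType} (eps : R) : 0 < eps -> exists k, k.+1%:R^-1 < eps.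
Proof.
move=> e0; exists (Num.truncn eps^-1).
rewrite -[ltRHS]invrK ltf_pV2 ?posrE ?invr_gt0//.
exact: truncnS_gt.
Qed.

Section measurable_normed.
Context {R : realType} {d : measure_display} {S : measurableType d}.
Variable D : set S.

(** The limit lies in the open set O exactly when, for some k, the terms end up
    in the closed set of points whose ball of radius 1 / k.+1 is included in O. *)
Lemma tmeas_fun_lim (V : normedModType R) (f : nat -> S -> V) (g : S -> V) :
  (forall n, tmeas_fun D (f n)) ->
  (forall w, D w -> (fun n => f n w) @ \oo --> g w) -> tmeas_fun D g.
Proof.
move=> mf fg O oO; have /open_normP hO := oO.
pose C k := [set y : V | forall p, `|y - p| < k.+1%:R^-1 -> O p].
have mC k n : tmeas D (fun w => C k (f n w)).
  apply: (@tmeas_ext _ _ _ (fun w => ~ (exists p, `|f n w - p| < k.+1%:R^-1 /\ ~ O p))).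
    move=> w _; split=> [nex p pk|Ck [p [/Ck//]]].
    by apply: contrapT => nO; apply: nex; exists p.
  apply: tmeas_not; apply: (mf n [set y | exists p, `|y - p| < k.+1%:R^-1 /\ ~ O p]).
  apply/open_normP => y [p [yp nO]].
  exists (k.+1%:R^-1 - `|y - p|); first by rewrite subr_gt0.
  move=> z yz; exists p; split=> //.
  rewrite -(subrKA y) (le_lt_trans (ler_normD _ _))//.
  by rewrite [`|z - y|]distrC -ltrBrDr.
apply: (@tmeas_ext _ _ _ (fun w => exists k N : nat, forall n : nat, (N <= n)%N -> C k (f n w))).
  move=> w Dw; have /cvgrPdist_lt cfg := fg _ Dw; split.
    move=> [k [N h]].
    have k0 : 0 < k.+1%:R^-1 :> R by rewrite invr_gt0.
    have [M _ hM] := cfg _ k0.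
    apply: (h (maxn N M)); first exact: leq_maxl.
    by rewrite distrC; apply: hM => /=; exact: leq_maxr.
  move=> /hO[eps e0 h].
  have [k kh] := harmonic_lt (divr_gt0 e0 (ltr0n _ 2)).
  have k0 : 0 < k.+1%:R^-1 :> R by rewrite invr_gt0.
  have [N _ hN] := cfg _ k0; exists k, N => n Nn p fp.
  apply: h; rewrite -(subrKA (f n w)) (le_lt_trans (ler_normD _ _))//.
  by rewrite (splitr eps) ltrD// (lt_trans _ kh)//; exact: hN.
apply: tmeas_ex => k; apply: tmeas_ex => N; apply: tmeas_all => n.
by apply: tmeas_imp => //; exact: tmeas_cst.
Qed.

(** An open set of a product of separable spaces is a countable union of boxes. *)
Lemma tmeas_fun_pair (V W : normedModType R) (cV : nat -> V) (cW : nat -> W)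
    (f : S -> V) (g : S -> W) :
  dense_seq cV -> dense_seq cW -> tmeas_fun D f -> tmeas_fun D g ->
  tmeas_fun D (fun w => (f w, g w)).
Proof.
move=> dV dW mf mg O /open_normP hO.
pose Bx k i j := forall p, `|cV i - p.1| < k.+1%:R^-1 -> `|cW j - p.2| < k.+1%:R^-1 -> O p.
apply: (@tmeas_ext _ _ _ (fun w => exists k i j : nat, Bx k i j /\
   (`|cV i - f w| < k.+1%:R^-1 /\ `|cW j - g w| < k.+1%:R^-1))).
  move=> w _; split=> [[k [i [j [h [fi gj]]]]]|]; first exact: (h (f w, g w)).

  move=> /hO[eps e0 h]; have [k kh] := harmonic_lt (divr_gt0 e0 (ltr0n _ 2)).
  have k0 : 0 < k.+1%:R^-1 :> R by rewrite invr_gt0.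
  have [i fi] := dV (f w) _ k0; have [j gj] := dW (g w) _ k0.
  exists k, i, j; split; last by rewrite ![`|_ - f w|]distrC ![`|_ - g w|]distrC.
  move=> p pi pj; apply: h.
  rewrite prod_normE gt_max; apply/andP; split=> /=.
    rewrite -(subrKA (cV i)) (le_lt_trans (ler_normD _ _))//.
    by rewrite (splitr eps) ltrD// (lt_trans _ kh).
  rewrite -(subrKA (cW j)) (le_lt_trans (ler_normD _ _))//.
  by rewrite (splitr eps) ltrD// (lt_trans _ kh).
have ob (U : normedModType R) (u : U) k : open [set v : U | `|u - v| < k.+1%:R^-1].
  apply/open_normP => y /= uy; exists (k.+1%:R^-1 - `|u - y|); first by rewrite subr_gt0.
  move=> z yz /=; rewrite -(subrKA y) (le_lt_trans (ler_normD _ _))//.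
  by rewrite addrC -ltrBrDr.
apply: tmeas_ex => k; apply: tmeas_ex => i; apply: tmeas_ex => j.
apply: tmeas_and; first exact: tmeas_cst.
by apply: tmeas_and; [exact: (mf _ (ob _ _ _))|exact: (mg _ (ob _ _ _))].
Qed.

Lemma tmeas_fun2 (V W : normedModType R) (X : topologicalType) (cV : nat -> V)
    (cW : nat -> W) (f : S -> V) (g : S -> W) (h : V * W -> X) :
  dense_seq cV -> dense_seq cW -> continuous h ->
  tmeas_fun D f -> tmeas_fun D g -> tmeas_fun D (fun w => h (f w, g w)).
Proof.
move=> dV dW ch mf mg; exact: tmeas_fun_comp ch (tmeas_fun_pair dV dW mf mg).
Qed.

End measurable_normed.

Lemma matrix_norm_lt {R : realType} m n (A : 'M[R]_(m, n)) (eps : R) :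
  0 < eps -> (forall i j, `|A i j| < eps) -> `|A| < eps.
Proof.
move=> e0 h; rewrite /Num.norm/= mx_normrE; by apply/bigmax_ltP; split=> // -[i j] _; exact: h.
Qed.

Lemma matrix_norm_le {R : realType} m n (A : 'M[R]_(m, n)) (eps : R) :
  0 <= eps -> (forall i j, `|A i j| <= eps) -> `|A| <= eps.
Proof.
move=> e0 h; rewrite /Num.norm/= mx_normrE; by apply/bigmax_leP; split=> // -[i j] _; exact: h.
Qed.

Lemma entry_norm_le {R : realType} m n (A : 'M[R]_(m, n)) i j : `|A i j| <= `|A|.
Proof.
rewrite [leRHS]/Num.norm/= mx_normrE.
exact: (@le_bigmax _ _ _ 0 (fun ij => `|A ij.1 ij.2|) (i, j)).
Qed.

Lemma mulmx_norm_le {R : realType} m n p (A : 'M[R]_(m, n)) (B : 'M[R]_(n, p)) :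
  `|A *m B| <= n%:R * `|A| * `|B|.
Proof.
apply: matrix_norm_le => [|i j]; first by rewrite !mulr_ge0.
rewrite mxE (le_trans (ler_norm_sum _ _ _))//.
have -> : n%:R * `|A| * `|B| = \sum_(k < n) `|A| * `|B|.
  by rewrite sumr_const card_ord -mulrA mulr_natl.
by apply: ler_sum => k _; rewrite normrM ler_pM// entry_norm_le.
Qed.

Definition rat_matrix {R : realType} m n (j : nat) : 'M[R]_(m, n) :=
  if unpickle j is Some A then map_mx ratr (A : 'M[rat]_(m, n)) else 0.

Lemma dense_rat_matrix {R : realType} m n : dense_seq (@rat_matrix R m n).
Proof.
move=> v eps e0.
have h i j : exists r : rat, `|v i j - ratr r| < eps.
  have [r] := @rat_in_itvoo R (v i j - eps) (v i j + eps) ltac:(lra).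
  by rewrite in_itv/= => /andP[h1 h2]; exists r; rewrite ltr_norml; lra.
have /choice[r hr] : forall ij, exists r : rat, `|v ij.1 ij.2 - ratr r| < eps.
  by move=> [i j]; exact: h.
exists (pickle (\matrix_(i, j) r (i, j))).
rewrite /rat_matrix pickleK; apply: matrix_norm_lt => // i j.
by rewrite !mxE; exact: hr (i, j).
Qed.

Definition rat_real {R : realType} (j : nat) : R :=
  if unpickle j is Some r then ratr (r : rat) else 0.

Lemma dense_rat_real {R : realType} : dense_seq (@rat_real R : nat -> R^o).
Proof.
move=> v eps e0.
have [r] := @rat_in_itvoo R (v - eps) (v + eps) ltac:(lra).
rewrite in_itv/= => /andP[h1 h2]; exists (pickle r).
by rewrite /rat_real pickleK ltr_norml; lra.
Qed.

Section measurable_real.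
Context {R : realType} {d : measure_display} {S : measurableType d}.
Variable D : set S.

Lemma tmeas_fun_ltP (f : S -> R^o) :
  (forall a, tmeas D (fun w => f w < a)) -> tmeas_fun D f.
Proof.
move=> mf O /open_normP hO.
apply: (@tmeas_ext _ _ _ (fun w => exists p q : rat,
  (forall x : R, ratr p <= x < ratr q -> O x) /\ (f w < ratr q /\ ~ (f w < ratr p)))).
  move=> w _; split=> [[p [q [h [fq fp]]]]|].
    by apply: h; rewrite fq andbT leNgt; exact/negP.
  move=> /hO[eps e0 h].
  have [p] := @rat_in_itvoo R (f w - eps) (f w) ltac:(lra).
  rewrite in_itv/= => /andP[p1 p2].
  have [q] := @rat_in_itvoo R (f w) (f w + eps) ltac:(lra).
  rewrite in_itv/= => /andP[q1 q2].
  exists p, q; split; last by split=> //; apply/negP; rewrite -leNgt ltW.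
  by move=> x /andP[? ?]; apply: h; rewrite ltr_norml; apply/andP; split; lra.
apply: tmeas_ex => p; apply: tmeas_ex => q; apply: tmeas_and.
  exact: tmeas_cst.
by apply: tmeas_and => //; exact: tmeas_not.
Qed.

Lemma tmeas_lt (f : S -> R^o) a : tmeas_fun D f -> tmeas D (fun w => f w < a).
Proof. by move=> mf; apply: (mf [set x | x < a]); exact: open_lt. Qed.

Lemma tmeas_gt (f : S -> R^o) a : tmeas_fun D f -> tmeas D (fun w => a < f w).
Proof. by move=> mf; apply: (mf [set x | a < x]); exact: open_gt. Qed.

End measurable_real.

(** * Measurable selection of a convergent subsequence *)

(** Bolzano and Weierstrass, with the cluster point described by distances. *)
Lemma compact_cluster_seq {R : realType} {W : normedModType R} (C : set W)
    (s : nat -> W) : compact C -> (forall n, C (s n)) ->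
  exists p, forall eps : R, 0 < eps -> forall N : nat, exists2 n,
    (N <= n)%N & `|p - s n| < eps.
Proof.
move=> cC Cs.
have Cf : (s @ \oo) C by exists 0%N => // n _; exact: Cs.
have [p [Cp clp]] := cC (s @ \oo) _ Cf.
exists p => eps e0 N.
have := clp (s @` [set n | (N <= n)%N]) (ball p eps).
case.
- by exists N => // n Nn; exists n.
- exact: nbhsx_ballx.
- by move=> _ [[n Nn <-]]; rewrite -ball_normE => h; exists n.
Qed.

Section diagonal_extraction.
Context {R : realType} {W : normedModType R} {I : countType}.
Variables (c : nat -> W) (i0 : I) (g : nat -> I -> W).

(** Stage k treats the coordinate i with precision 1 / m.+1, where k codes
    (m, i): each coordinate is treated with every precision. *)
Definition stage_code (k : nat) : nat * I := odflt (0%N, i0) (unpickle k).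

Definition near_center (k n j : nat) :=
  `|g n (stage_code k).2 - c j| < (stage_code k).1.+1%:R^-1.

(** The first center of a ball that contains infinitely many of the terms that
    remain. *)
Definition center_of (k : nat) (Nk : nat -> Prop) : nat :=
  least (fun j => forall m, exists n, (m <= n)%N /\ (Nk n /\ near_center k n j)).

(** The indices that remain after k stages; they form a decreasing sequence of
    infinite sets. *)
Fixpoint stage (k : nat) : nat -> Prop :=
  if k is k'.+1 then
    fun n => stage k' n /\ near_center k' n (center_of k' (stage k'))
  else fun=> True.

Definition center k := center_of k (stage k).

Lemma stage_le k k' n : (k <= k')%N -> stage k' n -> stage k n.
Proof.
elim: k' => [|k' ih]; first by rewrite leqn0 => /eqP->.
rewrite leq_eqVlt => /predU1P[->//|/ih h []/h//].
Qed.

Hypothesis dc : dense_seq c.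
Variable C : set W.
Hypothesis cC : compact C.
Hypothesis Cg : forall n i, C (g n i).

Lemma stage_infinite k m : exists2 n, (m <= n)%N & stage k n.
Proof.
elim: k m => [m|k ih m]; first by exists m.
suff /leastP[+ _] : exists j, forall m, exists n,
    (m <= n)%N /\ (stage k n /\ near_center k n j).
  by move=> /(_ m)[n [mn [sn nn]]]; exists n.
have /choice[s hs] : forall m, exists n, (m <= n)%N /\ stage k n.
  by move=> m'; have [n mn sn] := ih m'; exists n.
have [p hp] := compact_cluster_seq (s := fun n => g (s n) (stage_code k).2) cC
  (fun n => Cg _ _).
pose eps : R := (stage_code k).1.+1%:R^-1.
have e0 : 0 < eps by rewrite invr_gt0.
have e20 : 0 < eps / 2 by rewrite divr_gt0.
have [j hj] := dc p e20; exists j => m'.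
have [n mn hn] := hp _ e20 m'; exists (s n); split; last split.
- by rewrite (leq_trans mn)//; exact: (hs n).1.
- exact: (hs n).2.
- rewrite /near_center -(subrKA p) (le_lt_trans (ler_normD _ _))//.
  by rewrite -/eps (splitr eps) ltrD// distrC.
Qed.

(** The centers chosen for a coordinate converge, and the diagonal
    subsequence converges to the same limit. The limit is thus a function of the
    centers, which depend measurably on the sequence, whereas the
    subsequence is merely known to exist. *)
Lemma diagonal_cvg : exists phi : nat -> nat, (forall k, (k <= phi k)%N) /\
  forall i, let L := lim ((fun m => c (center (pickle (m, i)))) @ \oo) in
    (fun m => c (center (pickle (m, i)))) @ \oo --> L /\
    (fun k => g (phi k) i) @ \oo --> L.
Proof.
have /choice[phi hphi] : forall k, exists n, (k <= n)%N /\ stage k n.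
  by move=> k; have [n kn sn] := stage_infinite k k; exists n.
exists phi; split=> [k|i]; first exact: (hphi k).1.
have near m k : (pickle (m, i) < k)%N ->
    `|g (phi k) i - c (center (pickle (m, i)))| < m.+1%:R^-1.
  move=> /stage_le/(_ (hphi k).2)[_].
  by rewrite /near_center /stage_code pickleK.
have [p hp] := compact_cluster_seq (s := fun k => g (phi k) i) cC (fun n => Cg _ _).
have pc m : `|p - c (center (pickle (m, i)))| <= m.+1%:R^-1.
  apply/ler_addgt0Pl => e e0; have [k kn hk] := hp _ e0 (pickle (m, i)).+1.
  rewrite -(subrKA (g (phi k) i)) (le_trans (ler_normD _ _))//.
  by rewrite lerD// ltW// near.
have cp : (fun m => c (center (pickle (m, i)))) @ \oo --> p.
  apply/cvgrPdist_lt => e e0; have [k kh] := harmonic_lt e0.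
  exists k => // m /= km; rewrite (le_lt_trans (pc m))// (le_lt_trans _ kh)//.
  by rewrite lef_pV2 ?posrE// ler_nat.
have Lp := cvg_lim (@norm_hausdorff _ W) cp.
rewrite /= Lp; split=> //.
apply/cvgrPdist_lt => e e0; have [m mh] := harmonic_lt (divr_gt0 e0 (ltr0n _ 2)).
exists (pickle (m, i)).+1 => // k /= mk.
rewrite -(subrKA (c (center (pickle (m, i))))) (le_lt_trans (ler_normD _ _))//.
rewrite (splitr e) ltrD// (le_lt_trans _ mh)//.
by rewrite distrC ltW// near.
Qed.

End diagonal_extraction.

(** Measurable version of the extraction of a convergent subsequence from a
    sequence of families with values in a compact set. *)
Lemma measurable_subsequence_limit {R : realType} d (S : measurableType d) (D : set S)
    (W : normedModType R) (I : countType) (i0 : I) (c : nat -> W) (C : set W)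
    (f : nat -> I -> S -> W) :
  dense_seq c -> compact C ->
  (forall n i, tmeas_fun D (f n i)) ->
  (forall n i w, D w -> C (f n i w)) ->
  exists L : I -> S -> W, (forall i, tmeas_fun D (L i)) /\
    forall w, D w -> exists phi : nat -> nat, (forall k, (k <= phi k)%N) /\
      forall i, (fun k => f (phi k) i w) @ \oo --> L i w.
Proof.
move=> dc cC mf Cf.
pose g w n i := f n i w.
have ms k : (forall n, tmeas D (fun w => stage c i0 (g w) k n)) /\
   (forall j, tmeas D (fun w => center c i0 (g w) k = j)).
  have mnear k' n j : tmeas D (fun w => near_center c i0 (g w) k' n j).
    apply: (mf _ _ [set x | `|x - c j| < (stage_code i0 k').1.+1%:R^-1]).
    apply/open_normP => y /= hy; exists ((stage_code i0 k').1.+1%:R^-1 - `|y - c j|).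
      by rewrite subr_gt0.
    move=> z yz; rewrite -(subrKA y) (le_lt_trans (ler_normD _ _))//.
    by rewrite [`|z - y|]distrC -ltrBrDr.
  have mc k' : (forall n, tmeas D (fun w => stage c i0 (g w) k' n)) ->
     (forall j, tmeas D (fun w => center c i0 (g w) k' = j)).
    move=> mk; apply: tmeas_least => j; apply: tmeas_all => m; apply: tmeas_ex => n.
    by apply: tmeas_and; [exact: tmeas_cst|exact: tmeas_and].
  elim: k => [|k [ih1 ih2]].
    have m0 n : tmeas D (fun w => stage c i0 (g w) 0 n) by exact: tmeas_cst.
    by split=> //; exact: mc.
  suff h n : tmeas D (fun w => stage c i0 (g w) k.+1 n) by split=> //; exact: mc.
  apply: tmeas_and; first exact: ih1.
  by apply: (tmeas_sel (P := fun j w => near_center c i0 (g w) k n j)).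
exists (fun i w => lim ((fun m => c (center c i0 (g w) (pickle (m, i)))) @ \oo)).
have key w : D w -> _ := fun Dw => diagonal_cvg i0 dc cC (fun n i => Cf n i w Dw).
split=> [i|w Dw].
  apply: (tmeas_fun_lim (f := fun m w => c (center c i0 (g w) (pickle (m, i))))).
    move=> m; apply: (tmeas_fun_sel (f := fun j _ => c j)) => j; first exact: (ms _).2.
    exact: tmeas_fun_cst.
  by move=> w Dw; have [phi [_ /(_ i)[]]] := key w Dw.
have [phi [phile h]] := key w Dw; exists phi; split=> // i.
exact: (h i).2.
Qed.

(** * Hoelder maps with compact values *)

Lemma lipschitz_continuous {R : realType} {V W : normedModType R} (K : R) (f : V -> W) :
  0 <= K -> (forall x y, `|f x - f y| <= K * `|x - y|) -> continuous f.
Proof.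
move=> K0 lf x; apply/cvgrPdist_lt => e e0.
have p0 : 0 < K + 1 by rewrite ltr_wpDl.
apply/nbhs_normP; exists (e / (K + 1)) => /=; first exact: divr_gt0.
move=> y /= xy; rewrite ltr_pdivlMr// mulrC in xy.
by rewrite (le_lt_trans (lf _ _))// (le_lt_trans _ xy)// ler_wpM2r// lerDl.
Qed.

Lemma compact_matrix_ball {R : realType} m n (c : 'M[R]_(m, n)) (r : R) :
  compact [set A | `|A - c| <= r].
Proof.
have [r0|r0] := ltP r 0.
  rewrite (_ : [set _ | _] = set0); first exact: compact0.
  apply/seteqP; split=> A //= h.
  by have := le_lt_trans h r0; rewrite ltNge normr_ge0.
have -> : [set A | `|A - c| <= r] =
    (fun v => vec_mx v + c) @` [set v : 'rV[R]_(m * n) | `|v| <= r].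
  apply/seteqP; split=> A /=.
    move=> h; exists (mxvec (A - c)); last by rewrite mxvecK subrK.
    apply: matrix_norm_le => // i j; rewrite ord1 {i}.
    case/mxvec_indexP: j => i j; rewrite mxvecE.
    exact: le_trans (entry_norm_le _ _ _) h.
  move=> [v vr <-]; rewrite addrK; apply: matrix_norm_le => // i j.
  by rewrite mxE (le_trans _ vr)// entry_norm_le.
apply: continuous_compact.
  apply: continuous_subspaceT; apply: (lipschitz_continuous ler01) => x y.
  rewrite mul1r opprD addrACA subrr addr0 -linearB/=.
  by apply: matrix_norm_le => // i j; rewrite mxE entry_norm_le.
apply: bounded_closed_compact.
  by exists r; split; [exact: num_real|move=> M rM x /= /le_trans; apply; exact: ltW].
rewrite (_ : [set _ | _] = (fun v : 'rV[R]_(m * n) => `|v|) @^-1` [set x | x <= r]) //.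
apply: closed_comp; last exact: closed_le.
by move=> x _; exact: norm_continuous.
Qed.

(** The consequence of the Hausdorff estimate that serves for selections: each
    point of F a has an almost nearest point in F b. *)
Lemma hoelder_on_near {R : realType} {V W : normedModType R} (gamma : R)
    (A : set V) (F : V -> set W) :
  (forall a, A a -> nonempty_compact (F a)) -> hoelder_on gamma A F ->
  exists2 K : R, 0 <= K & forall a b p (eta : R), A a -> A b -> F a p -> 0 < eta ->
    exists2 p', F b p' & `|p - p'| < K * `|a - b| `^ gamma + eta.
Proof.
move=> cF; rewrite /hoelder_on => hF.
have [K K0 hK] : exists2 K : R, 0 <= K & forall a b, A a -> A b -> a <> b ->
    hausdorff_dist (F a) (F b) <= K * `|a - b| `^ gamma.
  set E := [set _ | _ in _] in hF.
  have [k hk] : exists k : R, forall x, E x -> (x <= k%:E)%E.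
    move: hF; case sE : (ereal_sup E) => [k| |] // _.
      by exists k => x Ex; rewrite -sE; exact: ereal_sup_ubound.
    exists 0 => x Ex; have := ereal_sup_ubound Ex.
    by rewrite sE leeNy_eq => /eqP->; rewrite leNye.
  exists (Num.max k 0); first by rewrite le_max lexx orbT.
  move=> a b Aa Ab ab.
  have : E (hausdorff_dist (F a) (F b) / `|a - b| `^ gamma)%:E.
    by exists (a, b).
  move=> /hk; rewrite lee_fin.
  have ab0 : 0 < `|a - b| `^ gamma.
    by rewrite powR_gt0// normr_gt0 subr_eq0; exact/eqP.
  rewrite ler_pdivrMr// => /le_trans; apply; apply: ler_wpM2r; first exact: ltW.
  by rewrite le_max lexx.
exists K => // a b p eta Aa Ab Fp eta0.
have [->|/eqP ab] := eqVneq b a.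
  by exists p => //; rewrite subrr normr0 ltr_wpDl// mulr_ge0// powR_ge0.
have h := hK _ _ Aa Ab (nesym ab).
have [[b0 Fb0] cB] := cF _ Ab.
have [_ /compact_bounded[M [_ hM]]] := cF _ Aa.
have lbn x (B : set W) : has_lbound [set `|x - b| | b in B].
  by exists 0 => _ [y _ <-].
have hd : dist_to_set p (F b) <= K * `|a - b| `^ gamma.
  apply: le_trans h; rewrite /hausdorff_dist le_max; apply/orP; left.
  apply: ub_le_sup; last by exists p.
  exists (M + 1 + `|b0|) => _ [x Fx <-].
  apply: (@le_trans _ _ `|x - b0|).
    by apply: ge_inf => //; exists b0.
  by rewrite (le_trans (ler_normB _ _))// lerD2r hM// ltrDl.
have hi : has_inf [set `|p - b| | b in F b].
  by split=> //; exists `|p - b0|, b0.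
have [_ [p' Fp' <-] hp'] := inf_adherent eta0 hi.
exists p' => //; rewrite (lt_le_trans hp')// lerD2r //.
Qed.

Lemma hoelder_on_bounded {R : realType} {V W : normedModType R} (gamma : R)
    (A : set V) (F : V -> set W) (c : V) (r : R) : 0 <= gamma ->
  (forall a, A a -> nonempty_compact (F a)) -> hoelder_on gamma A F ->
  A c -> (forall a, A a -> `|a - c| <= r) ->
  exists2 M : R, 0 <= M & forall a p, A a -> F a p -> `|p| <= M.
Proof.
move=> g0 cF hF Ac Ar.
have [K K0 hK] := hoelder_on_near cF hF.
have [_ /compact_bounded[M [_ hM]]] := cF _ Ac.
have {}hM p : F c p -> `|p| <= `|M| + 1.
  by move=> Fp; apply: hM => //; rewrite (le_lt_trans (ler_norm _))// ltrDl.
have r0 : 0 <= r by apply: le_trans (Ar _ Ac).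
exists (K * r `^ gamma + 1 + (`|M| + 1)) => [|a p Aa Fp].
  by rewrite !addr_ge0// mulr_ge0// powR_ge0.
have [p' Fp' pp'] := hK _ _ _ _ Aa Ac Fp ltr01.
rewrite -(subrK p' p) (le_trans (ler_normD _ _))// lerD ?hM//.
rewrite (le_trans (ltW pp'))// lerD2r ler_wpM2l// ge0_ler_powR// ?nnegrE//.
exact: Ar.
Qed.

Lemma compact_adherent {R : realType} {W : normedModType R} (B : set W) (p : W) :
  compact B -> (forall eps : R, 0 < eps -> exists2 p', B p' & `|p - p'| < eps) -> B p.
Proof.
move=> cB h; have /closure_id -> := compact_closed (@norm_hausdorff _ W) cB.
move=> N /nbhs_normP[e /= e0 eN].
by have [p' Bp' pp'] := h _ e0; exists p'; split=> //; exact: eN.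
Qed.

(** * Sums of p-th powers of increments *)

Section powR_root.
Context {R : realType}.
Implicit Types (X Z q : R).

Lemma powR_root q X : 0 < q -> 0 <= X -> (X `^ q) `^ q^-1 = X.
Proof. by move=> q0 X0; rewrite -powRrM mulfV ?powRr1// gt_eqF. Qed.

Lemma powR_rootV q X : 0 < q -> 0 <= X -> (X `^ q^-1) `^ q = X.
Proof. by move=> q0 X0; rewrite -powRrM mulVf ?powRr1// gt_eqF. Qed.

Lemma powR_le_root q X Z : 0 < q -> 0 <= X -> X `^ q <= Z -> X <= Z `^ q^-1.
Proof.
move=> q0 X0 h; rewrite -[leLHS](powR_root q0 X0).
have Z0 : 0 <= Z by apply: le_trans h; exact: powR_ge0.
by apply: ge0_ler_powR => //; rewrite ?invr_ge0 ?nnegrE ?powR_ge0// ltW.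
Qed.

Lemma root_le_powR q X Z : 0 < q -> 0 <= X -> 0 <= Z -> X <= Z `^ q^-1 -> X `^ q <= Z.
Proof.
move=> q0 X0 Z0 h; rewrite -[leRHS](powR_rootV q0 Z0).
by apply: ge0_ler_powR => //; rewrite ?nnegrE ?powR_ge0// ltW.
Qed.

Lemma powR_eq0_le q X : 0 < q -> 0 <= X -> X `^ q <= 0 -> X = 0.
Proof.
move=> q0 X0 /(powR_le_root q0 X0); rewrite powR0 ?invr_eq0 ?gt_eqF// => h.
by apply/eqP; rewrite eq_le h.
Qed.

End powR_root.

Section pvar_sums.
Context {R : realType} {V : normedModType R}.
Implicit Types (p : R) (E : set R) (x : R -> V).

Lemma pvar_sum_ge0 p x s : 0 <= pvar_sum p x s.
Proof. by apply: sumr_ge0 => k _; exact: powR_ge0. Qed.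

Lemma pvar_sum_rcons2 p x s u t :
  pvar_sum p x (rcons (rcons s u) t) = pvar_sum p x (rcons s u) + `|x t - x u| `^ p.
Proof.
have nthe i : (i <= size s)%N -> (rcons (rcons s u) t)`_i = (rcons s u)`_i.
  by rewrite nth_rcons size_rcons ltnS => ->.
rewrite /pvar_sum !size_rcons/= big_ord_recr/=; congr (_ + _).
  by apply: eq_bigr => k _; rewrite !nthe// ltnW.
rewrite (nthe (size s))// [(rcons s u)`_ _]nth_rcons ltnn eqxx.
by rewrite nth_rcons size_rcons ltnn eqxx.
Qed.

Lemma pvar_sum_rcons_ge p x s u : pvar_sum p x s <= pvar_sum p x (rcons s u).
Proof.
case/lastP: s => [|s t].
  by rewrite /pvar_sum !big_ord0.
by rewrite pvar_sum_rcons2 lerDl powR_ge0.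
Qed.

Lemma finite_pvarP p E x : 0 < p -> finite_pvar p E x <->
  exists C : R, forall s : seq R, sorted <%R s -> (forall u, u \in s -> E u) ->
    pvar_sum p x s <= C.
Proof.
move=> p0; rewrite /finite_pvar /pvar; set S := [set _ | _ in _]; split.
  have [h|h] := ltP (ereal_sup S) +oo%E; last first.
    move: h; by rewrite leye_eq => /eqP->; rewrite poweRyr ?invr_eq0 ?gt_eqF.
  move=> _; move: h; case sS : (ereal_sup S) => [c| |]// _.
    exists c => s ss sE; rewrite -lee_fin -sS; apply: ereal_sup_ubound.
    by exists s.
  have S0 : S (pvar_sum p x [::])%:E by exists [::].
  by move: (ereal_sup_ubound S0); rewrite sS leeNy_eq.
move=> [C hC]; apply: poweR_lty; apply: (@le_lt_trans _ _ C%:E); last exact: ltry.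
by apply: ge_ereal_sup => _ [s [ss sE] <-]; rewrite lee_fin hC.
Qed.

(** If the powers of the increments are controlled by those of a bounded
    function G, a p-variation sum telescopes. The error eta per term
    serves for controls G that depend on a level of approximation, which is sent
    to infinity for a fixed subdivision. *)
Lemma pvar_sum_control p E x (G : R -> R) (eta m M : R) s : 0 <= eta ->
  (forall u t, E u -> E t -> u < t -> `|x t - x u| `^ p <= G t - G u + eta) ->
  (forall u, E u -> m <= G u <= M) -> m <= M ->
  sorted <%R s -> (forall u, u \in s -> E u) ->
  pvar_sum p x s <= M - m + (size s)%:R * eta.
Proof.
move=> eta0 hG GM mM.
suff h : forall s, sorted <%R s -> (forall u, u \in s -> E u) ->
   pvar_sum p x s <= G (last 0 s) - m + (size s)%:R * eta \/ s = [::].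
  move=> ss sE; have [hs|->] := h s ss sE.
    case: s ss sE hs => [|u s] ss sE hs.
      by rewrite /pvar_sum big_ord0 mul0r addr0 subr_ge0.
    apply: (le_trans hs); rewrite lerD2r lerD2r/=.
    by have /andP[] := GM _ (sE _ (mem_last u s)).
  by rewrite /pvar_sum big_ord0 mul0r addr0 subr_ge0.
elim/last_ind => [|{}s t ih]; first by right.
move=> ss sE; left.
case/lastP: s ih ss sE => [_ ss sE|s u ih ss sE].
  rewrite /pvar_sum big_ord0 /= addr_ge0 ?mulr_ge0// subr_ge0.
  by have /andP[] := GM t (sE t (mem_head _ _)).
have ut : u < t.
  move: ss; case: (s) => [|r s'] /=; first by rewrite andbT.
  by rewrite rcons_path last_rcons => /andP[].
have ss' : sorted <%R (rcons s u).
  by move: ss; rewrite -cats1 => /cat_sorted2[].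
have sE' w : w \in rcons s u -> E w.
  by move=> h; apply: sE; rewrite mem_rcons inE h orbT.
have [h|] := ih ss' sE'; last by case: (s).
rewrite pvar_sum_rcons2 last_rcons.
rewrite last_rcons in h.
have := hG u t (sE' u _) (sE t _) ut.
rewrite mem_rcons mem_head => /(_ isT); rewrite mem_rcons mem_head => /(_ isT) hut.
rewrite [size (rcons _ t)]size_rcons -natr1 mulrDl mul1r.
lra.
Qed.

End pvar_sums.

Definition unif_cont_on {R : realType} {V : normedModType R} (E : set R) (x : R -> V) :=
  forall eta : R, 0 < eta -> exists2 delta : R, 0 < delta &
    forall s t, E s -> E t -> `|s - t| < delta -> `|x s - x t| < eta.

Lemma continuous_unif_cont_on {R : realType} {V : normedModType R} (T : R) (x : R -> V) :
  {within `[0, T], continuous x} -> unif_cont_on `[0, T] x.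
Proof.
move=> /subspace_continuousP cx eta eta0; apply: contrapT => nex.
have /choice[st hst] : forall n : nat, exists st : R * R,
    [/\ `[0, T]%classic st.1, `[0, T]%classic st.2, `|st.1 - st.2| < n.+1%:R^-1
     & eta <= `|x st.1 - x st.2|].
  move=> n; apply: contrapT => nst; apply: nex; exists n.+1%:R^-1.
    by rewrite invr_gt0.
  move=> s t Es Et hst; rewrite ltNge; apply/negP => h.
  by apply: nst; exists (s, t).
have cs n : `[0, T]%classic (st n).1 by have [] := hst n.
have [p hp] := compact_cluster_seq (W := R^o) (@segment_compact R 0 T) cs.
have Ep : `[0, T]%classic p.
  apply: (compact_adherent (W := R^o) (@segment_compact R 0 T)) => eps e0.
  by have [n _ hn] := hp _ e0 0%N; exists (st n).1.
have /cvgrPdist_lt := cx p Ep.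
move=> /(_ _ (divr_gt0 eta0 (ltr0n _ 2))); rewrite near_withinE.
move=> /nbhs_normP[r /= r0 hr].
have r20 : 0 < r / 2 by rewrite divr_gt0.
have [k hk] := harmonic_lt r20.
have [n kn pn] := hp _ r20 k.
have [Es Et hst' hx] := hst n.
have hn : `|(st n).1 - (st n).2| < r / 2.
  apply: (lt_trans hst'); apply: le_lt_trans hk.
  by rewrite lef_pV2 ?posrE// ler_nat ltnS.
have h1 : `|x p - x (st n).1| < eta / 2.
  by apply: hr => //=; rewrite (lt_trans pn)// ltr_pdivrMr// ltr_pMr// ltr1n.
have h2 : `|x p - x (st n).2| < eta / 2.
  apply: hr => //=; rewrite -(subrKA (st n).1) (le_lt_trans (ler_normD _ _))//.
  by rewrite (splitr r) ltrD.
move: hx; apply/negP; rewrite -ltNge -(subrKA (x p)) (le_lt_trans (ler_normD _ _))//.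
by rewrite (splitr eta) ltrD// distrC.
Qed.

(** * The q-variation clock and its hitting times *)

Section clock.
Context {R : realType} {V : normedModType R}.
Variables (q T : R).

(** The times are smaller than t, so that t, when rational, can be added
    at the end of a subdivision without repeating its last point. *)
Definition rat_times (t : R) : set (seq rat) :=
  [set s | sorted <%R s /\ forall r : rat, r \in s -> 0 <= (ratr r : R) < t].

Definition rat_qvar (x : R -> V) (t : R) : R :=
  sup [set pvar_sum q x (map ratr s) | s in rat_times t].

(** The right limit of the variation. It makes the clock right-continuous by
    construction. *)
Definition rat_qvar_right (x : R -> V) (t : R) : R :=
  inf [set rat_qvar x u | u in [set u | t < u <= T]].

Definition clock (x : R -> V) (t : R) : R := rat_qvar_right x t - rat_qvar_right x 0.

Section path.
Variable x : R -> V.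
Hypothesis q0 : 0 < q.
Hypothesis T0 : 0 < T.
Hypothesis ux : unif_cont_on `[0, T] x.
Variable C : R.
Hypothesis xC : forall s : seq R, sorted <%R s -> (forall u, u \in s -> `[0, T]%classic u) ->
    pvar_sum q x s <= C.

Let has_sup_qvar t : t <= T ->
  has_sup [set pvar_sum q x (map ratr s) | s in rat_times t].
Proof.
move=> tT; split; first by exists (pvar_sum q x [::]), [::].
exists C => _ [s [ss st] <-]; apply: xC.
  by rewrite sorted_map; apply: sub_sorted ss => r1 r2; rewrite /= ltr_rat.
move=> u /mapP[r /st/andP[r0 rt] ->] /=.
by rewrite in_itv/= r0 (le_trans (ltW rt)).
Qed.

Lemma rat_qvar_ge0 t : t <= T -> 0 <= rat_qvar x t.
Proof.
move=> /has_sup_qvar[_ h].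
apply: (@le_trans _ _ (pvar_sum q x [::])); first exact: pvar_sum_ge0.
by apply: ub_le_sup => //; exists [::].
Qed.

Lemma rat_qvar_nd s t : s <= t -> t <= T -> rat_qvar x s <= rat_qvar x t.
Proof.
move=> st tT; apply: ge_sup; first exact: (has_sup_qvar (le_trans st tT)).1.
move=> _ [l [sl lt] <-]; apply: ub_le_sup; first exact: (has_sup_qvar tT).2.
exists l => //; split=> // r /lt/andP[-> /= rs]; exact: lt_le_trans st.
Qed.

(** Two points added at the end of a subdivision contribute their increment. *)
Lemma rat_qvar_incr (p p' : rat) t : 0 <= ratr p :> R -> ratr p < ratr p' :> R ->
  ratr p' < t -> t <= T ->
  rat_qvar x (ratr p) + `|x (ratr p') - x (ratr p)| `^ q <= rat_qvar x t.
Proof.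
move=> p0 pp' p't tT.
have pT : ratr p <= T by rewrite (le_trans _ tT)// ltW// (lt_trans pp').
rewrite -lerBrDr; apply: ge_sup; first exact: (has_sup_qvar pT).1.
move=> _ [l [sl lt] <-]; rewrite lerBrDr.
apply: (@le_trans _ _ (pvar_sum q x (map ratr (rcons (rcons l p) p')))).
  by rewrite !map_rcons pvar_sum_rcons2 lerD2r pvar_sum_rcons_ge.
apply: ub_le_sup; first exact: (has_sup_qvar tT).2.
exists (rcons (rcons l p) p') => //; split.
  have h : sorted <%R (rcons l p).
    case: (l) sl lt => [//|r l'] /= sl lt; rewrite rcons_path sl/=.
    by have /andP[_] := lt _ (mem_last r l'); rewrite ltr_rat.
  move: h; case: (l) => [|r l'] /=; first by rewrite -(ltr_rat R) pp'.
  by rewrite !rcons_path last_rcons => -> /=; rewrite -(ltr_rat R).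
move=> r; rewrite mem_rcons inE => /predU1P[->|].
  by rewrite p't andbT (le_trans p0)// ltW.
rewrite mem_rcons inE => /predU1P[->|/lt/andP[r0 rp]].
  by rewrite p0 (lt_trans pp').
by rewrite r0 (lt_trans rp)// (lt_trans pp').
Qed.

Let has_inf_qvar t : t < T ->
  has_inf [set rat_qvar x u | u in [set u | t < u <= T]].
Proof.
move=> tT; split; first by exists (rat_qvar x T), T => //=; rewrite tT lexx.
by exists 0 => _ [u /andP[_ uT] <-]; exact: rat_qvar_ge0.
Qed.

Lemma rat_qvar_right_le t u : t < u -> u <= T -> rat_qvar_right x t <= rat_qvar x u.
Proof.
move=> tu uT; apply: ge_inf; first exact: (has_inf_qvar (lt_le_trans tu uT)).2.
by exists u => //=; rewrite tu.
Qed.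

Lemma rat_qvar_right_lt t a : t < T -> rat_qvar_right x t < a <->
  exists n : nat, rat_qvar x (t + (T - t) / n.+1%:R) < a.
Proof.
move=> tT; split.
  rewrite -subr_gt0 => /inf_adherent-/(_ _ (has_inf_qvar tT))[_ [u /= /andP[tu uT] <-]].
  rewrite subrKC => ua.
  have [n hn] : exists n, (n.+1)%:R^-1 < (u - t) / (T - t).
    by apply: harmonic_lt; rewrite divr_gt0// subr_gt0.
  exists n; apply: le_lt_trans ua; apply: rat_qvar_nd => //.
  rewrite -lerBrDl mulrC -ler_pdivlMr ?subr_gt0//; exact: ltW.
move=> [n hn]; apply: le_lt_trans hn; apply: rat_qvar_right_le.
  by rewrite ltrDl divr_gt0// subr_gt0.
rewrite -lerBrDl ler_pdivrMr// ler_peMr ?ler1n// subr_ge0; exact: ltW.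
Qed.

Lemma rat_qvar_right_adherent t eta : t < T -> 0 < eta ->
  exists u, t < u <= T /\ rat_qvar x u < rat_qvar_right x t + eta.
Proof.
move=> tT eta0.
have [_ [u /= /andP[tu uT] <-] hu] := inf_adherent eta0 (has_inf_qvar tT).
by exists u; rewrite tu uT.
Qed.

Lemma clock0 : clock x 0 = 0.
Proof. by rewrite /clock subrr. Qed.

Lemma clock_nd s t : s <= t -> t < T -> clock x s <= clock x t.
Proof.
move=> st tT; rewrite lerD2r; apply: lb_le_inf; first exact: (has_inf_qvar tT).1.
move=> _ [w /= /andP[tw wT] <-]; apply: rat_qvar_right_le => //.
exact: le_lt_trans tw.
Qed.

Lemma clock_right_cont t eta : t < T -> 0 < eta ->
  exists2 u, t < u & forall s, t <= s < u -> clock x s < clock x t + eta.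
Proof.
move=> tT eta0; have [u [/andP[tu uT] hu]] := rat_qvar_right_adherent tT eta0.
exists u => // s /andP[ts su]; rewrite /clock addrAC ltrD2r.
by apply: le_lt_trans hu; exact: rat_qvar_right_le.
Qed.

(** The estimate at rational times, [rat_qvar_incr], extends to real times by
    continuity of x: the clock at s and at t is approached by the variation at times
    slightly larger, which may be chosen to enclose rational ones. *)
Lemma clock_control s t : 0 <= s -> s < t -> t < T ->
  `|x t - x s| `^ q <= clock x t - clock x s.
Proof.
move=> s0 st tT; rewrite /clock opprD opprK addrACA subrr addr0 addrC.
rewrite [leRHS]addrC.
apply/ler_addgt0Pl => eta eta0.
have [u [/andP[tu uT] hu]] := rat_qvar_right_adherent tT eta0.
set Z := eta + _.
have hr (p p' : rat) : s < ratr p -> ratr p < ratr p' :> R -> ratr p' < u ->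
    `|x (ratr p') - x (ratr p)| `^ q <= Z.
  move=> sp pp' p'u.
  have := @rat_qvar_incr p p' u _ pp' p'u uT.
  move=> /(_ (le_trans s0 (ltW sp))) h1.
  have h2 : rat_qvar_right x s <= rat_qvar x (ratr p).
    by apply: rat_qvar_right_le => //; rewrite (le_trans _ uT)// ltW// (lt_trans pp').
  rewrite /Z; lra.
have Z0 : 0 <= Z.
  have [p] := rat_in_itvoo (lt_trans st tu).
  rewrite in_itv/= => /andP[sp pu].
  have [p'] := rat_in_itvoo pu.
  rewrite in_itv/= => /andP[pp' p'u].
  by apply: le_trans (hr _ _ sp pp' p'u); exact: powR_ge0.
apply: root_le_powR => //.
apply/ler_addgt0Pl => eps eps0.
have e20 : 0 < eps / 2 by rewrite divr_gt0.
have [delta d0 hd] := ux e20.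
have [p] := @rat_in_itvoo R s (Num.min t (s + delta)) ltac:(by rewrite lt_min st ltrDl).
rewrite in_itv/= lt_min => /and3P[sp pt psd].
have [p'] := @rat_in_itvoo R t (Num.min u (t + delta)) ltac:(by rewrite lt_min tu ltrDl).
rewrite in_itv/= lt_min => /and3P[tp' p'u p'td].
have h := powR_le_root q0 (normr_ge0 _) (hr p p' sp (lt_trans pt tp') p'u).
have -> : x t - x s = (x t - x (ratr p')) + (x (ratr p) - x s) +
    (x (ratr p') - x (ratr p)).
  by rewrite addrAC !subrKA.
apply: le_trans (ler_normD _ _) _; rewrite lerD//.
apply: le_trans (ler_normD _ _) _; rewrite (splitr eps) lerD//; apply/ltW/hd.
- by rewrite /= in_itv/= (le_trans s0 (ltW st)) ltW.
- by rewrite /= in_itv/= (le_trans (ltW p'u) uT) (le_trans s0)// ltW// (lt_trans st).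
- by rewrite distrC gtr0_norm ?subr_gt0// ltrBlDl.
- by rewrite /= in_itv/= (le_trans s0 (ltW sp)) ltW// (lt_trans pt).
- by rewrite /= in_itv/= s0 ltW// (lt_trans st).
- by rewrite gtr0_norm ?subr_gt0// ltrBlDl.
Qed.

End path.
End clock.

Section hitting.
Context {R : realType} {V : normedModType R}.
Variables (q Ts : R) (x : R -> V) (c : R -> R).

(** The final time Ts belongs to the set, so that the levels that the clock does
    not reach are hit at Ts. *)
Definition hit_set u := [set t | 0 <= t <= Ts /\ (u <= c t \/ t = Ts)].

Definition hit u := inf (hit_set u).

Hypothesis q0 : 0 < q.
Hypothesis Ts0 : 0 < Ts.
Hypothesis ux : unif_cont_on `[0, Ts] x.
Hypothesis c_nd : forall s t : R, 0 <= s -> s <= t -> t <= Ts -> c s <= c t.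
Hypothesis c_rc : forall t eta : R, 0 <= t -> t < Ts -> 0 < eta ->
  exists2 u, t < u & forall s, t <= s < u -> c s < c t + eta.
Hypothesis c_ctl : forall s t : R, 0 <= s -> s < t -> t <= Ts -> `|x t - x s| `^ q <= c t - c s.

Let hit_lb u : lbound (hit_set u) 0.
Proof. by move=> t [/andP[]]. Qed.

Let hit_has_inf u : has_inf (hit_set u).
Proof.
split; last by exists 0; exact: hit_lb.
by exists Ts; split; [rewrite lexx ltW|right].
Qed.

Lemma hit_le u t : hit_set u t -> hit u <= t.
Proof. by move=> h; apply: ge_inf => //; exact: (hit_has_inf u).2. Qed.

Lemma hit_ge u s : (forall t : R, 0 <= t -> t < s -> t < Ts -> c t < u) -> s <= Ts ->
  s <= hit u.
Proof.
move=> h sTs; apply: lb_le_inf; first exact: (hit_has_inf u).1.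
move=> t [/andP[t0 tTs] ut]; rewrite leNgt; apply/negP => ts.
have := h t t0 ts (lt_le_trans ts sTs).
case: ut => [ut|tT]; first by rewrite ltNge ut.
by move: ts; rewrite tT ltNge sTs.
Qed.

Lemma hit_itv u : 0 <= hit u <= Ts.
Proof.
apply/andP; split; first by apply: lb_le_inf; [exact: (hit_has_inf u).1|exact: hit_lb].
by apply: hit_le; split; [rewrite lexx ltW|right].
Qed.

Lemma hit_before u s : 0 <= s -> s < hit u -> c s < u.
Proof.
move=> s0 su; rewrite ltNge; apply/negP => us.
have sTs : s <= Ts by have /andP[_] := hit_itv u; exact/le_trans/ltW.
by have := @hit_le u s; rewrite leNgt su => h; suff: false by []; apply: h; split;
   [rewrite s0|left].
Qed.

(** This is the use of the right-continuity of the clock. *)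
Lemma hit_attained u : u <= c (hit u) \/ hit u = Ts.
Proof.
have /andP[h0] := hit_itv u; rewrite le_eqVlt => /predU1P[|hT]; first by right.
left; rewrite leNgt; apply/negP => cu.
have [w hw cw] : exists2 w, hit u < w & forall s, hit u <= s < w -> c s < c (hit u) + (u - c (hit u)).
  by apply: c_rc => //; rewrite subr_gt0.
have : Num.min w Ts <= hit u.
  apply: hit_ge; last by rewrite ge_min lexx orbT.
  move=> t t0; rewrite lt_min => /andP[tw _] tT.
  have [tu|ut] := ltP t (hit u); first exact: hit_before.
  by have := cw t; rewrite ut tw subrKC; exact.
by rewrite leNgt lt_min hw hT.
Qed.

Lemma hit_nd u u' : u <= u' -> hit u <= hit u'.
Proof.
move=> uu'; have /andP[h0 hT] := hit_itv u'; apply: hit_le.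
split; first by rewrite h0.
have [h|h] := hit_attained u'; last by right.
by left; exact: le_trans h.
Qed.

(** Read at the hitting times, x has increments controlled by the levels. Before
    the hitting time of u' the clock is smaller than u', and x is continuous, so
    a jump of the clock at the hitting time is harmless. *)
Lemma hit_path_control u u' : u <= u' -> `|x (hit u') - x (hit u)| `^ q <= u' - u.
Proof.
move=> uu'; have := hit_nd uu'; have /andP[s0 sT] := hit_itv u.
have /andP[t0 tT] := hit_itv u'.
rewrite le_eqVlt => /predU1P[->|st].
  by rewrite subrr normr0 powR0 ?gt_eqF// subr_ge0.
have uc : u <= c (hit u).
  by have [//|sTs] := hit_attained u; move: st; rewrite sTs ltNge tT.
have h w : hit u < w -> w < hit u' -> `|x w - x (hit u)| `^ q <= u' - u.
  move=> sw wt; have w0 := le_trans s0 (ltW sw).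
  have h1 := c_ctl s0 sw (le_trans (ltW wt) tT).
  have h2 := hit_before w0 wt.
  lra.
apply: root_le_powR => //; first by rewrite subr_ge0.
apply/ler_addgt0Pl => eps eps0.
have [delta d0 hd] := ux eps0.
(* A time slightly before the hitting time of u', where the clock is below u'. *)
pose w := Num.max ((hit u + hit u') / 2) (hit u' - delta / 2).
have sw : hit u < w by rewrite lt_max; apply/orP; left; lra.
have wt : w < hit u' by rewrite gt_max; apply/andP; split; lra.
have wd : hit u' - delta / 2 <= w by rewrite le_max lexx orbT.
have := powR_le_root q0 (normr_ge0 _) (h w sw wt) => hw.
rewrite -(subrKA (x w)) (le_trans (ler_normD _ _))// lerD// ltW// hd//.
- by rewrite /= in_itv/= t0.
- by rewrite /= in_itv/= (le_trans s0 (ltW sw)) (le_trans (ltW wt)).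
- by rewrite gtr0_norm ?subr_gt0//; lra.
Qed.

(** The path may be recovered from the levels: the clock does not increase
    from the hitting time of c t to t, so that x is constant in between. *)
Lemma hit_clock t : 0 <= t <= Ts -> x (hit (c t)) = x t.
Proof.
move=> /andP[t0 tTs].
have : hit (c t) <= t by apply: hit_le; split; [rewrite t0|left].
rewrite le_eqVlt => /predU1P[->//|st].
have /andP[s0 sT] := hit_itv (c t).
have [h|h] := hit_attained (c t); last by move: st; rewrite h ltNge tTs.
have := c_ctl s0 st tTs => h1.
have : `|x t - x (hit (c t))| `^ q <= 0 by rewrite (le_trans h1)// subr_le0.
by move=> /(powR_eq0_le q0 (normr_ge0 _))/eqP; rewrite normr_eq0 subr_eq0 => /eqP.
Qed.

Lemma hit_between s t u : 0 <= s -> s <= t -> t <= Ts -> c s < u -> u <= c t ->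
  s <= hit u <= t.
Proof.
move=> s0 st tT su ut; apply/andP; split.
  apply: hit_ge; last exact: le_trans tT.
  by move=> r r0 rs rT; apply: le_lt_trans su; apply: c_nd => //; [exact: ltW|exact: le_trans tT].
by apply: hit_le; split; [rewrite tT (le_trans s0)|left].
Qed.

(** The grid points from which the clock is at least u approximate the hitting
    time from above. *)
Definition grid_hit (n : nat) u : nat :=
  least (fun k => u <= c (Ts * k%:R / n.+1%:R) \/ (n < k)%N).

Lemma grid_hit_cvg u :
  (fun n => x (Ts * (minn (grid_hit n u) n.+1)%:R / n.+1%:R)) @ \oo --> x (hit u).
Proof.
apply/cvgrPdist_lt => eps eps0; have [delta d0 hd] := ux eps0.
have [k hk] := harmonic_lt (divr_gt0 d0 Ts0).
exists k => // n /= kn.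
have [|hg lg] := @leastP (fun k => u <= c (Ts * k%:R / n.+1%:R) \/ (n < k)%N).
  by exists n.+1; right.
rewrite -/(grid_hit n u) in hg lg.
have gn : (grid_hit n u <= n.+1)%N.
  rewrite leqNgt; apply/negP => /lg; apply; by right.
rewrite (minn_idPl gn).
set g := grid_hit n u in hg lg gn *; set t := _ / _.
have Ts1 k' : 0 <= Ts * k'%:R / n.+1%:R by rewrite divr_ge0// mulr_ge0// ltW.
have tT : t <= Ts by rewrite ler_pdivrMr// ler_wpM2l ?ler_nat// ltW.
have hs : hit_set u t.
  split; first by rewrite Ts1.
  case: hg => [?|ng]; [by left|right].
  have gn1 : g = n.+1 by apply/eqP; rewrite eqn_leq gn ng.
  by rewrite /t gn1 mulfK// pnatr_eq0.
have ht := hit_le hs.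
have th : t - Ts / n.+1%:R <= hit u.
  have /andP[h0 _] := hit_itv u.
  have [g0|g0] := posnP g.
    rewrite /t g0 mulr0 mul0r add0r (le_trans _ h0)// oppr_le0 divr_ge0//; exact: ltW.
  have -> : t - Ts / n.+1%:R = Ts * g.-1%:R / n.+1%:R.
    by rewrite /t -mulrBl -{2}[Ts]mulr1 -mulrBr -[in g%:R](prednK g0) -natr1 addrK.
  apply: hit_ge.
    move=> r r0 rg rT; have gg : (g.-1 < g)%N by rewrite prednK.
    have := lg _ gg; rewrite not_orP => -[/negP]; rewrite -ltNge => hc _.
    apply: le_lt_trans hc; apply: c_nd => //; first exact: ltW.
    rewrite ler_pdivrMr// ler_wpM2l ?ltW// ltr_nat.
    by rewrite prednK.
  rewrite ler_pdivrMr// ler_wpM2l ?ler_nat ?ltW//.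
  by rewrite (leq_trans (leq_pred _)).
apply: hd.
- by rewrite /= in_itv/= hit_itv.
- by rewrite /= in_itv/= Ts1.
rewrite distrC ger0_norm ?subr_ge0//.
apply: (@le_lt_trans _ _ (Ts / n.+1%:R)); first by rewrite lerBlDr addrC -lerBlDr.
rewrite mulrC -ltr_pdivlMr//; apply: le_lt_trans hk.
by rewrite lef_pV2 ?posrE// ler_nat ltnS.
Qed.

End hitting.

(** * The Euler scheme along the binary tree *)

(** Clearing the lowest bit: the parent of i is the left end of the dyadic interval
    whose middle point is i. *)
Definition parent (i : nat) : nat := (i - 2 ^ logn 2 i)%N.

Lemma odd_times_pow2 i : (0 < i)%N ->
  exists k, i = ((2 * k).+1 * 2 ^ logn 2 i)%N.
Proof.
move=> i0; have [m cm im] := pfactor_coprime (isT : prime 2) i0.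
exists m./2; rewrite [LHS]im; congr muln.
by rewrite -[LHS]odd_double_half -coprime2n cm mul2n.
Qed.

Lemma logn_odd_times_pow2 s k : logn 2 ((2 * k).+1 * 2 ^ s) = s.
Proof.
rewrite lognM ?expn_gt0// pfactorK// logn_coprime ?add0n//.
by rewrite coprime2n /= mul2n odd_double.
Qed.

Lemma parent_odd_times_pow2 s k : parent ((2 * k).+1 * 2 ^ s) = (2 * k * 2 ^ s)%N.
Proof. by rewrite /parent logn_odd_times_pow2 mulSn addKn. Qed.

Lemma parent_lt i : (0 < i)%N -> (parent i < i)%N.
Proof.
move=> i0; rewrite /parent ltn_subrL i0 andbT expn_gt0 //.
Qed.

Section sewing.
Context {R : realType} {d e : nat}.
Variables (n N : nat) (v : nat -> 'M[R]_(e, d)) (z : nat -> 'cV[R]_e) (Y : nat -> 'cV[R]_d).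
Variables (B a b kappa C : R).
Hypothesis zS : forall i, (i < N)%N -> z i.+1 = z i + v i *m (Y i.+1 - Y i).
Hypothesis hv : forall s k, ((2 * k).+1 * 2 ^ s < N)%N -> (s < n)%N ->
  `|v ((2 * k).+1 * 2 ^ s)%N - v (2 * k * 2 ^ s)%N| <= B * a ^+ (n - s).
Hypothesis hY : forall s i j, (s <= n)%N -> (i <= j <= i + 2 ^ s)%N -> (j <= N)%N ->
  `|Y j - Y i| <= kappa * b ^+ (n - s).
Hypotheses (a0 : 0 <= a) (b0 : 0 <= b) (B0 : 0 <= B) (k0 : 0 <= kappa) (C0 : 0 <= C).
Hypothesis hC : (2 * C + d%:R * B * kappa) * (a * b) <= C.

(** The defect on a dyadic interval of length 2 ^ s is the sum of the
    defects on its halves and of the product of the velocity increment at the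
    middle point with the increment of Y over the right half. The first two count
    twice the bound of the next level, which [hC] absorbs; on
    intervals of length 1 there is no defect. Only the velocities before the
    time j are involved, which makes the estimate usable in an induction on
    time. *)
Lemma dyadic_sewing s : (s <= n)%N -> forall k j,
  (k * 2 ^ s <= j <= k.+1 * 2 ^ s)%N -> (j <= N)%N ->
  `|z j - z (k * 2 ^ s)%N - v (k * 2 ^ s)%N *m (Y j - Y (k * 2 ^ s)%N)|
    <= C * (a * b) ^+ (n - s).
Proof.
have ab0 : 0 <= a * b by rewrite mulr_ge0.
elim: s => [|s ih] sn k j /andP[kj jk] jN.
  rewrite expn0 muln1 in kj *; rewrite expn0 muln1 in jk.
  have [->|jk'] := eqVneq j k.
    by rewrite !subrr mulmx0 subr0 normr0 mulr_ge0// exprn_ge0.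
  have -> : j = k.+1 by lia.
  rewrite zS; last by lia.
  by rewrite addrAC addrK subrr normr0 mulr_ge0// exprn_ge0.
have e1 : (k * 2 ^ s.+1 = 2 * k * 2 ^ s)%N by rewrite expnS; lia.
have e2 : (k.+1 * 2 ^ s.+1 = (2 * k).+2 * 2 ^ s)%N by rewrite expnS; lia.
rewrite e1 in kj *; rewrite e2 in jk.
have e3 : (n - s = (n - s.+1).+1)%N by lia.
have step : (2 * C + d%:R * B * kappa) * (a * b) ^+ (n - s) <= C * (a * b) ^+ (n - s.+1).
  by rewrite e3 exprS mulrA ler_wpM2r// exprn_ge0.
set t := (a * b) ^+ (n - s) in step *.
have t0 : 0 <= t by rewrite exprn_ge0.
have dBk : 0 <= d%:R * B * kappa by rewrite !mulr_ge0.
have [jm|mj] := leqP j ((2 * k).+1 * 2 ^ s).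
  apply: le_trans (ih (ltnW sn) (2 * k)%N j _ jN) _; first by rewrite kj jm.
  rewrite (le_trans _ step)// ler_wpM2r//; move: C0 dBk; move: (d%:R * B * kappa) => X; lra.
set m := ((2 * k).+1 * 2 ^ s)%N in mj.
set l := (2 * k * 2 ^ s)%N.
have -> : z j - z l - v l *m (Y j - Y l) =
  (z j - z m - v m *m (Y j - Y m)) + (z m - z l - v l *m (Y m - Y l)) +
  (v m - v l) *m (Y j - Y m).
  rewrite mulmxBl !mulmxBr.
  move: (v l *m Y j) (v l *m Y l) (v m *m Y j) (v m *m Y m) (v l *m Y m).
  by move=> ? ? ? ? ?; apply/matrixP => i0 j0; rewrite !mxE; ring.
apply: le_trans (ler_normD _ _) _; apply: (le_trans (lerD (ler_normD _ _) (lexx _))).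
have h1 := ih (ltnW sn) (2 * k).+1 j _ jN; rewrite -/m in h1.
have h2 := ih (ltnW sn) (2 * k)%N m _ _; rewrite -/l in h2.
have h3 := hv (leq_trans mj jN) sn; rewrite -/m -/l in h3.
have h4 := @hY s m j (ltnW sn) _ jN.
have h5 := mulmx_norm_le (v m - v l) (Y j - Y m).
apply: le_trans (lerD (lerD (h1 _) (h2 _ _)) h5) _.
- by rewrite ltnW// /m.
- by apply/andP; split; rewrite /m /l leq_mul2r ?leqnn ?leqnSn orbT.
- by rewrite (leq_trans (ltnW mj)).
apply: le_trans step; rewrite -/t mulrDl.
have -> : C * t + C * t = 2 * C * t by ring.
rewrite lerD2l.
have -> : d%:R * B * kappa * t = d%:R * (B * a ^+ (n - s)) * (kappa * b ^+ (n - s)).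
  by rewrite /t exprMn; ring.
apply: ler_pM => //; last apply: h4.
- by rewrite ler_wpM2l.
by rewrite (ltnW mj)/= /m; move: jk; rewrite [in X in (_ <= X)%N -> _]mulSn addnC.
Qed.

End sewing.

Section euler.
Context {R : realType} {d e : nat}.
Variables (F : 'cV[R]_e -> set 'M[R]_(e, d)) (c0 : 'cV[R]_e) (rho : R).
Variables (c : nat -> 'M[R]_(e, d)) (B a : R).

Section scheme.
Variables (n : nat) (eps : R) (xi : 'cV[R]_e) (Y : nat -> 'cV[R]_d).

(** An open condition on z, unlike membership in F z, and one that the points of a
    dense sequence can meet. *)
Definition almost_in (z : 'cV[R]_e) (p : 'M[R]_(e, d)) :=
  `|z - c0| < rho /\ exists2 p', F z p' & `|p - p'| < eps.

Definition select_init (z : 'cV[R]_e) : nat := least (fun j => almost_in z (c j)).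

(** The velocity at z is chosen within a prescribed bound of p, the velocity of
    the parent. *)
Definition select_near (z : 'cV[R]_e) (p : 'M[R]_(e, d)) (bound : R) : nat :=
  least (fun j => almost_in z (c j) /\ `|c j - p| < bound).

(** The state after i steps is the list of the indices of the velocities chosen so
    far, as a function, together with the position: the velocity of the parent
    may have been chosen long before. *)
Fixpoint euler (i : nat) : (nat -> nat) * 'cV[R]_e :=
  if i is i'.+1 then
    let h := (euler i').1 in
    let z := (euler i').2 + c (h i') *m (Y i'.+1 - Y i') in
    let j := select_near z (c (h (parent i'.+1))) (B * a ^+ (n - logn 2 i'.+1)) in
    (fun m => if m == i'.+1 then j else h m, z)
  else (fun=> select_init xi, xi).

Definition euler_idx i := (euler i).1 i.
Definition euler_v i := c (euler_idx i).
Definition euler_z i := (euler i).2.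

Lemma euler_hist i m : (m <= i)%N -> (euler i).1 m = euler_idx m.
Proof.
elim: i => [|i ih]; first by rewrite leqn0 => /eqP->.
rewrite leq_eqVlt => /predU1P[->//|mi] /=.
by rewrite ltn_eqF// ih.
Qed.

Lemma euler_idxS i : euler_idx i.+1 =
  select_near (euler_z i.+1) (euler_v (parent i.+1)) (B * a ^+ (n - logn 2 i.+1)).
Proof.
rewrite {1}/euler_idx /= eqxx.
by rewrite [(euler i).1 (parent _)]euler_hist// -ltnS parent_lt.
Qed.

End scheme.

Variables (b kappa K M A gamma : R).
Hypothesis dc : dense_seq c.
Hypothesis F0 : forall z, `|z - c0| <= rho -> F z !=set0.
Hypothesis FK : forall x y p eta, `|x - c0| <= rho -> `|y - c0| <= rho -> F x p ->
  0 < eta -> exists2 p', F y p' & `|p - p'| < K * `|x - y| `^ gamma + eta.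
Hypothesis FM : forall x p, `|x - c0| <= rho -> F x p -> `|p| <= M.
Hypotheses (a0 : 0 <= a) (b0 : 0 <= b) (B0 : 0 <= B) (k0 : 0 <= kappa) (K0 : 0 <= K)
  (M0 : 0 <= M) (a1 : a <= 1) (g0 : 0 <= gamma).
Hypothesis bga : b `^ gamma = a.
Hypothesis hAM : d%:R * (M + 1) + 1 <= A.
Hypothesis hB : (2 + d%:R * B) * (a * b) <= 1.
Hypothesis hK : K * (A * kappa) `^ gamma <= B / 2.

Variables (n : nat) (eps : R) (xi : 'cV[R]_e) (Y : nat -> 'cV[R]_d).
Hypotheses (e0 : 0 < eps) (e1 : eps <= 1)
  (heps : forall l, (l <= n)%N -> 3 * eps <= B / 2 * a ^+ l).
Hypothesis hxi : `|xi - c0| + A * kappa < rho.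
Hypothesis hY : forall s i j, (s <= n)%N -> (i <= j <= i + 2 ^ s)%N -> (j <= 2 ^ n)%N ->
  `|Y j - Y i| <= kappa * b ^+ (n - s).

Let v := euler_v n eps xi Y.
Let z := euler_z n eps xi Y.

Definition euler_good i := almost_in eps (z i) (v i) /\
  ((0 < i)%N -> `|v i - v (parent i)| < B * a ^+ (n - logn 2 i)).

Let almost_in_norm x p : almost_in eps x p -> `|p| <= M + 1.
Proof.
move=> [xr [p' Fp' pp']].
rewrite -(subrK p' p) (le_trans (ler_normD _ _))// addrC lerD//.
  by apply: FM Fp'; exact: ltW.
by rewrite (le_trans (ltW pp')).
Qed.

Let good_v N : (forall i, (i < N)%N -> euler_good i) ->
  forall s k, ((2 * k).+1 * 2 ^ s < N)%N -> (s < n)%N ->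
  `|v ((2 * k).+1 * 2 ^ s)%N - v (2 * k * 2 ^ s)%N| <= B * a ^+ (n - s).
Proof.
move=> hG s k skN _; have [_] := hG _ skN.
rewrite parent_odd_times_pow2 logn_odd_times_pow2 => h.
by apply/ltW/h; rewrite muln_gt0 expn_gt0.
Qed.

Let good_sewing N s k j : (N <= 2 ^ n)%N -> (forall i, (i < N)%N -> euler_good i) ->
  (s <= n)%N -> (k * 2 ^ s <= j <= k.+1 * 2 ^ s)%N -> (j <= N)%N ->
  `|z j - z (k * 2 ^ s)%N - v (k * 2 ^ s)%N *m (Y j - Y (k * 2 ^ s)%N)|
    <= kappa * (a * b) ^+ (n - s).
Proof.
move=> Nn hG sn kj jN.
apply: (@dyadic_sewing R d e n N v z Y B a b kappa kappa) => //.
- exact: good_v.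
- by move=> s' i' j' ? ? ?; apply: hY => //; apply: leq_trans Nn.
- rewrite (_ : _ * (a * b) = kappa * ((2 + d%:R * B) * (a * b))); last by ring.
  by rewrite ler_piMr.
Qed.

Let good_incr N s k j : (N <= 2 ^ n)%N -> (forall i, (i < N)%N -> euler_good i) ->
  (s <= n)%N -> (k * 2 ^ s <= j <= k.+1 * 2 ^ s)%N -> (j <= N)%N ->
  `|z j - z (k * 2 ^ s)%N| <= A * kappa * b ^+ (n - s).
Proof.
move=> Nn hG sn kj jN.
have [->|jk] := eqVneq j (k * 2 ^ s)%N.
  rewrite subrr normr0 !mulr_ge0 ?exprn_ge0//.
  by rewrite (le_trans _ hAM)// addr_ge0// mulr_ge0// addr_ge0.
have h1 := good_sewing Nn hG sn kj jN.
have [kN] : euler_good (k * 2 ^ s)%N.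
  case/andP: kj => kj _.
  by apply: hG; rewrite (leq_trans _ jN)// ltn_neqAle eq_sym jk.
move=> _; have vM := almost_in_norm kN.
set m := (k * 2 ^ s)%N in h1 kN vM *.
rewrite -(subrK (v m *m (Y j - Y m)) (z j - z m)) (le_trans (ler_normD _ _))//.
have hYj : `|Y j - Y m| <= kappa * b ^+ (n - s).
  by apply: hY => //; [rewrite addnC -mulSn|exact: leq_trans Nn].
have h2 := mulmx_norm_le (v m) (Y j - Y m).
apply: (le_trans (lerD h1 h2)).
apply: (@le_trans _ _ ((d%:R * (M + 1) + 1) * (kappa * b ^+ (n - s)))); last first.
  by rewrite -mulrA ler_wpM2r// mulr_ge0// exprn_ge0.
rewrite addrC mulrDl mul1r lerD//.
  by rewrite ler_pM// ?mulr_ge0// ler_wpM2l.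
rewrite ler_wpM2l// exprMn ler_piMl// ?exprn_ge0// exprn_ile1//.
Qed.

(** Strong induction on time. The bounds before time i give, by
    [dyadic_sewing], the bound A * kappa * b ^+ l on the increment of the
    position from the parent of i to i, hence a velocity of F near that of the
    parent by the Hoelder condition; [hK] makes it fit the bound B * a ^+ l that is
    propagated. *)
Lemma euler_goodP i : (i <= 2 ^ n)%N -> euler_good i.
Proof.
have [i' le_i] := ubnP i; elim: i' i le_i => // i' IH i le_i iN.
have hG j : (j < i)%N -> euler_good j.
  move=> ji; apply: IH; first exact: leq_trans ji le_i.
  by apply: leq_trans iN; exact: ltnW.
case: i => [|i] in le_i iN hG *.
  have rxi : `|xi - c0| < rho.
    apply: le_lt_trans hxi; rewrite lerDl mulr_ge0//.
    by rewrite (le_trans _ hAM)// addr_ge0// mulr_ge0// addr_ge0.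
  split=> //.
  suff /leastP[] : exists j, almost_in eps xi (c j) by [].
  have [p Fp] := F0 (ltW rxi); have [j hj] := dc p e0.
  by exists j; split=> //; exists p => //; rewrite distrC.
have zr : `|z i.+1 - c0| < rho.
  have h : `|z i.+1 - z 0| <= A * kappa.
    have := @good_incr i.+1 n 0 i.+1 iN hG (leqnn n) _ (leqnn _).
    by rewrite mul0n mul1n subnn expr0 mulr1; apply; rewrite iN.
  rewrite -(subrKA (z 0)) (le_lt_trans (ler_normD _ _))// addrC.
  apply: le_lt_trans hxi; rewrite lerD2l //.
have [k ik] := odd_times_pow2 (ltn0Sn i).
set s := logn 2 i.+1 in ik.
have sn : (s <= n)%N.
  rewrite -(leq_exp2l _ _ (isT : (1 < 2)%N)) (leq_trans _ iN)//.
  by rewrite ik leq_pmull.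
have pi : parent i.+1 = (2 * k * 2 ^ s)%N by rewrite ik parent_odd_times_pow2.
have zz : `|z i.+1 - z (parent i.+1)| <= A * kappa * b ^+ (n - s).
  rewrite pi; apply: good_incr iN hG sn _ (leqnn _).
  by rewrite -ik leqnn andbT [leqRHS]ik leq_mul2r leqnSn orbT.
have [[zp [p Fp vp]] _] := hG _ (parent_lt (ltn0Sn i)).
have [p' Fp' pp'] := FK (ltW zp) (ltW zr) Fp e0.
have [j hj] := dc p' e0.
have : exists j, almost_in eps (z i.+1) (c j) /\
    `|c j - v (parent i.+1)| < B * a ^+ (n - s).
  exists j; split; first by split=> //; exists p' => //; rewrite distrC.
  rewrite -(subrKA p') (le_lt_trans (ler_normD _ _))//.
  rewrite [X in _ + X < _](_ : _ = `|(p' - p) + (p - v (parent i.+1))|); last by rewrite subrKA.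
  apply: (@le_lt_trans _ _ (`|p' - c j| + (`|p - p'| + `|v (parent i.+1) - p|))).
    rewrite ![`|p' - _|]distrC lerD2l (le_trans (ler_normD _ _))//.
    by rewrite [`|p' - p|]distrC [X in _ + X <= _]distrC.
  have AK0 : 0 <= A * kappa.
    by rewrite mulr_ge0// (le_trans _ hAM)// addr_ge0// mulr_ge0// addr_ge0.
  have hz : K * `|z (parent i.+1) - z i.+1| `^ gamma <= B / 2 * a ^+ (n - s).
    rewrite distrC; apply: (@le_trans _ _ (K * (A * kappa) `^ gamma * a ^+ (n - s))).
      rewrite -mulrA ler_wpM2l//.
      apply: (le_trans (@ge0_ler_powR _ _ g0 _ _ _ _ zz)).
      - by rewrite nnegrE.
      - by rewrite nnegrE mulr_ge0// exprn_ge0.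
      rewrite powRM ?exprn_ge0// ler_wpM2l ?powR_ge0//.
      by rewrite -bga -!powR_mulrn ?powR_ge0// -!powRrM mulrC.
    by rewrite ler_wpM2r// exprn_ge0.
  have := heps (leq_subr s n).
  lra.
move=> /leastP[h _].
have ev : v i.+1 =
    c (select_near eps (z i.+1) (v (parent i.+1)) (B * a ^+ (n - s))).
  by rewrite /v /euler_v euler_idxS.
by split; rewrite ev; [exact: h.1|move=> _; exact: h.2].
Qed.

Lemma euler_bounds :
  [/\ forall i, (i <= 2 ^ n)%N -> almost_in eps (z i) (v i) /\ `|v i| <= M + 1,
      forall s k, (s < n)%N -> ((2 * k).+1 * 2 ^ s <= 2 ^ n)%N ->
        `|v ((2 * k).+1 * 2 ^ s)%N - v (2 * k * 2 ^ s)%N| <= B * a ^+ (n - s),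
      forall s k j, (s <= n)%N -> (k * 2 ^ s <= j <= k.+1 * 2 ^ s)%N -> (j <= 2 ^ n)%N ->
        `|z j - z (k * 2 ^ s)%N - v (k * 2 ^ s)%N *m (Y j - Y (k * 2 ^ s)%N)|
          <= kappa * (a * b) ^+ (n - s) &
      forall s k j, (s <= n)%N -> (k * 2 ^ s <= j <= k.+1 * 2 ^ s)%N -> (j <= 2 ^ n)%N ->
        `|z j - z (k * 2 ^ s)%N| <= A * kappa * b ^+ (n - s)].
Proof.
have hG i : (i < 2 ^ n)%N -> euler_good i by move=> /ltnW; exact: euler_goodP.
split.
- by move=> i /euler_goodP[h _]; split=> //; exact: almost_in_norm h.
- move=> s k sn kn; have [_] := euler_goodP kn.
  rewrite parent_odd_times_pow2 logn_odd_times_pow2 => h.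
  by apply/ltW/h; rewrite muln_gt0 expn_gt0.
- by move=> s k j; exact: good_sewing (leqnn _) hG.
- by move=> s k j; exact: good_incr (leqnn _) hG.
Qed.

End euler.

(** * Sums of defects along a chain *)

Lemma geometric_lt {R : realType} (r C eps : R) : 0 <= r < 1 -> 0 < eps ->
  exists l, C * r ^+ l < eps.
Proof.
move=> /andP[r0 r1] eps0.
have : (fun l => C * r ^+ l) @ \oo --> C * 0.
  by apply: cvgMr; apply: cvg_expr; rewrite ger0_norm.
rewrite mulr0 => /cvgrPdist_lt/(_ _ eps0)[l _ /(_ l (leqnn l))].
by rewrite sub0r normrN => h; exists l; apply: le_lt_trans (ler_norm _) h.
Qed.

(** An error term of the form C * r ^+ n, with n arbitrary, may be dropped. *)
Lemma le_geometric {R : realType} (r C X Z : R) : 0 <= r < 1 ->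
  (forall n, X <= Z + C * r ^+ n) -> X <= Z.
Proof.
move=> r01 h; apply/ler_addgt0Pl => eps eps0.
have [n hn] := geometric_lt C r01 eps0.
by rewrite (le_trans (h n))// addrC lerD2r ltW.
Qed.

Lemma matrix_cauchy_rate {R : realType} m n (s : nat -> 'M[R]_(m, n)) (C r : R) :
  0 <= r < 1 -> (forall l k, (l <= k)%N -> `|s k - s l| <= C * r ^+ l) ->
  s @ \oo --> lim (s @ \oo) /\ forall l, `|lim (s @ \oo) - s l| <= C * r ^+ l.
Proof.
move=> r01 hs.
have sb k : [set A | `|A - s 0%N| <= C] (s k).
  by have /= := hs 0%N k (leq0n k); rewrite expr0 mulr1.
have [p hp] := compact_cluster_seq (@compact_matrix_ball R m n (s 0%N) C) sb.
have ps l : `|p - s l| <= C * r ^+ l.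
  apply/ler_addgt0Pl => eps eps0; have [k lk pk] := hp _ eps0 l.
  by rewrite -(subrKA (s k)) (le_trans (ler_normD _ _))// lerD// ?hs// ltW.
have sp : s @ \oo --> p.
  apply/cvgrPdist_lt => eps eps0; have [l hl] := geometric_lt C r01 eps0.
  exists l => // k /= lk; apply: le_lt_trans hl; apply: (le_trans (ps k)).
  have [/andP[r0 r1] C0] : (0 <= r < 1) /\ 0 <= C.
    by split=> //; have := hs 0%N 0%N (leqnn _); rewrite subrr normr0 expr0 mulr1.
  by rewrite ler_wpM2l// ler_wiXn2l// ltW.
have -> : lim (s @ \oo) = p by apply/cvg_lim => //; exact: norm_hausdorff.
by split.
Qed.

Section chains.
Context {R : realType} {W : normedModType R}.
Implicit Types (D : R -> R -> W) (a b : R) (s : seq R).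

Fixpoint chain_sum D a s : W :=
  if s is b :: s' then D a b + chain_sum D b s' else 0.

Lemma chain_sum_cat D a s1 b s2 : chain_sum D a (s1 ++ b :: s2) =
  chain_sum D a s1 + D (last a s1) b + chain_sum D b s2.
Proof.
by elim: s1 a => [a|c s1 ih a] /=; [rewrite add0r|rewrite ih !addrA].
Qed.

(** A chain along which h is nondecreasing crosses the value K at most once. *)
Lemma chain_sum_split (h : R -> nat) (K : nat) a s :
  path (fun b c => (h b <= h c)%N) a s -> (h a <= K)%N ->
  (forall b, b \in a :: s -> (h b <= K)%N) \/
  exists s1 b s2, [/\ s = s1 ++ b :: s2,
    forall c, c \in a :: s1 -> (h c <= K)%N &
    forall c, c \in b :: s2 -> (K < h c)%N].
Proof.
elim: s a => [|b s ih] a /=.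
  by move=> _ aK; left => c; rewrite inE => /eqP->.
move=> /andP[ab bs] aK; have [bK|Kb] := leqP (h b) K.
  have [hs|[s1 [c [s2 [-> h1 h2]]]]] := ih _ bs bK.
    by left => c; rewrite inE => /predU1P[->//|/hs].
  right; exists (b :: s1), c, s2; split=> // c'.
  by rewrite inE => /predU1P[->//|/h1].
right; exists [::], b, s; split=> //.
  by move=> c; rewrite inE => /eqP->.
have := order_path_min (fun y x z => @leq_trans _ _ _) bs => /allP hb.
move=> c; rewrite inE => /predU1P[->//|/hb]; exact: leq_trans.
Qed.

Variables (D : R -> R -> W) (E : set R) (g : nat -> R -> nat) (C r : R).
Hypothesis g_nd : forall l (s t : R), E s -> E t -> s <= t -> (g l s <= g l t)%N.
Hypothesis g_half : forall l (t : R), E t -> g l t = (g l.+1 t)./2.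
Hypothesis r0 : 0 <= r.
Hypothesis r1 : 2 * r < 1.
Hypothesis C0 : 0 <= C.
Hypothesis hD : forall m (s t : R), E s -> E t -> s <= t -> g m s = g m t ->
  `|D s t| <= C * r ^+ m.

Variable C1 : R.
Hypothesis C10 : 0 <= C1.
Hypothesis C1_ge : 2 * r * C1 + C <= C1.

Let C1r k : 0 <= C1 * r ^+ k. Proof. by apply: mulr_ge0 => //; exact: exprn_ge0. Qed.

Let path_g l a s : path <=%R a s -> (forall b, b \in a :: s -> E b) ->
  path (fun b c => (g l b <= g l c)%N) a s.
Proof.
elim: s a => //= b s ih a /andP[ab bs] hE.
rewrite g_nd ?ih//=.
- by move=> c hc; apply: hE; rewrite inE hc orbT.
- by apply: hE; rewrite mem_head.
- by apply: hE; rewrite !inE eqxx orbT.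
Qed.

(** A bound for a chain in one cell of level m, by induction on the number n of
    levels explored: a chain splits into its parts in the two half cells and one
    crossing term. At the deepest level each term is bounded individually, at the
    cost of a factor size s, for which the next lemma compensates by letting n grow. *)
Lemma chain_sum_cell_aux n m a s : path <=%R a s ->
  (forall b, b \in a :: s -> E b) -> (forall b, b \in a :: s -> g m b = g m a) ->
  `|chain_sum D a s| <= C1 * r ^+ m + (size s)%:R * C * (2 ^+ n * r ^+ (m + n)).
Proof.
elim: n m a s => [|n ih] m a s pas hE hg.
  rewrite expr0 mul1r addn0 -[leLHS]add0r; apply: lerD; first exact: C1r.
  elim: s a pas hE hg => [a _ _ _|b s ihs a]; first by rewrite /= normr0 mulr_ge0 ?exprn_ge0// mulr_ge0.
  rewrite [path _ _ _]/= => /andP[ab bs] hE hg.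
  rewrite [chain_sum _ _ _]/= [size _]/= mulrS !mulrDl mul1r.
  apply: (le_trans (ler_normD _ _)); apply: lerD.
    apply: hD => //; first by apply: hE; rewrite mem_head.
    - by apply: hE; rewrite !inE eqxx orbT.
    - by rewrite (hg b)// !inE eqxx orbT.
  apply: ihs => // c hc; first by apply: hE; rewrite inE hc orbT.
  by rewrite (hg c) ?(hg b)// in_cons ?hc ?orbT// mem_head orbT.
have Em b : b \in a :: s -> g m b = g m a by exact: hg.
have gS b : b \in a :: s -> (g m.+1 b)./2 = g m a by move=> h; rewrite -g_half ?hg//; exact: hE.
have rS : r ^+ m.+1 = r * r ^+ m by rewrite exprS.
have rm0 : 0 <= r ^+ m by rewrite exprn_ge0.
have X0 : 0 <= C * (2 ^+ n * r ^+ (m.+1 + n)) by rewrite !mulr_ge0 ?exprn_ge0.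
have e2 : C * (2 ^+ n.+1 * r ^+ (m + n.+1)) = 2 * (C * (2 ^+ n * r ^+ (m.+1 + n))).
  by rewrite exprS addnS addSn; ring.
have Y0 : 0 <= C1 * (r * r ^+ m) by rewrite -rS; exact: C1r.
have Z0 : 0 <= C * r ^+ m by rewrite mulr_ge0.
have hC1 : 2 * (C1 * (r * r ^+ m)) + C * r ^+ m <= C1 * r ^+ m.
  rewrite (_ : _ + _ = (2 * r * C1 + C) * r ^+ m); last by ring.
  by rewrite ler_wpM2r.
rewrite -mulrA e2.
(* The parity of the index of level m.+1 tells the half cell. *)
have [hall|[s1 [b [s2 [es h1 h2]]]]] : (forall b, b \in a :: s -> g m.+1 b = g m.+1 a) \/
   exists s1 b s2, [/\ s = s1 ++ b :: s2,
      forall c, c \in a :: s1 -> g m.+1 c = g m.+1 a &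
      forall c, c \in b :: s2 -> g m.+1 c = g m.+1 b].
  have half_eq b c : b \in a :: s -> c \in a :: s -> odd (g m.+1 b) = odd (g m.+1 c) ->
      g m.+1 b = g m.+1 c.
    by move=> hb hc o; rewrite -(odd_double_half (g m.+1 b)) o !gS// -(gS c)// odd_double_half.
  have ga b : b \in a :: s -> (g m.+1 b <= (g m a).*2)%N = ~~ odd (g m.+1 b).
    by move=> hb; rewrite -{1}(odd_double_half (g m.+1 b)) gS//; case: odd => //=;
       rewrite ?add0n ?leqnn// add1n ltnn.
  have [oa|oa] := boolP (odd (g m.+1 a)).
    left=> b hb; apply: half_eq => //; first by rewrite mem_head.
    rewrite oa; apply: contrapT => /negP nb.
    have bE := hE _ hb.
    have ab : a <= b.
      move: hb; rewrite inE => /predU1P[->//|hb].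
      by have := order_path_min le_trans pas => /allP; apply.
    have := g_nd m.+1 (hE _ (mem_head _ _)) bE ab.
    move=> /leq_trans/(_ _); move=> /(_ (g m a).*2); rewrite ga// nb => /(_ isT).
    by rewrite ga ?mem_head// oa.
  have gaK : (g m.+1 a <= (g m a).*2)%N by rewrite ga ?mem_head.
  have [hall|[s1 [b [s2 [es h1 h2]]]]] := chain_sum_split (path_g m.+1 pas hE) gaK.
    left => b hb; apply: half_eq => //; first by rewrite mem_head.
    by have := hall _ hb; rewrite ga// (negbTE oa) => /negbTE.
  right; exists s1, b, s2.
  have i1 c : c \in a :: s1 -> c \in a :: s.
    by rewrite es -cat_cons mem_cat => ->.
  have i2 c : c \in b :: s2 -> c \in a :: s.
    by rewrite es -cat_cons mem_cat orbC => ->.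
  split=> // c hc.
    apply: half_eq => //; [exact: i1|by rewrite mem_head|].
    by have := h1 _ hc; rewrite ga ?i1// (negbTE oa) => /negbTE.
  apply: half_eq => //; [exact: i2|by rewrite i2// mem_head|].
  have := h2 _ hc; have := h2 _ (mem_head _ _).
  by rewrite !ltnNge !ga ?i2 ?mem_head// !negbK => -> ->.
- apply: (le_trans (ih _ _ _ pas hE hall)); rewrite rS -mulrA.
  rewrite lerD//.
    apply: le_trans hC1; move: Y0 Z0; move: (C1 * (r * r ^+ m)) (C * r ^+ m) => y z.
    by move=> *; lra.
  by rewrite ler_wpM2l// ler_peMl// ler1n.
rewrite es in pas hE *; rewrite cat_path/= in pas.
have /and3P[p1 p12 p2] := pas.
have i1 c : c \in a :: s1 -> E c.
  by move=> hc; apply: hE; rewrite -cat_cons mem_cat hc.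
have i2 c : c \in b :: s2 -> E c.
  by move=> hc; apply: hE; rewrite -cat_cons mem_cat hc orbT.
have q1 := ih _ _ _ p1 i1 h1.
have q2 := ih _ _ _ p2 i2 h2.
have q3 : `|D (last a s1) b| <= C * r ^+ m.
  apply: hD => //; [by apply/i1/mem_last|by apply/i2/mem_head|].
  rewrite hg; last first.
    by rewrite es -cat_cons mem_cat mem_last.
  by rewrite hg// es -cat_cons mem_cat mem_head orbT.
rewrite chain_sum_cat (le_trans (ler_normD _ _))//.
apply: (le_trans (lerD (ler_normD _ _) (lexx _))).
apply: (le_trans (lerD (lerD q1 q3) q2)).
have -> : (size (s1 ++ b :: s2))%:R = 1 + (size s1)%:R + (size s2)%:R :> R.
  by rewrite size_cat /= addnS -addSn natrD mulrS.
rewrite rS -!mulrA.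
apply: le_trans (lerD hC1 (lexx _)); set X := C * (2 ^+ n * r ^+ _) in X0 *.
have S1 : 0 <= (size s1)%:R * X by rewrite mulr_ge0.
have S2 : 0 <= (size s2)%:R * X by rewrite mulr_ge0.
move: S1 S2 X0; move: X (size s1)%:R (size s2)%:R (C1 * (r * r ^+ m)) (C * r ^+ m).
by move=> X k1 k2 y z S1 S2 X0; lra.
Qed.

(** Since 2 * r < 1, the term that depends on the length of the chain vanishes as
    the number of levels grows: the bound is uniform over all chains. *)
Lemma chain_sum_cell m a s : path <=%R a s ->
  (forall b, b \in a :: s -> E b) -> (forall b, b \in a :: s -> g m b = g m a) ->
  `|chain_sum D a s| <= C1 * r ^+ m.
Proof.
move=> pas hE hg.
apply: (@le_geometric _ (2 * r) ((size s)%:R * C * r ^+ m)).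
  by rewrite r1 mulr_ge0.
move=> n; have := chain_sum_cell_aux n pas hE hg.
by rewrite exprD exprMn (_ : _ * (2 ^+ n * _) = (size s)%:R * C * r ^+ m * (2 ^+ n * r ^+ n))//; ring.
Qed.

(** A chain through several cells is cut at its crossings, whose number is at
    most that of the cells. *)
Lemma chain_sum_cells l (w : R) a s : 0 <= w -> path <=%R a s ->
  (forall b, b \in a :: s -> E b) -> path (fun b c => `|D b c| <= w) a s ->
  `|chain_sum D a s| <=
    (g l (last a s) - g l a).+1%:R * (C1 * r ^+ l) + (g l (last a s) - g l a)%:R * w.
Proof.
move=> w0; have [n] := ubnP (size s); elim: n a s => // n ih a s sn pas hE pw.
have X0 := C1r l.
have la b : b \in a :: s -> (g l a <= g l b)%N.
  move=> hb; apply: g_nd; [by apply: hE; rewrite mem_head|exact: hE|].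
  move: hb; rewrite inE => /predU1P[->//|hb].
  by have := order_path_min le_trans pas => /allP; apply.
have [hall|[s1 [b [s2 [es h1 h2]]]]] := chain_sum_split (path_g l pas hE) (leqnn _).
  have h b : b \in a :: s -> g l b = g l a.
    by move=> hb; apply/eqP; rewrite eqn_leq hall// la.
  apply: (le_trans (chain_sum_cell pas hE h)).
  rewrite -[leLHS]addr0 lerD ?mulr_ge0//.
  by rewrite ler_peMl// ler1n.
have i1 c : c \in a :: s1 -> c \in a :: s.
  by rewrite es -cat_cons mem_cat => ->.
have i2 c : c \in b :: s2 -> c \in a :: s.
  by rewrite es -cat_cons mem_cat orbC => ->.
move: pas pw; rewrite es !cat_path/= => /and3P[p1 p12 p2] /and3P[w1 w12 w2].
have q1 : `|chain_sum D a s1| <= C1 * r ^+ l.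
  apply: chain_sum_cell p1 _ _ => [c /i1/hE//|c hc].
  by apply/eqP; rewrite eqn_leq h1// la// i1.
have q2 : `|chain_sum D b s2| <= (g l (last b s2) - g l b).+1%:R * (C1 * r ^+ l) +
    (g l (last b s2) - g l b)%:R * w.
  apply: ih => //; last by move=> c /i2/hE.
  by move: sn; rewrite es size_cat/= ltnS; apply: leq_trans; rewrite addnS ltnS leq_addl.
rewrite chain_sum_cat last_cat/=.
apply: (le_trans (ler_normD _ _)); apply: (le_trans (lerD (ler_normD _ _) (lexx _))).
apply: (le_trans (lerD (lerD q1 w12) q2)).
have gab : (g l a < g l b)%N by apply: h2; rewrite mem_head.
have gbl : (g l b <= g l (last b s2))%N.
  apply: g_nd; [by apply/hE/i2/mem_head|by apply/hE/i2/mem_last|].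
  have := mem_last b s2; rewrite inE => /predU1P[->//|hb].
  exact: (allP (order_path_min le_trans p2) _ hb).
have : (g l (last b s2) - g l b)%:R + 1 <= (g l (last b s2) - g l a)%:R :> R.
  by rewrite natr1 ler_nat -subSn// -[leqRHS]subSS leq_sub2l.
rewrite -[(_ - g l b).+1%:R]natr1 -[(_ - g l a).+1%:R]natr1.
move: X0 w0; move: (_ - g l b)%:R (_ - g l a)%:R (C1 * r ^+ l) => k1 k2 X X0 w0 k12.
have : (k1 + 1) * (X + w) <= k2 * (X + w) by rewrite ler_wpM2r// addr_ge0.
rewrite !mulrDl !mulrDr !mul1r.
by move: (k1 * X) (k1 * w) (k2 * X) (k2 * w) => *; lra.
Qed.

End chains.

(** * The limit solution *)

Lemma finite_pvar_sub {R : realType} {V : normedModType R} (p : R) (E E' : set R)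
    (x : R -> V) : 0 < p -> E' `<=` E -> finite_pvar p E x -> finite_pvar p E' x.
Proof.
move=> p0 EE /(finite_pvarP _ _ p0)[C hC]; apply/finite_pvarP => //.
by exists C => s ss sE; apply: hC => // u /sE/EE.
Qed.

Lemma geometric_sum_le {R : realType} (r : R) n : 0 <= r < 1 ->
  \sum_(l < n) r ^+ l <= (1 - r)^-1.
Proof.
move=> /andP[r0 r1]; have h : 0 < 1 - r by rewrite subr_gt0.
rewrite -[leRHS]div1r ler_pdivlMr// mulrC -opprB mulNr -subrX1 opprB.
by rewrite gerBl exprn_ge0.
Qed.

Section dyadic_cells.
Context {R : realType}.
Variables (Ts : R) (u : R -> R).
Hypothesis u_nd : forall s t : R, 0 <= s -> s <= t -> t <= Ts -> u s <= u t.
Hypothesis u01 : forall t : R, 0 <= t -> t <= Ts -> 0 <= u t < 1.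

(** It changes only when u t enters another dyadic interval of level l: its increments
    control the variation of the velocity. *)
Definition cell (l : nat) (t : R) : nat := Num.truncn (2 ^+ l * u t).

Lemma cell_itv l t : 0 <= t -> t <= Ts -> (cell l t)%:R <= 2 ^+ l * u t < (cell l t).+1%:R.
Proof.
move=> t0 tT; apply: truncn_itv; rewrite mulr_ge0 ?exprn_ge0//.
by have /andP[] := u01 t0 tT.
Qed.

Lemma cell_lt l t : 0 <= t -> t <= Ts -> (cell l t < 2 ^ l)%N.
Proof.
move=> t0 tT; rewrite -(ltr_nat R) natrX.
have /andP[/le_lt_trans + _] := cell_itv l t0 tT; apply.
by rewrite gtr_pMr ?exprn_gt0//; have /andP[] := u01 t0 tT.
Qed.

Lemma cell_nd l s t : 0 <= s -> s <= t -> t <= Ts -> (cell l s <= cell l t)%N.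
Proof.
by move=> s0 st tT; apply: le_truncn; rewrite ler_wpM2l ?exprn_ge0// u_nd.
Qed.

Lemma cell_half l t : 0 <= t -> t <= Ts -> cell l t = (cell l.+1 t)./2.
Proof.
move=> t0 tT; apply: truncn_def.
have /andP[h1 h2] := cell_itv l.+1 t0 tT.
have := odd_double_half (cell l.+1 t); move: h1 h2; rewrite exprS -mulrA.
move: (_ * u t) => X; move: (cell l.+1 t) => k h1 h2 hk.
have hk1 : k./2%:R * 2 <= k%:R :> R by rewrite -natrM ler_nat muln2 -{2}hk leq_addl.
have hk2 : k.+1%:R <= k./2.+1%:R * 2 :> R.
  by rewrite -natrM ler_nat muln2 -{1}hk; case: odd => /=; lia.
by apply/andP; split; lra.
Qed.

Lemma cell_divn l k t : 0 <= t -> t <= Ts -> cell l t = (cell (l + k) t %/ 2 ^ k)%N.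
Proof.
move=> t0 tT; elim: k => [|k ->]; first by rewrite addn0 expn0 divn1.
by rewrite addnS cell_half// -divn2 -divnMA expnS.
Qed.

Lemma cell_near l s t : 0 <= s -> s <= t -> t <= Ts ->
  2 ^+ l * (u t - u s) <= 1 -> (cell l t <= (cell l s).+1)%N.
Proof.
move=> s0 st tT h; have /andP[_ h1] := cell_itv l s0 (le_trans st tT).
have /andP[h2 _] := cell_itv l (le_trans s0 st) tT.
rewrite -ltnS -(ltr_nat R) -[(_.+2)%:R]natr1; move: h h1 h2; rewrite mulrBr; lra.
Qed.

(** A bounded nondecreasing function with integer values is constant just
    before each time. *)
Lemma cell_left l t : 0 < t -> t <= Ts -> exists2 w, 0 <= w < t &
  forall s, w <= s < t -> cell l s = cell l w.
Proof.
move=> t0 tT; pose P k := `[< exists2 w, 0 <= w < t & cell l w = k >].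
have exP : exists k, P k by exists (cell l 0); apply/asboolP; exists 0; rewrite ?lexx.
have ubP k : P k -> (k <= 2 ^ l)%N.
  move=> /asboolP[w /andP[w0 wt] <-]; rewrite ltnW// cell_lt//.
  exact: le_trans (ltW wt) tT.
case: (ex_maxnP exP ubP) => k /asboolP[w /andP[w0 wt] wk] kmax.
exists w => [|s /andP[ws st]]; first by rewrite w0.
apply/eqP; rewrite eqn_leq; apply/andP; split.
  rewrite wk; apply: kmax; apply/asboolP; exists s => //.
  by rewrite st (le_trans w0).
by apply: cell_nd => //; exact: le_trans (ltW st) tT.
Qed.

Hypothesis u_rc : forall t eta : R, 0 <= t -> t < Ts -> 0 < eta ->
  exists2 w, t < w & forall s, t <= s < w -> u s < u t + eta.

Lemma cell_right l t : 0 <= t -> t < Ts -> exists2 w, t < w &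
  forall s, t <= s < w -> s <= Ts -> cell l s = cell l t.
Proof.
move=> t0 tT; have /andP[h1 h2] := cell_itv l t0 (ltW tT).
have p0 : 0 < 2 ^+ l :> R by rewrite exprn_gt0.
have [|w tw hw] := u_rc t0 tT (_ : 0 < (cell l t).+1%:R / 2 ^+ l - u t).
  by rewrite subr_gt0 ltr_pdivlMr// mulrC.
exists w => // s /andP[ts sw] sT; apply: truncn_def; apply/andP; split.
  by rewrite (le_trans h1)// ler_wpM2l ?exprn_ge0// u_nd.
by rewrite mulrC -ltr_pdivlMr//; have := hw s; rewrite ts sw subrKC; exact.
Qed.

End dyadic_cells.

Lemma young_sum_chain {R : realType} d e (v : R -> 'M[R]_(e, d)) (x : R -> 'cV[R]_d)
    (s : seq R) :
  young_sum v x s = chain_sum (fun a b => v a *m (x b - x a)) 0 s.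
Proof.
suff h a : \sum_(k < size s) v (a :: s)`_k *m (x (a :: s)`_k.+1 - x (a :: s)`_k) =
    chain_sum (fun a b => v a *m (x b - x a)) a s by exact: h.
elim: s a => [|b s ih] a; first by rewrite big_ord0.
by rewrite big_ord_recl /= -ih.
Qed.

Lemma mesh_path {R : realType} (delta : R) (s : seq R) : mesh s < delta ->
  path (fun a b => b - a < delta) 0 s.
Proof.
move=> h; apply/(pathP 0) => i si; apply: le_lt_trans h.
exact: (@le_bigmax _ _ _ 0 (fun k : 'I_(size s) => (0 :: s)`_k.+1 - (0 :: s)`_k) (Ordinal si)).
Qed.

Lemma mesh_to_0_filter {R : realType} (t : R) : Filter (mesh_to_0 t).
Proof.
apply: filter_from_filter; first by exists 1; exact: ltr01.
move=> i j /= i0 j0; exists (Num.min i j); first by rewrite /= lt_min i0.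
by move=> s /= [ps]; rewrite lt_min => /andP[? ?].
Qed.

(** Here u is the clock, normalized so as to take its values in [0, 1[, and Y l k,
    Zl l k and Vl l k are the path, the position and the velocity at the dyadic clock
    time k / 2 ^ l. *)
Section limit_solution.
Context {R : realType} {d e : nat}.
Variables (Ts : R) (u : R -> R) (x : R -> 'cV[R]_d).
Variables (Y : nat -> nat -> 'cV[R]_d) (Vl : nat -> nat -> 'M[R]_(e, d)).
Variable Zl : nat -> nat -> 'cV[R]_e.
Variables (a b kappa B P L M1 : R).

Hypothesis Ts0 : 0 < Ts.
Hypothesis u_nd : forall s t : R, 0 <= s -> s <= t -> t <= Ts -> u s <= u t.
Hypothesis u01 : forall t : R, 0 <= t -> t <= Ts -> 0 <= u t < 1.
Hypothesis u0 : u 0 = 0.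
Hypothesis u_rc : forall t eta : R, 0 <= t -> t < Ts -> 0 < eta ->
  exists2 w, t < w & forall s, t <= s < w -> u s < u t + eta.
Hypothesis ux : unif_cont_on `[0, Ts] x.
Let g := cell u.
Hypothesis Ynear : forall l (t : R), 0 <= t -> t <= Ts -> `|x t - Y l (g l t)| <= kappa * b ^+ l.
Hypothesis Ybetween : forall l (s t : R) i, 0 <= s -> s <= t -> t <= Ts ->
  (g l s < i <= g l t)%N -> exists2 r, s <= r <= t & Y l i = x r.
Hypothesis V_even : forall l k, Vl l.+1 (2 * k)%N = Vl l k.
Hypothesis V_odd : forall l k, ((2 * k).+1 <= 2 ^ l.+1)%N ->
  `|Vl l.+1 (2 * k).+1 - Vl l k| <= B * a ^+ l.+1.
Hypothesis V_bd : forall l k, (k <= 2 ^ l)%N -> `|Vl l k| <= M1.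
Hypothesis Z_sew : forall l m k j, (k * 2 ^ m <= j <= k.+1 * 2 ^ m)%N ->
  (j <= 2 ^ (l + m))%N ->
  `|Zl (l + m) j - Zl l k - Vl l k *m (Y (l + m) j - Y l k)| <= P * (a * b) ^+ l.
Hypothesis Z_incr : forall l m k j, (k * 2 ^ m <= j <= k.+1 * 2 ^ m)%N ->
  (j <= 2 ^ (l + m))%N -> `|Zl (l + m) j - Zl l k| <= L * b ^+ l.
Variable xi : 'cV[R]_e.
Hypothesis Z_0 : forall l, Zl l 0%N = xi.
Hypotheses (a01 : 0 <= a < 1) (b01 : 0 <= b < 1) (ab1 : 2 * (a * b) < 1).
Hypotheses (kappa0 : 0 <= kappa) (B0 : 0 <= B) (P0 : 0 <= P) (L0 : 0 <= L) (M0 : 0 <= M1).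

(** The values at dyadic levels extend to all times through the left ends of the
    cells. *)
Definition limit_v (t : R) : 'M[R]_(e, d) := lim ((fun l => Vl l (cell u l t)) @ \oo).
Definition limit_z (t : R) : 'cV[R]_e := lim ((fun l => Zl l (cell u l t)) @ \oo).

Let v := limit_v.
Let z := limit_z.
Let B1 := B / (1 - a).
Let E := `[0, Ts]%classic.

Let a0 : 0 <= a. Proof. by case/andP: a01. Qed.
Let b0 : 0 <= b. Proof. by case/andP: b01. Qed.
Let al l : 0 <= a ^+ l. Proof. exact: exprn_ge0. Qed.
Let bl l : 0 <= b ^+ l. Proof. exact: exprn_ge0. Qed.
Let ab0 : 0 <= a * b. Proof. exact: mulr_ge0. Qed.
Let abl l : 0 <= (a * b) ^+ l. Proof. exact: exprn_ge0. Qed.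
Let B10 : 0 <= B1.
Proof. by rewrite divr_ge0// subr_ge0 ltW//; case/andP: a01. Qed.

Let V_step l k : (k <= 2 ^ l.+1)%N -> `|Vl l.+1 k - Vl l k./2| <= B * a ^+ l.+1.
Proof.
move=> kl; have := odd_double_half k; case: odd => /= hk.
  by rewrite -{1}hk add1n -mul2n V_odd// mul2n -add1n hk.
by rewrite -{1}hk add0n -mul2n V_even subrr normr0 mulr_ge0.
Qed.

Let V_cauchy t l k : 0 <= t -> t <= Ts -> (l <= k)%N ->
  `|Vl k (g k t) - Vl l (g l t)| <= B1 * a ^+ l.
Proof.
move=> t0 tT lk.
suff h : `|Vl k (g k t) - Vl l (g l t)| <= B1 * a ^+ l - B1 * a ^+ k.
  by apply: (le_trans h); rewrite gerBl mulr_ge0.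
rewrite -(subnKC lk); elim: (k - l)%N => [|n ih].
  by rewrite addn0 !subrr normr0.
rewrite addnS -(subrKA (Vl (l + n) (g (l + n) t))) (le_trans (ler_normD _ _))//.
have h : `|Vl (l + n).+1 (g (l + n).+1 t) - Vl (l + n) (g (l + n) t)| <= B * a ^+ (l + n).+1.
  rewrite /g (cell_half u01 (l + n) t0 tT) V_step//.
  exact: ltnW (cell_lt u01 _ t0 tT).
apply: (le_trans (lerD h ih)).
have : B * a ^+ (l + n).+1 <= B1 * a ^+ (l + n) - B1 * a ^+ (l + n).+1.
  have -> : B1 * a ^+ (l + n) - B1 * a ^+ (l + n).+1 = B * a ^+ (l + n).
    have : B1 * (1 - a) = B by rewrite /B1 divfK// gt_eqF// subr_gt0; case/andP: a01.
    by move=> <-; rewrite exprS; ring.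
  by rewrite ler_wpM2l// exprS ler_piMl// ltW//; case/andP: a01.
lra.
Qed.

Lemma limit_v_near t l : 0 <= t -> t <= Ts -> `|v t - Vl l (g l t)| <= B1 * a ^+ l.
Proof.
move=> t0 tT.
by have [_] := matrix_cauchy_rate a01 (fun l k lk => V_cauchy t0 tT lk); apply.
Qed.

Lemma limit_v_cvg t : 0 <= t -> t <= Ts -> (fun l => Vl l (g l t)) @ \oo --> v t.
Proof.
move=> t0 tT.
by have [] := matrix_cauchy_rate a01 (fun l k lk => V_cauchy t0 tT lk).
Qed.

Let Z_cauchy t l k : 0 <= t -> t <= Ts -> (l <= k)%N ->
  `|Zl k (g k t) - Zl l (g l t)| <= L * b ^+ l.
Proof.
move=> t0 tT lk; rewrite -(subnKC lk); apply: Z_incr.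
  rewrite /g (cell_divn u01 l (k - l) t0 tT) leq_divM/=.
  by rewrite ltnW// ltn_ceil// expn_gt0.
exact: ltnW (cell_lt u01 _ t0 tT).
Qed.

Lemma limit_z_near t l : 0 <= t -> t <= Ts -> `|z t - Zl l (g l t)| <= L * b ^+ l.
Proof.
move=> t0 tT.
by have [_] := matrix_cauchy_rate b01 (fun l k lk => Z_cauchy t0 tT lk); apply.
Qed.

Lemma limit_z_cvg t : 0 <= t -> t <= Ts -> (fun l => Zl l (g l t)) @ \oo --> z t.
Proof.
move=> t0 tT.
by have [] := matrix_cauchy_rate b01 (fun l k lk => Z_cauchy t0 tT lk).
Qed.

Lemma limit_z0 : z 0 = xi.
Proof.
have g0 l : g l 0 = 0%N by rewrite /g /cell u0 mulr0 truncn0.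
have := limit_z_cvg (lexx 0) (ltW Ts0) => /cvg_lim h.
rewrite -[LHS]h; last exact: norm_hausdorff.
rewrite (_ : (fun l => _) = fun=> xi); last by apply/funext => l; rewrite g0 Z_0.
by apply: cvg_lim; [exact: norm_hausdorff|exact: cvg_cst].
Qed.

Lemma limit_v_le t : 0 <= t -> t <= Ts -> `|v t| <= M1 + B1.
Proof.
move=> t0 tT; have h := limit_v_near 0 t0 tT; rewrite expr0 mulr1 in h.
rewrite -(subrK (Vl 0 (g 0 t)) (v t)) (le_trans (ler_normD _ _))// addrC lerD//.
exact/V_bd/ltnW/(cell_lt u01).
Qed.

(** The defect bound on dyadic intervals extends to all the times of a cell. *)
Lemma limit_sewing t l : 0 <= t -> t <= Ts ->
  `|z t - Zl l (g l t) - Vl l (g l t) *m (x t - Y l (g l t))| <= P * (a * b) ^+ l.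
Proof.
move=> t0 tT; apply: (@le_geometric _ b (L + d%:R * M1 * kappa)) => // n.
set k := g l t; set j := g (l + n) t.
have -> : z t - Zl l k - Vl l k *m (x t - Y l k) =
  (Zl (l + n) j - Zl l k - Vl l k *m (Y (l + n) j - Y l k)) +
  ((z t - Zl (l + n) j) - Vl l k *m (x t - Y (l + n) j)).
  rewrite !mulmxBr; move: (_ *m x t) (_ *m Y l k) (_ *m Y (l + n) j) => ? ? ?.
  by apply/matrixP => i0 j0; rewrite !mxE; ring.
apply: le_trans (ler_normD _ _) _; apply: lerD.
  apply: Z_sew; last exact: ltnW (cell_lt u01 _ t0 tT).
  by rewrite /k /g (cell_divn u01 l n t0 tT) leq_divM/= ltnW// ltn_ceil// expn_gt0.
have bn : b ^+ (l + n) <= b ^+ n.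
  by rewrite exprD ler_piMl// exprn_ile1//; case/andP: b01 => // _ /ltW.
apply: (le_trans (ler_normB _ _)); rewrite mulrDl; apply: lerD.
  by rewrite (le_trans (limit_z_near _ t0 tT))// ler_wpM2l.
apply: (le_trans (mulmx_norm_le _ _)); rewrite -[leRHS]mulrA; apply: ler_pM => //.
- by rewrite ler_wpM2l// V_bd// ltnW// (cell_lt u01).
- by rewrite (le_trans (Ynear _ t0 tT))// ler_wpM2l.
Qed.

Lemma limit_v_cell l s t : 0 <= s -> s <= Ts -> 0 <= t -> t <= Ts -> g l s = g l t ->
  `|v t - v s| <= 2 * B1 * a ^+ l.
Proof.
move=> s0 sT t0 tT st; rewrite -(subrKA (Vl l (g l t))) (le_trans (ler_normD _ _))//.
have := limit_v_near l t0 tT; have := limit_v_near l s0 sT; rewrite -st distrC -mulrA.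
by move: (B1 * _) => X; lra.
Qed.

Lemma limit_z_cell l s t : 0 <= s -> s <= Ts -> 0 <= t -> t <= Ts -> g l s = g l t ->
  `|z t - z s| <= 2 * L * b ^+ l.
Proof.
move=> s0 sT t0 tT st; rewrite -(subrKA (Zl l (g l t))) (le_trans (ler_normD _ _))//.
have := limit_z_near l t0 tT; have := limit_z_near l s0 sT; rewrite -st distrC -mulrA.
by move: (L * _) => X; lra.
Qed.

Let x_cell l s t : 0 <= s -> s <= Ts -> 0 <= t -> t <= Ts -> g l s = g l t ->
  `|x t - x s| <= 2 * kappa * b ^+ l.
Proof.
move=> s0 sT t0 tT st; rewrite -(subrKA (Y l (g l t))) (le_trans (ler_normD _ _))//.
have := Ynear l t0 tT; have := Ynear l s0 sT; rewrite -st distrC -mulrA.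
by move: (kappa * _) => X; lra.
Qed.

Let D s t := z t - z s - v s *m (x t - x s).

Lemma limit_defect_cell l s t : 0 <= s -> s <= Ts -> 0 <= t -> t <= Ts -> g l s = g l t ->
  `|D s t| <= (2 * P + d%:R * B1 * (2 * kappa)) * (a * b) ^+ l.
Proof.
move=> s0 sT t0 tT st; set k := g l t.
have -> : D s t = (z t - Zl l k - Vl l k *m (x t - Y l k)) -
   (z s - Zl l k - Vl l k *m (x s - Y l k)) - (v s - Vl l k) *m (x t - x s).
  rewrite /D mulmxBl !mulmxBr.
  move: (Vl l k *m x t) (Vl l k *m x s) (_ *m Y l k) (v s *m x t) (v s *m x s).
  by move=> ? ? ? ? ?; apply/matrixP => i0 j0; rewrite !mxE; ring.
apply: (le_trans (ler_normB _ _)); rewrite mulrDl; apply: lerD.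
  apply: (le_trans (ler_normB _ _)).
  have h1 := limit_sewing l t0 tT; have h2 := limit_sewing l s0 sT.
  rewrite st -/k in h2; rewrite -/k in h1; move: (lerD h1 h2); rewrite -mulrA.
  by move: (P * _) => X; lra.
apply: (le_trans (mulmx_norm_le _ _)).
have -> : d%:R * B1 * (2 * kappa) * (a * b) ^+ l =
   (d%:R * (B1 * a ^+ l)) * (2 * kappa * b ^+ l) by rewrite exprMn; ring.
apply: ler_pM => //.
  by rewrite ler_wpM2l//; have := limit_v_near l s0 sT; rewrite st.
exact: x_cell.
Qed.

Let Z_walk l k0 k1 (eta : R) : 0 <= eta -> (k0 <= k1)%N -> (k1 <= 2 ^ l)%N ->
  (forall k, (k0 <= k < k1)%N -> `|Y l k.+1 - Y l k| <= eta) ->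
  `|Zl l k1 - Zl l k0| <= 2 ^+ l * (P * (a * b) ^+ l + d%:R * M1 * eta).
Proof.
move=> eta0 k01 k1l hY.
have X0 : 0 <= P * (a * b) ^+ l + d%:R * M1 * eta by rewrite addr_ge0 ?mulr_ge0.
suff h n : (k0 + n <= k1)%N ->
    `|Zl l (k0 + n) - Zl l k0| <= n%:R * (P * (a * b) ^+ l + d%:R * M1 * eta).
  have := h (k1 - k0)%N; rewrite subnKC// => /(_ (leqnn _))/le_trans; apply.
  by rewrite ler_wpM2r// -natrX ler_nat (leq_trans (leq_subr _ _)).
elim: n => [|n ih] kn; first by rewrite addn0 !subrr normr0 mul0r.
rewrite addnS in kn *.
rewrite -(subrKA (Zl l (k0 + n))) (le_trans (ler_normD _ _))//.
rewrite mulrS mulrDl mul1r; apply: lerD; last by apply: ih; exact: ltnW.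
have := @Z_sew l 0 (k0 + n)%N (k0 + n).+1.
rewrite expn0 !muln1 addn0 leqnn leqnSn => /(_ isT) h.
have {}h := h (leq_trans kn k1l).
rewrite -(subrK (Vl l (k0 + n) *m (Y l (k0 + n).+1 - Y l (k0 + n))) (_ - _)).
apply: (le_trans (ler_normD _ _)); apply: (lerD h).
apply: (le_trans (mulmx_norm_le _ _)); apply: ler_pM => //.
- by rewrite ler_wpM2l// V_bd// (leq_trans (ltnW kn)).
- by apply: hY; rewrite leq_addr.
Qed.

(** A modulus of continuity of z in terms of that of x, and not of the clock,
    which may jump: from the cell of s to that of t, z moves along at most 2 ^ l
    dyadic intervals, on which x moves by at most 2 * eta by [Ybetween]. *)
Lemma limit_z_modulus l s t (eta : R) : 0 <= s -> s <= t -> t <= Ts ->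
  (forall r, s <= r <= t -> `|x r - x s| <= eta) ->
  `|z t - z s| <= 3 * L * b ^+ l + 2 ^+ l * (P * (a * b) ^+ l + d%:R * M1 * (2 * eta)).
Proof.
move=> s0 st tT hx; have sT := le_trans st tT; have t0 := le_trans s0 st.
have eta0 : 0 <= eta by apply: le_trans (hx s _); rewrite ?lexx.
have X0 : 0 <= 2 ^+ l * (P * (a * b) ^+ l + d%:R * M1 * (2 * eta)).
  by rewrite mulr_ge0 ?exprn_ge0// addr_ge0 ?mulr_ge0.
have Lb : 0 <= L * b ^+ l by rewrite mulr_ge0.
have := cell_nd u_nd l s0 st tT; rewrite -/g leq_eqVlt => /predU1P[gst|gst].
  apply: (le_trans (limit_z_cell s0 sT t0 tT gst)); rewrite -!mulrA.
  by move: (L * _) X0 Lb => ? ? ?; lra.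
have gtl := cell_lt u01 l t0 tT.
have h1 := limit_z_near l t0 tT; have h2 := limit_z_near l s0 sT.
have h3 := @Z_incr l 0 (g l s) (g l s).+1.
rewrite expn0 !muln1 addn0 leqnn leqnSn in h3.
have {}h3 := h3 isT (leq_trans gst (ltnW gtl)).
have h4 : `|Zl l (g l t) - Zl l (g l s).+1| <=
    2 ^+ l * (P * (a * b) ^+ l + d%:R * M1 * (2 * eta)).
  apply: Z_walk => //; first by rewrite mulr_ge0.
    exact: ltnW.
  have hY k : (g l s < k <= g l t)%N -> `|Y l k - x s| <= eta.
    by move=> /(Ybetween s0 st tT)[r hr ->]; exact: hx.
  move=> k /andP[k1 k2]; rewrite -(subrKA (x s)) (le_trans (ler_normD _ _))//.
  rewrite mulr_natl mulr2n lerD//; first by apply: hY; rewrite k2 (leq_trans k1).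
  by rewrite distrC hY// k1 ltnW.
have -> : z t - z s = (z t - Zl l (g l t)) + (Zl l (g l t) - Zl l (g l s).+1) +
   (Zl l (g l s).+1 - Zl l (g l s)) + (Zl l (g l s) - z s) by rewrite !subrKA.
have := ler_normD (z t - Zl l (g l t) + (Zl l (g l t) - Zl l (g l s).+1) +
   (Zl l (g l s).+1 - Zl l (g l s))) (Zl l (g l s) - z s).
have := ler_normD (z t - Zl l (g l t) + (Zl l (g l t) - Zl l (g l s).+1))
   (Zl l (g l s).+1 - Zl l (g l s)).
have := ler_normD (z t - Zl l (g l t)) (Zl l (g l t) - Zl l (g l s).+1).
rewrite [`|Zl l (g l s) - z s|]distrC -[3 * L * _]mulrA.
by move: h1 h2 h3 h4; move: (L * b ^+ l) (2 ^+ l * _) => *; lra.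
Qed.

Lemma limit_z_unif_cont : unif_cont_on E z.
Proof.
move=> eps eps0.
have e40 : 0 < eps / 4 by rewrite divr_gt0.
have [l1 hl1] := geometric_lt (3 * L) b01 e40.
have r01 : 0 <= 2 * (a * b) < 1 by rewrite ab1 mulr_ge0.
have [l2 hl2] := geometric_lt P r01 e40.
pose l := maxn l1 l2.
have h1 : 3 * L * b ^+ l < eps / 4.
  apply: le_lt_trans hl1; rewrite ler_wpM2l ?mulr_ge0// ler_wiXn2l ?leq_maxl//.
  by case/andP: b01 => _ /ltW.
have h2 : 2 ^+ l * (P * (a * b) ^+ l) < eps / 4.
  rewrite mulrCA -exprMn; apply: le_lt_trans hl2.
  by rewrite ler_wpM2l// ler_wiXn2l ?leq_maxr//; [case/andP: r01|exact: ltW].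
pose K := 2 ^+ l * (d%:R * M1 * 2) + 1.
have K0 : 0 < K by rewrite ltr_wpDl// mulr_ge0 ?exprn_ge0// !mulr_ge0.
have [delta d0 hd] := ux (divr_gt0 e40 K0).
have key s t : 0 <= s -> s <= t -> t <= Ts -> t - s < delta -> `|z t - z s| < eps.
  move=> s0 st tT td.
  have hx r : s <= r <= t -> `|x r - x s| <= eps / 4 / K.
    move=> /andP[sr rt]; apply/ltW/hd.
    - by rewrite /= in_itv/= (le_trans s0 sr) (le_trans rt).
    - by rewrite /= in_itv/= s0 (le_trans st).
    - by rewrite ger0_norm ?subr_ge0// (le_lt_trans _ td)// lerD2r.
  apply: (le_lt_trans (limit_z_modulus l s0 st tT hx)).
  have : 2 ^+ l * (d%:R * M1 * (2 * (eps / 4 / K))) <= eps / 4.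
    rewrite (_ : _ * _ = (2 ^+ l * (d%:R * M1 * 2)) * (eps / 4) / K); last by ring.
    by rewrite ler_pdivrMr// mulrC ler_wpM2l ?(ltW e40)// /K lerDl.
  rewrite mulrDr; move: h1 h2; move: (_ * b ^+ l) (2 ^+ l * _) (2 ^+ l * _) => *; lra.
exists delta => // s t; rewrite /E /= !in_itv/= => /andP[s0 sT] /andP[t0 tT] std.
have [st|ts] := leP s t.
  by rewrite distrC key// (le_lt_trans _ std)// distrC ler_norm.
by rewrite key//; [exact: ltW|exact: le_lt_trans (ler_norm _) std].
Qed.

(** The difference between the integral and a Young sum is a sum of defects. At a
    level l fixed first, the chains inside the cells contribute little, uniformly
    over the subdivisions; then the crossing terms, at most 2 ^ l in number,
    are made small by the mesh. *)
Lemma limit_young t : 0 <= t -> t <= Ts -> is_young_integral v x t (z t - xi).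
Proof.
move=> t0 tT; have FF := mesh_to_0_filter t.
apply/cvgrPdist_lt => eps eps0; pose r := a * b; pose C := 2 * P + d%:R * B1 * (2 * kappa).
have C0 : 0 <= C.
  apply: addr_ge0; first exact: mulr_ge0.
  by apply: mulr_ge0; exact: mulr_ge0.
pose C1 := C / (1 - 2 * r).
have r1 : 0 < 1 - 2 * r by rewrite subr_gt0.
have C10 : 0 <= C1 by rewrite divr_ge0// ltW.
have hC1 : 2 * r * C1 + C <= C1.
  have : C1 * (1 - 2 * r) = C by rewrite /C1 divfK// gt_eqF.
  by move=> <-; rewrite mulrBr mulr1; lra.
have r01 : 0 <= 2 * r < 1 by rewrite ab1 mulr_ge0.
have [l hl] := geometric_lt C1 r01 (divr_gt0 eps0 (ltr0n _ 2)).
(* The share of each of the at most 2 ^ l crossings. *)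
pose w := eps / 2 / (2 ^+ l + 1).
have p0 : 0 < 2 ^+ l + 1 :> R by rewrite ltr_wpDl// exprn_ge0.
have w0 : 0 < w by rewrite !divr_gt0.
have [delta1 d10 hd1] := limit_z_unif_cont (divr_gt0 w0 (ltr0n _ 2)).
pose K := d%:R * (M1 + B1) + 1.
have K0 : 0 < K by rewrite ltr_wpDl// mulr_ge0// addr_ge0.
have [delta2 d20 hd2] := ux (divr_gt0 (divr_gt0 w0 (ltr0n _ 2)) K0).
exists (Num.min delta1 delta2); first by rewrite /= lt_min d10.
move=> s [[ps /eqP ls] /mesh_path ms].
have ple : path <=%R 0 s by apply: sub_path ps => ? ?; exact: ltW.
have hE c : c \in 0 :: s -> 0 <= c <= t.
  move=> hc; apply/andP; split.
    move: hc; rewrite inE => /predU1P[->//|hc].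
    exact: (allP (order_path_min le_trans ple)).
  rewrite -ls; clear -ple hc; elim: s 0 c ple hc => [|b' s ih] a' c /=.
    by rewrite inE => _ /eqP->.
  move=> /andP[ab bs]; rewrite inE => /predU1P[->|]; last exact: ih.
  by rewrite (le_trans ab)// ih// mem_head.
have hE' c : c \in 0 :: s -> E c.
  by move=> /hE/andP[c0 ct]; rewrite /E /= in_itv/= c0 (le_trans ct).
have Dw : path (fun b c => `|D b c| <= w) 0 s.
  clear ls; elim: s 0 ple ms hE' {ps hE} => //= b' s ih a' /andP[ab bs] /andP[md mds] hE'.
  apply/andP; split; last by apply: ih => // c hc; apply: hE'; rewrite inE hc orbT.
  have Ea : E a' by apply: hE'; rewrite mem_head.
  have Eb : E b' by apply: hE'; rewrite !inE eqxx orbT.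
  move: md; rewrite lt_min => /andP[md1 md2].
  have ba : `|b' - a'| = b' - a' by rewrite ger0_norm// subr_ge0.
  rewrite (splitr w); apply: (le_trans (ler_normB _ _)); apply: lerD.
    by apply/ltW/hd1 => //; rewrite ba.
  apply: (le_trans (mulmx_norm_le _ _)).
  have hx : `|x b' - x a'| <= w / 2 / K by apply/ltW/hd2 => //; rewrite ba.
  apply: (@le_trans _ _ (d%:R * (M1 + B1) * (w / 2 / K))).
    apply: ler_pM => //.
    rewrite ler_wpM2l//; move: Ea; rewrite /E /= in_itv/= => /andP[? ?].
    exact: limit_v_le.
  rewrite mulrA ler_pdivrMr// mulrC ler_wpM2l//; first by apply/ltW; exact: divr_gt0.
  by rewrite /K lerDl.
have gnd l' s' t' : E s' -> E t' -> s' <= t' -> (g l' s' <= g l' t')%N.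
  rewrite /E /= !in_itv/= => /andP[? ?] /andP[? ?] ?; exact: (cell_nd u_nd).
have ghalf l' t' : E t' -> g l' t' = (g l'.+1 t')./2.
  rewrite /E /= in_itv/= => /andP[? ?]; exact: (cell_half u01).
have hD m s' t' : E s' -> E t' -> s' <= t' -> g m s' = g m t' -> `|D s' t'| <= C * r ^+ m.
  rewrite /E /= !in_itv/= => /andP[? ?] /andP[? ?] ? ?; exact: limit_defect_cell.
have := @chain_sum_cells _ _ D E g C r gnd ghalf ab0 ab1 C0 hD C1 C10 hC1 l w 0 s (ltW w0) ple hE' Dw.
rewrite ls.
have -> : chain_sum D 0 s = z t - xi - young_sum v x s.
  rewrite young_sum_chain -ls -limit_z0.
  clear; elim: s 0 => [|b' s ih] a' /=; first by rewrite !subrr.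
  rewrite ih /D; move: (v a' *m _) (chain_sum _ _ _) => P1 P2.
  by apply/matrixP => i0 j0; rewrite !mxE; ring.
move=> /le_lt_trans; apply.
have gl : (g l t - g l 0 < 2 ^ l)%N.
  by apply: leq_ltn_trans (leq_subr _ _) _; exact: (cell_lt u01).
apply: (@le_lt_trans _ _ (2 ^+ l * (C1 * r ^+ l) + 2 ^+ l * w)).
  have rl := exprn_ge0 l ab0.
  apply: lerD; apply: ler_wpM2r; first exact: mulr_ge0.
  - by rewrite -natrX ler_nat.
  - exact: ltW.
  - by rewrite ltW// -natrX ltr_nat.
rewrite (splitr eps); apply: ltr_leD; first by rewrite mulrCA -exprMn.
by rewrite /w mulrA ler_pdivrMr// mulrC ler_wpM2l ?lerDl// divr_ge0// ltW.
Qed.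

(** For the level l with 2 ^ (- l.+1) < u t - u s <= 2 ^ (- l), the times s and t are
    in the same cell or in adjacent ones, and (b ^+ l) `^ q = 2 ^ (- l).
    The bound has the form of the hypothesis of [pvar_sum_control], with no error. *)
Lemma limit_z_control q s t : 0 < q -> b `^ q = 2^-1 -> 0 <= s -> s < t -> t <= Ts ->
  `|z t - z s| `^ q <= (3 * L) `^ q * 2 * u t - (3 * L) `^ q * 2 * u s + 0.
Proof.
move=> q0 bq s0 st tT; have sT := le_trans (ltW st) tT; have t0 := le_trans s0 (ltW st).
rewrite addr0 -mulrBr.
have key l : 2 ^+ l * (u t - u s) <= 1 -> `|z t - z s| <= 3 * L * b ^+ l.
  move=> hl; have := cell_near u01 s0 (ltW st) tT hl.
  have gn := cell_nd u_nd l s0 (ltW st) tT.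
  rewrite leq_eqVlt ltnS => /predU1P[gt|gt]; last first.
    have gst : g l s = g l t by apply/eqP; rewrite eqn_leq gn.
    apply: (le_trans (limit_z_cell s0 sT t0 tT gst)).
    have : 0 <= L * b ^+ l by rewrite mulr_ge0.
    by rewrite -!mulrA; move: (L * _) => X; lra.
  have h1 := limit_z_near l t0 tT; have h2 := limit_z_near l s0 sT.
  rewrite /g gt in h1.
  have h3 := @Z_incr l 0 (g l s) (g l s).+1.
  rewrite expn0 !muln1 addn0 leqnn leqnSn in h3.
  have gtl := cell_lt u01 l t0 tT; rewrite gt in gtl.
  have {}h3 := h3 isT (ltnW gtl).
  have -> : z t - z s = (z t - Zl l (g l s).+1) +
     (Zl l (g l s).+1 - Zl l (g l s)) + (Zl l (g l s) - z s) by rewrite !subrKA.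
  have := ler_normD (z t - Zl l (g l s).+1 + (Zl l (g l s).+1 - Zl l (g l s)))
     (Zl l (g l s) - z s).
  have := ler_normD (z t - Zl l (g l s).+1) (Zl l (g l s).+1 - Zl l (g l s)).
  rewrite [`|Zl l (g l s) - z s|]distrC -[3 * L * _]mulrA.
  by move: h1 h2 h3; move: (L * b ^+ l) => *; lra.
have ust : 0 <= u t - u s by rewrite subr_ge0 u_nd// ltW.
have [us0|us0] := eqVneq (u t - u s) 0.
  have : `|z t - z s| <= 0.
    apply: (@le_geometric _ b (3 * L)) => // n; rewrite add0r; apply: key.
    by rewrite us0 mulr0.
  rewrite normr_le0 => /eqP->; rewrite normr0 powR0 ?gt_eqF//.
  by rewrite mulr_ge0// mulr_ge0// powR_ge0.
have u0' : 0 < u t - u s by rewrite lt_neqAle eq_sym us0.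
have u1 : u t - u s <= 1.
  by have /andP[] := u01 t0 tT; have /andP[] := u01 s0 sT; lra.
have exl : exists l, 2^-1 ^+ l.+1 < u t - u s.
  have [|l hl] := @geometric_lt R 2^-1 1 (u t - u s) _ u0'.
    by apply/andP; split; lra.
  exists l; apply: le_lt_trans hl; rewrite mul1r exprS ler_piMl ?exprn_ge0//; lra.
have [l hl lmin] := ex_minnP exl.
have hl' : 2 ^+ l * (u t - u s) <= 1.
  case: l lmin {hl} => [_|l lmin]; first by rewrite expr0 mul1r.
  have : ~~ (2^-1 ^+ l.+1 < u t - u s) by apply/negP => /lmin; rewrite ltnn.
  by rewrite -leNgt exprVn -ler_pdivlMl ?mulr1// exprn_gt0.
apply: (@le_trans _ _ ((3 * L * b ^+ l) `^ q)).
  by apply: ge0_ler_powR; rewrite ?(ltW q0) ?nnegrE ?mulr_ge0// key.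
rewrite powRM ?mulr_ge0// -mulrA; apply: ler_wpM2l; first exact: powR_ge0.
rewrite -powR_mulrn// powRAC bq powR_mulrn ?invr_ge0//.
by move: hl; rewrite exprS; move: (2^-1 ^+ l) => X; lra.
Qed.

Lemma limit_z_finite_pvar q : 0 < q -> b `^ q = 2^-1 -> finite_pvar q E z.
Proof.
move=> q0 bq; apply/finite_pvarP => //; exists ((3 * L) `^ q * 2 - 0 + 0) => s ss sE.
have Lq : 0 <= (3 * L) `^ q * 2 by rewrite mulr_ge0// powR_ge0.
apply: (le_trans (pvar_sum_control (p := q) (E := E) (x := z) (eta := 0)
  (G := fun t => (3 * L) `^ q * 2 * u t) (m := 0) (M := (3 * L) `^ q * 2) _ _ _ _ ss sE)) => //.
- move=> r t; rewrite /E /= !in_itv/= => /andP[r0 _] /andP[_ tT] rt.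
  exact: limit_z_control.
- move=> r; rewrite /E /= in_itv/= => /andP[r0 rT].
  have /andP[h0 h1] := u01 r0 rT.
  by rewrite mulr_ge0//= ler_piMr// ltW.
- by rewrite mulr0.
Qed.

(** If l is the first level that separates s and t, then v moves by O(a ^+ l), and
    the cell index of level l increases by at least one. So the function
    G n, a weighted sum of the cell indices of the levels up to n, controls the
    r-th powers of the increments of v up to an error that vanishes
    with n; it is bounded uniformly in n because a ^ r < 1 / 2. *)
Lemma limit_v_finite_pvar r : 0 < r -> 0 < a -> a `^ r * 2 < 1 -> finite_pvar r E v.
Proof.
move=> r0 apos ar; pose ra := a `^ r; pose K := (2 * B1 / a) `^ r.
have ra0 : 0 <= ra := powR_ge0 _ _.
have K0 : 0 <= K := powR_ge0 _ _.
have ra1 : 0 <= ra < 1 by apply/andP; split=> //; rewrite /ra; move: ar ra0; rewrite /ra; lra.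
pose G n t := K * \sum_(l < n.+1) (g l t)%:R * ra ^+ l.
have step n s t : 0 <= s -> s < t -> t <= Ts ->
    `|v t - v s| `^ r <= G n t - G n s + K * ra ^+ n.
  move=> s0 st tT; have sT := le_trans (ltW st) tT; have t0 := le_trans s0 (ltW st).
  have same l : g l s = g l t -> `|v t - v s| `^ r <= K * ra ^+ l.+1.
    move=> gst; have := limit_v_cell s0 sT t0 tT gst => h.
    have -> : K * ra ^+ l.+1 = (2 * B1 / a * a ^+ l.+1) `^ r.
      rewrite powRM//; last by rewrite divr_ge0// mulr_ge0.
      by rewrite -[a ^+ _]powR_mulrn// powRAC powR_mulrn// powR_ge0.
    apply: ge0_ler_powR; rewrite ?(ltW r0) ?nnegrE//.
      by apply: mulr_ge0 => //; apply: divr_ge0 => //; exact: mulr_ge0.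
    by rewrite exprS mulrA divfK// gt_eqF.
  have gn l : ((g l s)%:R <= (g l t)%:R :> R) by rewrite ler_nat (cell_nd u_nd)// ltW.
  have GS n' t' : G n'.+1 t' = G n' t' + K * ((g n'.+1 t')%:R * ra ^+ n'.+1).
    by rewrite /G big_ord_recr/= mulrDr.
  have Gn n' : 0 <= G n' t - G n' s.
    rewrite subr_ge0 /G ler_wpM2l// ler_sum// => l _.
    by rewrite ler_wpM2r// exprn_ge0.
  suff : g n s = g n t \/ `|v t - v s| `^ r <= G n t - G n s.
    move=> [/same h|h]; last first.
      by rewrite (le_trans h)// lerDl mulr_ge0// exprn_ge0.
    apply: (le_trans h); rewrite -[leLHS]add0r lerD// ler_wpM2l//.
    by rewrite exprS ler_piMl ?exprn_ge0//; case/andP: ra1 => _ /ltW.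
  elim: n => [|n [ih|ih]].
  - left; have := cell_lt u01 0 s0 sT; have := cell_lt u01 0 t0 tT.
    by rewrite expn0 !ltnS !leqn0 /g => /eqP-> /eqP->.
  - have [gS|gS] := eqVneq (g n.+1 s) (g n.+1 t); [by left|right].
    apply: (le_trans (same _ ih)); rewrite !GS.
    have : 1 <= (g n.+1 t)%:R - (g n.+1 s)%:R :> R.
      rewrite lerBrDl natr1 ler_nat ltn_neqAle gS/= (cell_nd u_nd)// ltW //.
    have X0 : 0 <= K * ra ^+ n.+1 by rewrite mulr_ge0// exprn_ge0.
    move=> h1; have h : K * ra ^+ n.+1 <=
        K * ((g n.+1 t)%:R * ra ^+ n.+1) - K * ((g n.+1 s)%:R * ra ^+ n.+1).
      rewrite [leRHS](_ : _ = ((g n.+1 t)%:R - (g n.+1 s)%:R) * (K * ra ^+ n.+1)); last by ring.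
      by rewrite ler_peMl.
    by move: (Gn n) h; move: (G n t) (G n s) (K * (_ * _)) (K * (_ * _)) (K * _) => *; lra.
  - right; apply: (le_trans ih); rewrite !GS.
    have : K * ((g n.+1 s)%:R * ra ^+ n.+1) <= K * ((g n.+1 t)%:R * ra ^+ n.+1).
      by rewrite ler_wpM2l// ler_wpM2r// exprn_ge0.
    move: (G n t) (G n s) (K * (_ * _)) (K * (_ * _)) => *; lra.
have ar01 : 0 <= ra * 2 < 1 by rewrite ar mulr_ge0.
apply/finite_pvarP => //; exists (K * (1 - ra * 2)^-1) => s ss sE.
apply: (@le_geometric _ ra ((size s)%:R * K)) => // n.
have M0' : 0 <= K * (1 - ra * 2)^-1.
  by rewrite mulr_ge0// invr_ge0 subr_ge0 ltW//; case/andP: ar01.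
rewrite -mulrA -[X in _ <= X + _]subr0.
apply: (pvar_sum_control (E := E) (G := G n)) => //.
- by rewrite mulr_ge0// exprn_ge0.
- move=> p t; rewrite /E /= !in_itv/= => /andP[p0 _] /andP[_ tT] pt.
  exact: step.
- move=> t; rewrite /E /= in_itv/= => /andP[t0 tT]; apply/andP; split.
    by rewrite mulr_ge0// sumr_ge0// => l _; rewrite mulr_ge0// exprn_ge0.
  rewrite /G ler_wpM2l//; apply: le_trans (geometric_sum_le n.+1 ar01).
  apply: ler_sum => l _; rewrite exprMn mulrC ler_wpM2l ?exprn_ge0//.
  by rewrite -natrX ler_nat ltnW// (cell_lt u01).
Qed.

(** On both sides of a time the cell indices are eventually constant, on the right
    equal to their value at this time; v is within O(a ^+ l) of a constant on each cell. *)
Lemma limit_v_cadlag : cadlag_on E v.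
Proof.
move=> t; rewrite /E /= in_itv/= => /andP[t0 tT]; split.
  apply/cvgrPdist_lt => eps eps0; rewrite near_withinE.
  move: (tT); rewrite le_eqVlt => /predU1P[tTs|tlT].
    have : \forall s \near t^'+, t < s by exact: nbhs_right_gt.
    apply: filterS => s ts; rewrite /E /= in_itv/= => /andP[_ sT].
    by move: sT; rewrite -tTs leNgt ts.
  have [l hl] := geometric_lt (2 * B1) a01 eps0.
  have [w tw hw] := cell_right u_nd u01 u_rc l t0 tlT.
  have h1 : \forall s \near t^'+, s < w by exact: nbhs_right_lt.
  have h2 : \forall s \near t^'+, t < s by exact: nbhs_right_gt.
  apply: filterS2 h1 h2 => s sw ts; rewrite /E /= in_itv/= => /andP[s0 sT].
  apply: le_lt_trans hl; apply: limit_v_cell => //.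
  by apply: hw => //; rewrite sw ltW.
move: (t0); rewrite le_eqVlt => /predU1P[t00|tpos].
  exists 0; apply/cvgrPdist_lt => eps eps0; rewrite near_withinE.
  have : \forall s \near t^'-, s < t by exact: nbhs_left_lt.
  apply: filterS => s st; rewrite /E /= in_itv/= => /andP[s0 _].
  by move: s0; rewrite t00 leNgt st.
(* The left limit is a cluster point along a sequence that increases to t. *)
pose tn (n : nat) := t - t / n.+1%:R.
have tnE n : 0 <= tn n < t.
  rewrite /tn subr_ge0 ler_pdivrMr// ler_peMr ?ler1n//=.
  by rewrite gtrBl divr_gt0.
have tnT n : tn n <= Ts by have /andP[_ /ltW/le_trans] := tnE n; apply.
have tn0 n : 0 <= tn n by have /andP[] := tnE n.
have vb n : [set A | `|A - 0| <= M1 + B1] (v (tn n)).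
  by rewrite /= subr0 limit_v_le.
have [p hp] := compact_cluster_seq (@compact_matrix_ball R e d 0 (M1 + B1)) vb.
exists p; apply/cvgrPdist_lt => eps eps0; rewrite near_withinE.
have e20 : 0 < eps / 2 by rewrite divr_gt0.
have [l hl] := geometric_lt (2 * B1) a01 e20.
have [w /andP[w0 wt] hw] := cell_left u_nd u01 l tpos tT.
have tw0 : 0 < t - w by rewrite subr_gt0.
have [k hk] := harmonic_lt (divr_gt0 tw0 tpos).
have [n kn hn] := hp _ e20 k.
have wtn : w <= tn n.
  rewrite /tn lerBrDr -lerBrDl mulrC -ler_pdivlMr//.
  by apply: ltW; apply: le_lt_trans hk; rewrite lef_pV2 ?posrE// ler_nat ltnS.
have h1 : \forall s \near t^'-, s < t by exact: nbhs_left_lt.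
have h2 : \forall s \near t^'-, w < s by exact: nbhs_left_gt.
apply: filterS2 h1 h2 => s st ws; rewrite /E /= in_itv/= => /andP[s0 sT].
rewrite -(subrKA (v (tn n))) (le_lt_trans (ler_normD _ _))//.
rewrite (splitr eps) ltrD//; apply: le_lt_trans hl; apply: limit_v_cell => //.
rewrite /g hw; last by rewrite st ltW.
by rewrite hw// wtn; have /andP[] := tnE n.
Qed.

Variables (F : 'cV[R]_e -> set 'M[R]_(e, d)) (U : set 'cV[R]_e).
Variables (c0 : 'cV[R]_e) (rho K q gamma p : R).
Hypothesis ballU : forall w, `|w - c0| <= rho -> U w.
Hypothesis Fc : forall w, `|w - c0| <= rho -> compact (F w).
Hypothesis FK : forall w y pt eta, `|w - c0| <= rho -> `|y - c0| <= rho -> F w pt ->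
  0 < eta -> exists2 p', F y p' & `|pt - p'| < K * `|w - y| `^ gamma + eta.
Hypothesis Z_ball : forall l k, (k <= 2 ^ l)%N -> `|Zl l k - c0| <= rho.
Hypothesis Z_F : forall l k, (k <= 2 ^ l)%N -> F (Zl l k) (Vl l k).
Hypotheses (K0 : 0 <= K) (gamma0 : 0 < gamma) (q0 : 0 < q) (apos : 0 < a).
Hypotheses (bq : b `^ q = 2^-1) (bg : b `^ gamma = a).
Hypotheses (p1 : 1 <= p) (pq : 1 < p^-1 + q^-1) (ap : a `^ p * 2 < 1).
Hypothesis ar : forall r, q / gamma < r -> a `^ r * 2 < 1.

Lemma limit_z_ball t : 0 <= t -> t <= Ts -> `|z t - c0| <= rho.
Proof.
move=> t0 tT; apply: (@le_geometric _ b L) => // n.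
rewrite -(subrKA (Zl n (g n t))) (le_trans (ler_normD _ _))// addrC lerD//.
  by apply/Z_ball/ltnW/(cell_lt u01).
exact: limit_z_near.
Qed.

(** The Hoelder condition moves the velocities at dyadic levels into
    F (z t), which is closed. *)
Lemma limit_velocity t : 0 <= t -> t <= Ts -> F (z t) (v t).
Proof.
move=> t0 tT; have zb := limit_z_ball t0 tT.
apply: (compact_adherent (Fc zb)) => eps eps0.
have e20 : 0 < eps / 2 by rewrite divr_gt0.
have [l hl] := geometric_lt (B1 + K * L `^ gamma) a01 e20.
have gl := ltnW (cell_lt u01 l t0 tT).
have [p' Fp' hp'] := FK (Z_ball gl) zb (Z_F gl) e20.
exists p' => //; rewrite -(subrKA (Vl l (cell u l t))) (le_lt_trans (ler_normD _ _))//.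
have h1 := limit_v_near l t0 tT.
have h2 : `|Zl l (cell u l t) - z t| `^ gamma <= L `^ gamma * a ^+ l.
  rewrite -bg -powR_mulrn ?powR_ge0// powRAC powR_mulrn// -powRM//.
  apply: ge0_ler_powR; rewrite ?(ltW gamma0) ?nnegrE ?mulr_ge0//.
  by rewrite distrC; exact: limit_z_near.
have := ler_wpM2l K0 h2; move: hl hp' h1; rewrite mulrDl -[K * _ * _]mulrA /g.
by move: (K * _) (K * (_ * _)) (B1 * _) => *; lra.
Qed.

Lemma limit_solution_spec :
  [/\ solution_with_velocity q U F xi x Ts z v,
      cont_finite_pvar q E z & cadlag_finite_pvar_plus (q / gamma) E v].
Proof.
have p0 : 0 < p by rewrite (lt_le_trans _ p1).
have zE : cont_finite_pvar q E z.
  split; last exact: limit_z_finite_pvar.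
  apply/subspace_continuousP => t Et; apply/cvgrPdist_lt => eps eps0.
  have [delta d0 hd] := limit_z_unif_cont eps0; rewrite near_withinE.
  by apply/nbhs_normP; exists delta => // s /= ts Es; exact: hd.
have inE' t : t \in `[0, Ts] -> 0 <= t /\ t <= Ts by rewrite in_itv/= => /andP[].
split=> //; first split.
- by move=> t /inE'[t0 tT]; apply/ballU/limit_z_ball.
- split; first by case: zE.
  by move=> H _ HE; case: zE => _; exact: finite_pvar_sub.
- exists p; split=> // H _ HE; apply: (finite_pvar_sub p0 HE).
  exact: limit_v_finite_pvar.
- move=> t /inE'[t0 tT]; split; last exact: limit_velocity.
  by exists (z t - xi); [exact: limit_young|rewrite subrKC].
move=> r qr; split; first exact: limit_v_cadlag.
apply: limit_v_finite_pvar => //; last exact: ar.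
by apply: lt_trans qr; rewrite divr_gt0.
Qed.


End limit_solution.

(** * Measurability of the clock and of the Euler scheme *)

Lemma powR_small {R : realType} (K gamma eps : R) : 0 <= K -> 0 < gamma -> 0 < eps ->
  exists2 theta : R, 0 < theta & forall x, 0 <= x -> x <= theta -> K * x `^ gamma <= eps.
Proof.
move=> K0 g0 e0; have K1 : 0 < K + 1 by rewrite ltr_wpDl.
exists ((eps / (K + 1)) `^ gamma^-1); first by rewrite powR_gt0// divr_gt0.
move=> x x0 /(root_le_powR g0 x0 (ltW (divr_gt0 e0 K1))) h.
apply: (le_trans (ler_wpM2l K0 h)).
by rewrite mulrA ler_pdivrMr// mulrC ler_wpM2l ?(ltW e0)// lerDl.
Qed.

Definition pair_seq {V W : Type} (cV : nat -> V) (cW : nat -> W) (n : nat) : V * W :=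
  let ij := odflt (0%N, 0%N) (unpickle n) in (cV ij.1, cW ij.2).

Lemma dense_pair_seq {R : realType} (V W : normedModType R) (cV : nat -> V) (cW : nat -> W) :
  dense_seq cV -> dense_seq cW -> dense_seq (pair_seq cV cW).
Proof.
move=> dV dW [v w] eps e0; have [i hi] := dV v eps e0; have [j hj] := dW w eps e0.
exists (pickle (i, j)); rewrite /pair_seq pickleK/=.
by rewrite prod_normE gt_max hi.
Qed.

Section clock_measurability.
Context {R : realType} {dS : measure_display} {S : measurableType dS}.
Context {m n : nat}.
Local Notation V := 'M[R]_(m, n).
Variables (D : set S) (X : S -> R -> V) (q T : R).
Hypothesis q0 : 0 < q.
Hypothesis T0 : 0 < T.
Hypothesis mX : forall t : R, 0 <= t -> t <= T -> tmeas_fun D (X^~ t).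
Hypothesis uX : forall w, D w -> unif_cont_on `[0, T] (X w).
Hypothesis vX : forall w, D w -> finite_pvar q `[0, T] (X w).

Lemma tmeas_fun_gtP (f : S -> R^o) :
  (forall a, tmeas D (fun w => a < f w)) -> tmeas_fun D f.
Proof.
move=> mf; apply: tmeas_fun_ltP => a.
apply: (@tmeas_ext _ _ _ (fun w => exists k : nat, ~ (a - k.+1%:R^-1 < f w))).
  move=> w _; split=> [[k /negP]|fa].
    by rewrite -leNgt => /le_lt_trans; apply; rewrite gtrBl invr_gt0.
  have [|k hk] := @harmonic_lt R (a - f w); first by rewrite subr_gt0.
  by exists k; apply/negP; rewrite -leNgt lerBrDr -lerBrDl ltW.
by apply: tmeas_ex => k; exact: tmeas_not.
Qed.

Lemma tmeas_fun_sum (f : nat -> S -> R^o) k : (forall i, (i < k)%N -> tmeas_fun D (f i)) ->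
  tmeas_fun D (fun w => \sum_(i < k) f i w : R^o).
Proof.
elim: k => [_|k ih mf].
  apply: tmeas_fun_ext (tmeas_fun_cst D (0 : R^o)) => w _; by rewrite big_ord0.
apply: (@tmeas_fun_ext _ _ _ _ (fun w => (\sum_(i < k) f i w : R^o) + f k w)).
  by move=> w _; rewrite big_ord_recr.
apply: (tmeas_fun2 (h := fun z : R^o * R^o => z.1 + z.2) dense_rat_real dense_rat_real).
- exact: add_continuous.
- by apply: ih => i ik; apply: mf; exact: ltnW.
- exact: mf.
Qed.

Lemma tmeas_pvar_sum (s : seq R) : (forall r, r \in s -> 0 <= r <= T) ->
  tmeas_fun D (fun w => pvar_sum q (X w) s : R^o).
Proof.
move=> hs; apply: (tmeas_fun_sum (f := fun k w => `|X w s`_k.+1 - X w s`_k| `^ q)) => k ks.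
have hk i : (i < size s)%N -> tmeas_fun D (X^~ s`_i).
  by move=> /(mem_nth 0)/hs/andP[? ?]; exact: mX.
have ks' : (k.+1 < size s)%N by case: (size s) ks.
have mn : tmeas_fun D (fun w => `|X w s`_k.+1 - X w s`_k| : R^o).
  apply: (tmeas_fun_comp (h := fun v : V => `|v| : R^o) (f := fun w => X w s`_k.+1 - X w s`_k)).
    exact: norm_continuous.
  apply: (tmeas_fun2 (h := fun z : V * V => z.1 - z.2) (@dense_rat_matrix R _ _) (@dense_rat_matrix R _ _)).
  - exact: sub_continuous.
  - exact: hk.
  - by apply: hk; exact: ltnW.
apply: tmeas_fun_ltP => a.
apply: (@tmeas_ext _ _ _ (fun w => 0 < a /\ (`|X w s`_k.+1 - X w s`_k| : R^o) < a `^ q^-1)).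
  move=> w _; split=> [[a0 h]|h].
    rewrite -[ltRHS](powR_rootV q0 (ltW a0)).
    by apply: gt0_ltr_powR; rewrite ?nnegrE ?powR_ge0.
  have a0 : 0 < a by apply: le_lt_trans h; exact: powR_ge0.
  split=> //; rewrite -[ltLHS](powR_root q0)//.
  by apply: gt0_ltr_powR; rewrite ?invr_gt0 ?nnegrE ?powR_ge0// ltW.
by apply: tmeas_and; [exact: tmeas_cst|exact: tmeas_lt].
Qed.

Let hC w : D w -> exists C : R, forall s : seq R, sorted <%R s ->
  (forall u, u \in s -> `[0, T]%classic u) -> pvar_sum q (X w) s <= C.
Proof. by move=> /vX/(finite_pvarP _ _ q0). Qed.

Lemma tmeas_rat_qvar t : t <= T -> tmeas_fun D (fun w => rat_qvar q (X w) t : R^o).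
Proof.
move=> tT; apply: tmeas_fun_gtP => a.
apply: (@tmeas_ext _ _ _ (fun w => exists s : seq rat, rat_times t s /\
    a < pvar_sum q (X w) (map ratr s))).
  move=> w Dw; have [C xC] := hC Dw.
  have hsup : has_sup [set pvar_sum q (X w) (map ratr s) | s in rat_times t].
    split; first by exists (pvar_sum q (X w) [::]), [::].
    exists C => _ [s [ss st] <-]; apply: xC.
      by rewrite sorted_map; apply: sub_sorted ss => r1 r2; rewrite /= ltr_rat.
    move=> u /mapP[r /st/andP[r0 rt] ->] /=.
    by rewrite in_itv/= r0 (le_trans (ltW rt)).
  split=> [[s [st h]]|h].
    by apply: (lt_le_trans h); apply: ub_le_sup; [exact: hsup.2|exists s].
  have a0 : 0 < rat_qvar q (X w) t - a by rewrite subr_gt0.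
  have [_ [s st <-] hs] := sup_adherent a0 hsup.
  by exists s; split=> //; move: hs; rewrite subKr.
apply: tmeas_ex => s.
have [st|nst] := pselect (rat_times t s : Prop); last first.
  by apply: (@tmeas_ext _ _ _ (fun=> False)); [move=> w _; split=> // -[]|exact: tmeas_cst].
apply: tmeas_and; first exact: tmeas_cst.
apply: tmeas_gt; apply: tmeas_pvar_sum => _ /mapP[r rs ->].
by have /andP[-> /ltW/le_trans] := st.2 _ rs; apply.
Qed.

Lemma tmeas_rat_qvar_right t : 0 <= t -> t < T ->
  tmeas_fun D (fun w => rat_qvar_right q T (X w) t : R^o).
Proof.
move=> t0 tT; apply: tmeas_fun_ltP => a.
apply: (@tmeas_ext _ _ _ (fun w => exists k : nat,
    (rat_qvar q (X w) (t + (T - t) / k.+1%:R) : R^o) < a)).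
  move=> w Dw; have [C xC] := hC Dw.
  by rewrite (rat_qvar_right_lt xC a tT).
apply: tmeas_ex => k; apply: tmeas_lt; apply: tmeas_rat_qvar.
rewrite -lerBrDl ler_pdivrMr// ler_peMr ?ler1n// subr_ge0; exact: ltW.
Qed.

Lemma tmeas_clock t : 0 <= t -> t < T -> tmeas_fun D (fun w => clock q T (X w) t : R^o).
Proof.
move=> t0 tT.
apply: (tmeas_fun2 (h := fun z : R^o * R^o => z.1 - z.2) dense_rat_real dense_rat_real).
- exact: sub_continuous.
- exact: tmeas_rat_qvar_right.
- exact: tmeas_rat_qvar_right.
Qed.

Variable Ts : R.
Hypotheses (Ts0 : 0 < Ts) (TsT : Ts < T).

Lemma clock_path_facts w : D w ->
  [/\ unif_cont_on `[0, Ts] (X w),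
      forall s t : R, 0 <= s -> s <= t -> t <= Ts -> clock q T (X w) s <= clock q T (X w) t,
      forall t eta : R, 0 <= t -> t < Ts -> 0 < eta ->
        exists2 u, t < u & forall s, t <= s < u -> clock q T (X w) s < clock q T (X w) t + eta &
      forall s t : R, 0 <= s -> s < t -> t <= Ts ->
        `|X w t - X w s| `^ q <= clock q T (X w) t - clock q T (X w) s].
Proof.
move=> Dw; have [C xC] := hC Dw; split.
- move=> eta eta0; have [delta d0 hd] := uX Dw eta0; exists delta => // s t.
  rewrite /= !in_itv/= => /andP[s0 sT] /andP[t0 tT]; apply: hd.
    by rewrite /= in_itv/= s0 (le_trans sT)// ltW.
  by rewrite /= in_itv/= t0 (le_trans tT)// ltW.
- by move=> s t s0 st tT; apply: (clock_nd xC) => //; exact: le_lt_trans TsT.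
- by move=> t eta t0 tT eta0; apply: (clock_right_cont xC) => //; exact: lt_trans TsT.
- move=> s t s0 st tT; apply: (clock_control q0 (uX Dw) xC) => //.
  exact: le_lt_trans TsT.
Qed.

(** The grid points that approximate the hitting time from above take countably
    many values, and x is continuous. *)
Lemma tmeas_hit u : tmeas_fun D (fun w => X w (hit Ts (clock q T (X w)) u)).
Proof.
have Tk N k : (k <= N.+1)%N -> 0 <= Ts * k%:R / N.+1%:R <= Ts.
  move=> kN; rewrite divr_ge0 ?mulr_ge0 ?(ltW Ts0)//=.
  by rewrite ler_pdivrMr// ler_wpM2l ?ler_nat// ltW.
apply: (tmeas_fun_lim (f := fun N w =>
   X w (Ts * (minn (grid_hit Ts (clock q T (X w)) N u) N.+1)%:R / N.+1%:R))).
  move=> N; apply: (tmeas_fun_sel (J := fun w => grid_hit Ts (clock q T (X w)) N u)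
     (f := fun k w => X w (Ts * (minn k N.+1)%:R / N.+1%:R))) => [k|k].
    apply: tmeas_least => j; have [jN|jN] := leqP j N; last first.
      apply: (@tmeas_ext _ _ _ (fun=> True)); last exact: tmeas_cst.
      by move=> w _; split=> // _; right.
    have /andP[t0 tT] := Tk N j (leqW jN).
    apply: tmeas_or; last exact: tmeas_cst.
    apply: (@tmeas_ext _ _ _ (fun w => ~ ((clock q T (X w) (Ts * j%:R / N.+1%:R) : R^o) < u))).
      by move=> w _; split=> [/negP|h]; [rewrite -leNgt|apply/negP; rewrite -leNgt].
    by apply/tmeas_not/tmeas_lt/tmeas_clock => //; exact: le_lt_trans TsT.
  have /andP[t0 tT] := Tk N (minn k N.+1) (geq_minr _ _).
  by apply: mX => //; rewrite (le_trans tT)// ltW.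
move=> w Dw; have [h1 h2 h3 h4] := clock_path_facts Dw.
exact: grid_hit_cvg.
Qed.

Lemma tmeas_cell (delta : R) l t : 0 < delta -> 0 <= t -> t <= Ts -> forall k,
  tmeas D (fun w => cell (fun s => clock q T (X w) s / delta) l t = k).
Proof.
move=> d0 t0 tT k.
have p0 : 0 < 2 ^+ l :> R by rewrite exprn_gt0.
apply: (@tmeas_ext _ _ _ (fun w => ~ ((clock q T (X w) t : R^o) < k%:R * delta / 2 ^+ l)
   /\ (clock q T (X w) t : R^o) < k.+1%:R * delta / 2 ^+ l)).
  move=> w Dw; have [C xC] := hC Dw; have [h1 h2 h3 h4] := clock_path_facts Dw.
  have c0 : 0 <= 2 ^+ l * (clock q T (X w) t / delta).
    by rewrite mulr_ge0// ?(ltW p0)// divr_ge0 ?(ltW d0)// -(clock0 q T (X w)) h2.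
  have eq1 r : r * delta / 2 ^+ l <= clock q T (X w) t <-> r <= 2 ^+ l * (clock q T (X w) t / delta).
    by rewrite ler_pdivrMr// mulrA ler_pdivlMr// [2 ^+ l * _]mulrC.
  have eq2 r : clock q T (X w) t < r * delta / 2 ^+ l <-> 2 ^+ l * (clock q T (X w) t / delta) < r.
    by rewrite ltr_pdivlMr// mulrA ltr_pdivrMr// [2 ^+ l * _]mulrC.
  split=> [[/negP]|].
    rewrite -leNgt => /eq1 g1 /eq2 g2; apply: truncn_def; by rewrite g1.
  move=> /eqP; rewrite /cell truncn_eq// => /andP[/eq1 g1 /eq2 g2]; split=> //.
  by apply/negP; rewrite -leNgt.
have mc := tmeas_clock t0 (le_lt_trans tT TsT).
by apply: tmeas_and; [apply: tmeas_not|]; exact: tmeas_lt.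
Qed.

End clock_measurability.

Section euler_measurability.
Context {R : realType} {dS : measure_display} {S : measurableType dS} {d e : nat}.
Variables (D : set S) (F : 'cV[R]_e -> set 'M[R]_(e, d)) (c0 : 'cV[R]_e) (rho : R).
Variables (c : nat -> 'M[R]_(e, d)) (B a K gamma : R).
Hypotheses (K0 : 0 <= K) (gamma0 : 0 < gamma).
Hypothesis FK : forall x y p eta, `|x - c0| <= rho -> `|y - c0| <= rho -> F x p ->
  0 < eta -> exists2 p', F y p' & `|p - p'| < K * `|x - y| `^ gamma + eta.
Variables (n : nat) (eps : R) (xi : S -> 'cV[R]_e) (Y : S -> nat -> 'cV[R]_d).
Hypothesis mxi : tmeas_fun D xi.
Hypothesis mY : forall i, tmeas_fun D (Y^~ i).

(** Lower semicontinuity of F, from the Hoelder condition. *)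
Lemma open_almost_in p : open [set z | almost_in F c0 rho eps z p].
Proof.
apply/open_normP => z [zr [p' Fp' pp']].
have s0 : 0 < (eps - `|p - p'|) / 2 by rewrite divr_gt0// subr_gt0.
have [theta t0 ht] := powR_small K0 gamma0 s0.
exists (Num.min theta (rho - `|z - c0|)); first by rewrite lt_min t0 subr_gt0.
move=> y; rewrite lt_min => /andP[zy1 zy2].
have yr : `|y - c0| < rho.
  rewrite -(subrKA z) (le_lt_trans (ler_normD _ _))//.
  by rewrite distrC -ltrBrDr.
have [p'' Fp'' h] := FK (ltW zr) (ltW yr) Fp' s0.
split=> //; exists p'' => //; rewrite -(subrKA p') (le_lt_trans (ler_normD _ _))//.
have := ht _ (normr_ge0 (z - y)) (ltW zy1); move: h; move: (K * _) => *; lra.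
Qed.

Let idx w i := euler_idx F c0 rho c B a n eps (xi w) (Y w) i.
Let ez w i := euler_z F c0 rho c B a n eps (xi w) (Y w) i.

Lemma tmeas_euler i : (forall j, tmeas D (fun w => idx w i = j)) /\
  tmeas_fun D (ez^~ i).
Proof.
have [i' le_i] := ubnP i; elim: i' i le_i => // i' IH [_|i le_i].
  split; last exact: mxi.
  by apply: tmeas_least => j; exact: (mxi (@open_almost_in (c j))).
have mz : tmeas_fun D (ez^~ i.+1).
  have [mi mzi] := IH i le_i.
  apply: (tmeas_fun_sel (J := idx^~ i)
    (f := fun j w => ez w i + c j *m (Y w i.+1 - Y w i))) => // j.
  apply: (tmeas_fun2 (h := fun z : 'cV[R]_e * 'cV[R]_e => z.1 + z.2)
    (g := fun w => c j *m (Y w i.+1 - Y w i)) (@dense_rat_matrix R _ _) (@dense_rat_matrix R _ _)) => //.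
    exact: add_continuous.
  apply: (tmeas_fun_comp (h := fun y : 'cV[R]_d => c j *m y) (f := fun w => Y w i.+1 - Y w i)).
    apply: (@lipschitz_continuous _ _ _ (d%:R * `|c j|)) => [|y y'].
      by rewrite mulr_ge0.
    by rewrite -mulmxBr mulmx_norm_le.
  apply: (tmeas_fun2 (h := fun z : 'cV[R]_d * 'cV[R]_d => z.1 - z.2)
     (@dense_rat_matrix R _ _) (@dense_rat_matrix R _ _)) => //.
  exact: sub_continuous.
split=> // j.
have mp := (IH (parent i.+1) _).1.
apply: (@tmeas_ext _ _ _ (fun w => select_near F c0 rho c eps (ez w i.+1)
   (c (idx w (parent i.+1))) (B * a ^+ (n - logn 2 i.+1)) = j)).
  by move=> w _; rewrite /idx euler_idxS.
apply: tmeas_least => k; apply: tmeas_and; first exact: (mz _ (@open_almost_in (c k))).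
apply: (tmeas_sel (J := fun w => idx w (parent i.+1))
  (P := fun j' w => `|c k - c j'| < B * a ^+ (n - logn 2 i.+1))).
  by apply: mp; rewrite (leq_trans (parent_lt _)).
by move=> j'; exact: tmeas_cst.
Qed.

End euler_measurability.

(** * Solutions started from a ball *)

Section half_powers.
Context {R : realType}.

Lemma half_powR_lt1 (s : R) : 0 < s -> (2^-1 : R) `^ s < 1.
Proof.
move=> s0; have := @gt0_ltr_powR R s s0 2^-1 1; rewrite powR1; apply; rewrite ?nnegrE ?invr_ge0//.
by rewrite invf_lt1 ?ltr1n.
Qed.

Lemma half_powR_lt (s : R) : 1 < s -> (2^-1 : R) `^ s * 2 < 1.
Proof.
move=> s1; have -> : s = (s - 1) + 1 by rewrite subrK.
rewrite powRD; last by rewrite invr_eq0 pnatr_eq0 implybT.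
rewrite powRr1 ?invr_ge0// divfK ?pnatr_eq0//.
by apply: half_powR_lt1; rewrite subr_gt0.
Qed.

Lemma half_powR_ge (s : R) : 0 <= s -> s <= 1 -> 2^-1 <= (2^-1 : R) `^ s.
Proof.
move=> s0; rewrite le_eqVlt => /predU1P[->|s1]; first by rewrite powRr1 ?invr_ge0.
rewrite [leLHS](_ : _ = (2^-1 : R) `^ s * 2^-1 `^ (1 - s)); last first.
  by rewrite -powRD ?subrKC ?powRr1 ?invr_ge0// invr_eq0 pnatr_eq0 implybT.
rewrite ler_piMr ?powR_ge0// ltW//; apply: half_powR_lt1; by rewrite subr_gt0.
Qed.

End half_powers.

Lemma le_eps_mul {R : realType} (X C K : R) : 0 <= K ->
  (forall eps, 0 < eps -> X <= C + eps * K) -> X <= C.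
Proof.
move=> K0 h; apply/ler_addgt0Pl => eps e0.
have K1 : 0 < K + 1 by rewrite ltr_wpDl.
apply: (le_trans (h (eps / (K + 1)) (divr_gt0 e0 K1))).
rewrite addrC lerD2r -mulrA mulrC -mulrA -[leRHS]mul1r mulrA ler_wpM2r ?(ltW e0)//.
by rewrite ler_pdivrMl// mulr1 lerDl.
Qed.

Lemma norm_perturb {R : realType} {V : normedModType R} (x x' y y' : V) (eps : R) :
  `|x - x'| <= eps -> `|y - y'| <= eps -> `|x - y| <= `|x' - y'| + eps * 2.
Proof.
move=> hx hy; have -> : x - y = (x' - y') + ((x - x') - (y - y')).
  by rewrite opprB addrACA subrKC addKr.
rewrite (le_trans (ler_normD _ _))// lerD2l (le_trans (ler_normB _ _))//.
by rewrite mulr_natr mulr2n lerD.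
Qed.

Section piece.
Context {R : realType} {d e : nat}.
Variables (T q gamma : R) (U : set 'cV[R]_e) (F : 'cV[R]_e -> set 'M[R]_(e, d)).
Hypotheses (T0 : 0 < T) (d1 : (1 <= d)%N) (q1 : 1 <= q).
Hypotheses (qg : q - 1 < gamma) (g1 : gamma <= 1).
Hypothesis Fnc : forall u, U u -> nonempty_compact (F u).
Hypothesis Fh : loc_hoelder_on gamma U F.
Variables (c0 : 'cV[R]_e) (rho : R).
Hypotheses (rho0 : 0 < rho) (ballU : forall z, `|z - c0| <= rho -> U z).

Let q0 : 0 < q. Proof. exact: lt_le_trans q1. Qed.
Let gamma0 : 0 < gamma. Proof. by apply: le_lt_trans qg; rewrite subr_ge0. Qed.
Let a : R := 2^-1 `^ (gamma / q).
Let b : R := 2^-1 `^ q^-1.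
Let half0 : 0 < 2^-1 :> R. Proof. by rewrite invr_gt0. Qed.
Let apos : 0 < a. Proof. exact: powR_gt0. Qed.
Let bpos : 0 < b. Proof. exact: powR_gt0. Qed.
Let gq0 : 0 < gamma / q. Proof. exact: divr_gt0. Qed.
Let gq1 : gamma / q <= 1. Proof. by rewrite ler_pdivrMr// mul1r (le_trans g1). Qed.
Let a1 : a < 1. Proof. exact: half_powR_lt1. Qed.
Let b1 : b < 1. Proof. by apply: half_powR_lt1; rewrite invr_gt0. Qed.
Let ahalf : 2^-1 <= a. Proof. by apply: half_powR_ge => //; exact: ltW. Qed.
Let bq : b `^ q = 2^-1. Proof. by rewrite powR_rootV// ltW. Qed.
Let bg : b `^ gamma = a. Proof. by rewrite /b -powRrM mulrC. Qed.
Let ab1 : 2 * (a * b) < 1.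
Proof.
rewrite mulrC /a /b -powRD; last by rewrite (gt_eqF half0) implybT.
apply: half_powR_lt; rewrite -[X in _ + X]div1r -mulrDl ltr_pdivlMr// mul1r.
by move: qg; lra.
Qed.
Let ab0 : 0 < a * b. Proof. exact: mulr_gt0. Qed.
Let ar r : q / gamma < r -> a `^ r * 2 < 1.
Proof.
move=> qr; rewrite /a -powRrM; apply: half_powR_lt.
by rewrite mulrAC ltr_pdivlMr// mul1r mulrC -ltr_pdivrMr.
Qed.

(* The inverse of p is the mean of gamma / q and of 1 - 1 / q, between which it
   has to lie. *)
Let p : R := 2 * q / (q - 1 + gamma).
Let den0 : 0 < q - 1 + gamma. Proof. by move: q1 gamma0; lra. Qed.
Let qp : q / gamma < p.
Proof.
rewrite /p ltr_pdivrMr// mulrAC ltr_pdivlMr//.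
have : q * (q - 1 + gamma) < q * (2 * gamma) by rewrite ltr_pM2l//; move: qg; lra.
by move=> h; apply: (lt_le_trans h); rewrite mulrA [q * 2]mulrC.
Qed.
Let p1 : 1 <= p.
Proof.
apply: ltW; apply: le_lt_trans qp; rewrite ler_pdivlMr// mul1r; exact: le_trans q1.
Qed.
Let pq : 1 < p^-1 + q^-1.
Proof.
have -> : p^-1 + q^-1 = (q + 1 + gamma) / (2 * q).
  by rewrite /p; field; rewrite !gt_eqF.
by rewrite ltr_pdivlMr ?mulr_gt0// mul1r; move: qg; lra.
Qed.

(** On the inputs that start in a given ball and whose clock at the time Ts is
    below the threshold delta, all the constants are the same, and the
    limit of the Euler schemes is a solution on [0, Ts]. *)
Lemma local_solution : exists2 delta : R, 0 < delta &
  forall (dS : measure_display) (S : measurableType dS) (D : set S)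
    (xi : S -> 'cV[R]_e) (X : S -> R -> 'cV[R]_d) (Ts : R),
  0 < Ts -> Ts < T -> tmeas_fun D xi ->
  (forall t, 0 <= t -> t <= T -> tmeas_fun D (X^~ t)) ->
  (forall w, D w -> [/\ unif_cont_on `[0, T] (X w), finite_pvar q `[0, T] (X w),
     `|xi w - c0| < rho / 2 & clock q T (X w) Ts < delta]) ->
  exists (z : S -> R -> 'cV[R]_e) (v : S -> R -> 'M[R]_(e, d)),
    (forall w, D w -> [/\ solution_with_velocity q U F (xi w) (X w) Ts (z w) (v w),
       cont_finite_pvar q `[0, Ts] (z w) &
       cadlag_finite_pvar_plus (q / gamma) `[0, Ts] (v w)]) /\
    (forall t, 0 <= t -> t <= Ts -> tmeas_fun D (fun w => (z w t, v w t))).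
Proof.
have ballF z : `|z - c0| <= rho -> nonempty_compact (F z) by move=> /ballU/Fnc.
have hF : hoelder_on gamma [set z | `|z - c0| <= rho] F.
  by apply: Fh; [exact: compact_matrix_ball|exact: ballU].
have [K K0 FK0] := hoelder_on_near ballF hF.
have [||M M0 FM] := hoelder_on_bounded (ltW gamma0) ballF hF (c := c0) (r := rho).
- by rewrite /= subrr normr0 ltW.
- by [].
have FK x y pt eta : `|x - c0| <= rho -> `|y - c0| <= rho -> F x pt -> 0 < eta ->
    exists2 p', F y p' & `|pt - p'| < K * `|x - y| `^ gamma + eta by exact: FK0.
have F0 z : `|z - c0| <= rho -> F z !=set0 by move=> /ballF[].
have dpos : 0 < d%:R :> R by rewrite ltr0n.
(* The velocities are bounded by M + 1, and the factor d comes from the norm of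
   a product of matrices; the last 1 is for the defect. *)
pose A : R := d%:R * (M + 1) + 1.
have A0 : 0 < A by rewrite ltr_wpDl// mulr_ge0// addr_ge0.
(* Small enough for the defects to be absorbed in [dyadic_sewing].
   It does not depend on the size of x: the smallness of kappa will do the rest. *)
pose B : R := (1 - 2 * (a * b)) / d%:R.
have B0 : 0 < B by rewrite divr_gt0// subr_gt0.
have hB : (2 + d%:R * B) * (a * b) <= 1.
  rewrite /B mulrC -[d%:R * _]mulrC divfK ?gt_eqF// mulrDr.
  have : (a * b) * (1 - 2 * (a * b)) <= 1 * (1 - 2 * (a * b)).
    rewrite ler_wpM2r// ?subr_ge0 ?(ltW ab1)//.
    by apply: mulr_ile1 => //; exact: ltW.
  by move: (a * b) => r; lra.
have B1 : B <= 1.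
  rewrite ler_pdivrMr// mul1r (@le_trans _ _ 1)// ?ler1n//.
  by rewrite gerBl mulr_ge0// ltW.
have [theta th0 hth] := powR_small K0 gamma0 (divr_gt0 B0 (ltr0n _ 2)).
(* The Hoelder constant allowed for x: the first bound closes the induction on
   velocities, the second one keeps z in the ball. *)
pose kappa := Num.min (theta / A) (rho / 4 / A).
have kappa0 : 0 < kappa by rewrite lt_min !divr_gt0.
have Akappa0 : 0 <= A * kappa by rewrite mulr_ge0// ltW.
have hK : K * (A * kappa) `^ gamma <= B / 2.
  by apply: hth => //; rewrite mulrC -ler_pdivlMr// ge_min lexx.
have Akr : A * kappa <= rho / 4 by rewrite mulrC -ler_pdivlMr// ge_min lexx orbT.
exists (kappa `^ q); first exact: powR_gt0.
set delta := kappa `^ q.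
have delta0 : 0 < delta by exact: powR_gt0.
move=> dS S D xi X Ts Ts0 TsT mxi mX hD.
have uX w : D w -> unif_cont_on `[0, T] (X w) by move=> /hD[].
have vX w : D w -> finite_pvar q `[0, T] (X w) by move=> /hD[].
pose clk w := clock q T (X w).
pose y w u := X w (hit Ts (clk w) u).
pose Y w n i := y w (delta * i%:R / 2 ^+ n).
(* The tolerance of the selections at level n: since a >= 1 / 2, three such errors
   amount to at most half of the bound B * a ^+ l, for all l <= n. *)
pose eps n : R := B / 6 * 2^-1 ^+ n.
have eps0 n : 0 < eps n by rewrite mulr_gt0 ?exprn_gt0// divr_gt0.
have epsle n : 2^-1 ^+ n <= 1 :> R by rewrite exprn_ile1// ?invr_ge0// invf_le1 ?ler1n.
have eps1 n : eps n <= 1.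
  rewrite /eps mulr_ile1 ?exprn_ge0 ?invr_ge0//; first by rewrite divr_ge0// ltW.
  by rewrite ler_pdivrMr// mul1r (le_trans B1)// ler1n.
have epsl n l : (l <= n)%N -> 3 * eps n <= B / 2 * a ^+ l.
  move=> ln; rewrite (_ : 3 * eps n = B / 2 * 2^-1 ^+ n); last by rewrite /eps; field.
  rewrite ler_wpM2l//; first by rewrite divr_ge0// ltW.
  apply: (@le_trans _ _ (2^-1 ^+ l)).
    by rewrite ler_wiXn2l// ?invr_ge0// invf_le1 ?ler1n.
  by rewrite lerXn2r// nnegrE ltW.
have root_scale (N Z : R) m : 0 <= N -> N `^ q <= Z -> Z <= delta * 2^-1 ^+ m ->
    N <= kappa * b ^+ m.
  move=> N0 NZ Zd; rewrite -[leRHS](powR_root q0); last first.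
    by rewrite mulr_ge0 ?exprn_ge0 ?ltW.
  apply: powR_le_root => //; apply: (le_trans NZ); apply: (le_trans Zd).
  rewrite powRM ?exprn_ge0 ?(ltW kappa0) ?(ltW bpos)//.
  by rewrite -powR_mulrn ?(ltW bpos)// powRAC bq powR_mulrn ?(ltW half0).
have half_pow (m : nat) : 2^-1 ^+ m = (2 ^+ m)^-1 :> R by rewrite exprVn.
have p2 m : 0 < 2 ^+ m :> R by rewrite exprn_gt0.
have facts w : D w -> _ := fun Dw => clock_path_facts q0 uX vX TsT Dw.
have yctl w u u' : D w -> u <= u' -> `|y w u' - y w u| `^ q <= u' - u.
  move=> Dw uu; have [h1 h2 h3 h4] := facts w Dw.
  exact: hit_path_control.
have hY w n s i j : D w -> (s <= n)%N -> (i <= j <= i + 2 ^ s)%N -> (j <= 2 ^ n)%N ->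
    `|Y w n j - Y w n i| <= kappa * b ^+ (n - s).
  move=> Dw sn /andP[ij js] _.
  have dd : delta * i%:R / 2 ^+ n <= delta * j%:R / 2 ^+ n.
    by rewrite ler_wpM2r ?invr_ge0 ?(ltW (p2 n))// ler_wpM2l ?ler_nat ?(ltW delta0).
  apply: (root_scale _ _ _ (normr_ge0 _) (yctl w _ _ Dw dd)).
  rewrite -mulrBl -mulrBr -mulrA ler_wpM2l ?(ltW delta0)// ler_pdivrMr//.
  rewrite half_pow [2 ^+ n](_ : _ = 2 ^+ (n - s) * 2 ^+ s); last by rewrite -exprD subnK.
  rewrite mulKf ?gt_eqF//.
  by rewrite lerBlDl -natrX -natrD ler_nat.
pose ez n w := euler_z F c0 rho (rat_matrix e d) B a n (eps n) (xi w) (Y w n).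
pose ev n w := euler_v F c0 rho (rat_matrix e d) B a n (eps n) (xi w) (Y w n).
have hxi w : D w -> `|xi w - c0| + A * kappa < rho.
  by move=> /hD[_ _ h _]; move: h Akr rho0; lra.
have EB n w : D w -> _ := fun Dw => euler_bounds (@dense_rat_matrix R e d) F0 FK FM
   (ltW apos) (ltW bpos) (ltW B0) (ltW kappa0) K0 M0 (ltW a1) (ltW gamma0) bg
   (lexx A) hB hK (eps0 n) (eps1 n) (epsl n) (hxi w Dw) (fun s i j => hY w n s i j Dw).
(* Position and velocity of the scheme of level n at the dyadic time k / 2 ^ l;
   the value (c0, 0) stands for the times that this scheme does not see. *)
pose f n (lk : nat * nat) w : 'cV[R]_e * 'M[R]_(e, d) :=
  if (lk.1 <= n)%N && (lk.2 <= 2 ^ lk.1)%N then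
    (ez n w (lk.2 * 2 ^ (n - lk.1))%N, ev n w (lk.2 * 2 ^ (n - lk.1))%N) else (c0, 0).
have mY n i : tmeas_fun D (fun w => Y w n i).
  exact: (tmeas_hit q0 T0 mX uX vX Ts0 TsT).
have mf n lk : tmeas_fun D (f n lk).
  rewrite /f; case: ((lk.1 <= n)%N && (lk.2 <= 2 ^ lk.1)%N); last exact: tmeas_fun_cst.
  have mE := tmeas_euler (rat_matrix e d) B a K0 gamma0 FK n (eps n) mxi (mY n) (lk.2 * 2 ^ (n - lk.1)).
  apply: (tmeas_fun_pair (@dense_rat_matrix R _ _) (@dense_rat_matrix R _ _)); first exact: mE.2.
  apply: (tmeas_fun_sel (J := fun w => euler_idx F c0 rho (rat_matrix e d) B a n (eps n) (xi w) (Y w n)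
     (lk.2 * 2 ^ (n - lk.1))) (f := fun j _ => rat_matrix e d j)); first exact: mE.1.
  by move=> j; exact: tmeas_fun_cst.
have kle l n k : (l <= n)%N -> (k <= 2 ^ l)%N -> (k * 2 ^ (n - l) <= 2 ^ n)%N.
  by move=> ln kl; rewrite -[in X in (_ <= X)%N](subnKC ln) expnD leq_mul2r kl orbT.
pose C := [set z : 'cV[R]_e | `|z - c0| <= rho] `*` [set A : 'M[R]_(e, d) | `|A - 0| <= M + 1].
have cC : compact C by apply: compact_setX; exact: compact_matrix_ball.
have fC n lk w : D w -> C (f n lk w).
  move=> Dw; rewrite /f; case: ifP => [/andP[ln kl]|_]; last first.
    by split; rewrite /= ?subrr ?subr0 ?normr0 ?(ltW rho0)// addr_ge0.
  have [G _ _ _] := EB n w Dw; have [[zr _] vM] := G _ (kle _ _ _ ln kl).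
  by split; rewrite /= ?subr0//; exact: ltW.
have [L [mL hL]] := measurable_subsequence_limit (0%N, 0%N)
  (dense_pair_seq (@dense_rat_matrix R e 1) (@dense_rat_matrix R e d)) cC mf fC.
(* The bounds for the limit follow from those for some scheme that is close to it
   at the two dyadic times involved. *)
have approx w i1 i2 (ep : R) N : D w -> 0 < ep -> exists2 n, (N <= n)%N &
    [/\ `|(L i1 w).1 - (f n i1 w).1| <= ep, `|(L i1 w).2 - (f n i1 w).2| <= ep,
        `|(L i2 w).1 - (f n i2 w).1| <= ep & `|(L i2 w).2 - (f n i2 w).2| <= ep].
  move=> Dw ep0; have [phi [phile hphi]] := hL w Dw.
  have /cvgrPdist_le/(_ _ ep0)[N1 _ h1] := hphi i1.
  have /cvgrPdist_le/(_ _ ep0)[N2 _ h2] := hphi i2.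
  pose k := maxn N (maxn N1 N2).
  exists (phi k); first by rewrite (leq_trans _ (phile k))// leq_maxl.
  have /= := h1 k (leq_trans (leq_maxl _ _) (leq_maxr _ _)).
  have /= := h2 k (leq_trans (leq_maxr _ _) (leq_maxr _ _)).
  by rewrite !prod_normE !ge_max => /andP[? ?] /andP[? ?].
pose Zl w l k := (L (l, k) w).1; pose Vl w l k := (L (l, k) w).2.
pose u w t := clk w t / delta.
have spec w : D w -> [/\ solution_with_velocity q U F (xi w) (X w) Ts
       (limit_z (u w) (Zl w)) (limit_v (u w) (Vl w)),
     cont_finite_pvar q `[0, Ts] (limit_z (u w) (Zl w)) &
     cadlag_finite_pvar_plus (q / gamma) `[0, Ts] (limit_v (u w) (Vl w))] /\
     forall t, 0 <= t -> t <= Ts ->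
       (fun l => L (l, cell (u w) l t) w) @ \oo -->
       (limit_z (u w) (Zl w) t, limit_v (u w) (Vl w) t).
  move=> Dw; have [h1 h2 h3 h4] := facts w Dw.
  have clk0 : clk w 0 = 0 by exact: clock0.
  have fE n l k : (l <= n)%N -> (k <= 2 ^ l)%N ->
      f n (l, k) w = (ez n w (k * 2 ^ (n - l))%N, ev n w (k * 2 ^ (n - l))%N).
    by move=> ln kl; rewrite /f ln kl.
  have Ycoarse n l j : (l <= n)%N -> Y w n (j * 2 ^ (n - l))%N = Y w l j.
    move=> ln; rewrite /Y; congr y.
    rewrite [2 ^+ n](_ : _ = 2 ^+ (n - l) * 2 ^+ l); last by rewrite -exprD subnK.
    by rewrite natrM natrX mulrA invfM mulrA mulfK ?gt_eqF.
  have u_nd s t : 0 <= s -> s <= t -> t <= Ts -> u w s <= u w t.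
    by move=> s0 st tT; rewrite /u ler_wpM2r ?invr_ge0 ?(ltW delta0)// h2.
  have u01 t : 0 <= t -> t <= Ts -> 0 <= u w t < 1.
    move=> t0 tT; apply/andP; split.
      by rewrite divr_ge0 ?(ltW delta0)// -clk0 h2.
    rewrite ltr_pdivrMr// mul1r; have [_ _ _] := hD w Dw; apply: le_lt_trans.
    by rewrite h2// ltW.
  have u00 : u w 0 = 0 by rewrite /u clk0 mul0r.
  have u_rc t eta : 0 <= t -> t < Ts -> 0 < eta ->
      exists2 w0, t < w0 & forall s, t <= s < w0 -> u w s < u w t + eta.
    move=> t0 tT eta0; have [w0 tw hw] := h3 t (eta * delta) t0 tT (mulr_gt0 eta0 delta0).
    by exists w0 => // s /hw; rewrite /u ltr_pdivrMr// mulrDl divfK// gt_eqF.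
  have cellE l t : 0 <= t -> t <= Ts -> delta * (cell (u w) l t)%:R / 2 ^+ l <= clk w t /\
      clk w t < delta * (cell (u w) l t).+1%:R / 2 ^+ l.
    move=> t0 tT; have /andP[g1' g2'] := cell_itv u01 l t0 tT.
    rewrite ler_pdivrMr// ltr_pdivlMr//; split.
      rewrite (_ : clk w t * _ = delta * (2 ^+ l * u w t)); first by rewrite ler_pM2l.
      by rewrite /u mulrC [RHS]mulrCA -[in LHS](divfK (lt0r_neq0 delta0) (clk w t)) [delta * _]mulrC.
    rewrite (_ : clk w t * _ = delta * (2 ^+ l * u w t)); first by rewrite ltr_pM2l.
    by rewrite /u mulrC [RHS]mulrCA -[in LHS](divfK (lt0r_neq0 delta0) (clk w t)) [delta * _]mulrC.
  have Ynear l t : 0 <= t -> t <= Ts -> `|X w t - Y w l (cell (u w) l t)| <= kappa * b ^+ l.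
    move=> t0 tT; have [c1 c2] := cellE l t t0 tT.
    have -> : X w t = y w (clk w t) by rewrite /y (hit_clock (q := q))// t0.
    apply: (root_scale _ _ _ (normr_ge0 _) (yctl w _ _ Dw c1)).
    rewrite half_pow lerBlDl; apply: (le_trans (ltW c2)).
    by rewrite -natr1 mulrDr mulrDl mulr1.
  have Ybetween l s t i : 0 <= s -> s <= t -> t <= Ts ->
      (cell (u w) l s < i <= cell (u w) l t)%N -> exists2 r, s <= r <= t & Y w l i = X w r.
    move=> s0 st tT /andP[si it]; exists (hit Ts (clk w) (delta * i%:R / 2 ^+ l)) => //.
    have [_ c1] := cellE l s s0 (le_trans st tT).
    have [c2 _] := cellE l t (le_trans s0 st) tT.
    apply: hit_between => //.
      apply: (lt_le_trans c1); rewrite ler_wpM2r ?invr_ge0 ?(ltW (p2 l))//.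
      by rewrite ler_wpM2l ?(ltW delta0)// ler_nat.
    apply: le_trans c2; rewrite ler_wpM2r ?invr_ge0 ?(ltW (p2 l))//.
    by rewrite ler_wpM2l ?(ltW delta0)// ler_nat.
  have L_even l k : L (l.+1, (2 * k)%N) w = L (l, k) w.
    apply/eqP; rewrite -subr_eq0 -normr_le0; apply: (@le_eps_mul _ _ 0 2) => // ep ep0.
    have [n ln [g1' g2' g3' g4']] := approx w (l.+1, (2 * k)%N) (l, k) ep l.+1 Dw ep0.
    have fe : f n (l.+1, (2 * k)%N) w = f n (l, k) w.
      rewrite /f /= ln (ltnW ln) expnS leq_pmul2l//=; case: ifP => // _.
      suff -> : (2 * k * 2 ^ (n - l.+1) = k * 2 ^ (n - l))%N by [].
      by rewrite -(subnSK ln) expnS mulnCA mulnA.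
    rewrite -[X in _ <= X + _](normr0 ('cV[R]_e * 'M[R]_(e, d))%type).
    rewrite -(subrr (f n (l, k) w)); apply: norm_perturb.
      by rewrite -fe prod_normE ge_max g1' g2'.
    by rewrite prod_normE ge_max g3' g4'.
  have V_even l k : Vl w l.+1 (2 * k)%N = Vl w l k by rewrite /Vl L_even.
  have V_odd l k : ((2 * k).+1 <= 2 ^ l.+1)%N ->
      `|Vl w l.+1 (2 * k).+1 - Vl w l k| <= B * a ^+ l.+1.
    move=> kl; apply: (@le_eps_mul _ _ _ 2) => // ep ep0.
    have [n ln [_ g2' _ g4']] := approx w (l.+1, (2 * k).+1) (l, k) ep l.+1 Dw ep0.
    apply: (le_trans (norm_perturb g2' g4')); rewrite lerD2r.
    have kl' : (k <= 2 ^ l)%N by rewrite -(leq_pmul2l (isT : (0 < 2)%N)) -expnS ltnW.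
    rewrite !fE ?(ltnW ln)//=.
    have [_ G _ _] := EB n w Dw; have := G (n - l.+1)%N k.
    have -> : (n - (n - l.+1))%N = l.+1 by rewrite subKn.
    have -> : (2 * k * 2 ^ (n - l.+1) = k * 2 ^ (n - l))%N.
      by rewrite -(subnSK ln) expnS mulnCA mulnA.
    by apply; [rewrite ltn_subrL (leq_trans _ ln)|exact: kle].
  have V_bd l k : (k <= 2 ^ l)%N -> `|Vl w l k| <= M + 1.
    move=> kl; apply: (@le_eps_mul _ _ _ 1) => // ep ep0.
    have [n ln [_ g2' _ _]] := approx w (l, k) (l, k) ep l Dw ep0.
    rewrite mulr1 -(subrK (f n (l, k) w).2 (Vl w l k)) (le_trans (ler_normD _ _))//.
    rewrite addrC lerD// fE//=.
    by have [G _ _ _] := EB n w Dw; have [] := G _ (kle _ _ _ ln kl).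
  have grid l m k j n : (l + m <= n)%N -> (k * 2 ^ m <= j <= k.+1 * 2 ^ m)%N ->
      (k * 2 ^ (n - l) <= j * 2 ^ (n - (l + m)) <= k.+1 * 2 ^ (n - l))%N.
    move=> ln kj; have -> : (2 ^ (n - l) = 2 ^ m * 2 ^ (n - (l + m)))%N.
      by rewrite -expnD subnDA subnKC// leq_subRL// (leq_trans (leq_addr m l)).
    by rewrite !mulnA !leq_mul2r; case/andP: kj => -> ->; rewrite !orbT.
  have kjl l m k j : (k * 2 ^ m <= j <= k.+1 * 2 ^ m)%N -> (j <= 2 ^ (l + m))%N ->
      (k <= 2 ^ l)%N.
    move=> /andP[kj _] jl; rewrite -(leq_pmul2r (m := 2 ^ m)) ?expn_gt0//.
    by rewrite -expnD (leq_trans kj).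
  have Z_sew l m k j : (k * 2 ^ m <= j <= k.+1 * 2 ^ m)%N -> (j <= 2 ^ (l + m))%N ->
      `|Zl w (l + m) j - Zl w l k - Vl w l k *m (Y w (l + m) j - Y w l k)|
        <= kappa * (a * b) ^+ l.
    move=> kj jl; have kl := kjl _ _ _ _ kj jl.
    set dY := Y w (l + m) j - Y w l k.
    apply: (@le_eps_mul _ _ _ (2 + d%:R * `|dY|)) => [|ep ep0].
      by rewrite addr_ge0// mulr_ge0.
    have [n ln [g1' _ g3' g4']] := approx w ((l + m)%N, j) (l, k) ep (l + m)%N Dw ep0.
    have ln' : (l <= n)%N by apply: leq_trans ln; exact: leq_addr.
    have [_ _ G _] := EB n w Dw.
    have : `|ez n w (j * 2 ^ (n - (l + m)))%N - ez n w (k * 2 ^ (n - l))%N -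
        ev n w (k * 2 ^ (n - l))%N *m dY| <= kappa * (a * b) ^+ l.
      have := G (n - l)%N k _ (leq_subr _ _) (grid _ _ _ _ _ ln kj) (kle _ _ _ ln jl).
      by rewrite !Ycoarse// subKn.
    move: g1' g3' g4'.
    rewrite !fE//= -/(Zl w (l + m) j) -/(Zl w l k) -/(Vl w l k).
    move: (Zl w (l + m) j) (Zl w l k) (Vl w l k) (ez n w (j * _)%N) (ez n w (k * _)%N)
      (ev n w _).
    move=> z1 z2 v1 z1' z2' v1' g1' g3' g4' G'.
    have -> : z1 - z2 - v1 *m dY = (z1' - z2' - v1' *m dY) + ((z1 - z1') - (z2 - z2') -
        (v1 - v1') *m dY).
      rewrite mulmxBl; move: (v1 *m dY) (v1' *m dY) => ? ?.
      by apply/matrixP => i0 j0; rewrite !mxE; ring.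
    apply: (le_trans (ler_normD _ _)); apply: (lerD G').
    apply: (le_trans (ler_normB _ _)); rewrite mulrDr; apply: lerD.
      rewrite mulr_natr mulr2n; apply: (le_trans (ler_normB _ _)); exact: lerD.
    apply: (le_trans (mulmx_norm_le _ _)).
    by rewrite [leRHS]mulrCA mulrA ler_wpM2r// ler_wpM2l.
  have Z_incr l m k j : (k * 2 ^ m <= j <= k.+1 * 2 ^ m)%N -> (j <= 2 ^ (l + m))%N ->
      `|Zl w (l + m) j - Zl w l k| <= A * kappa * b ^+ l.
    move=> kj jl; have kl := kjl _ _ _ _ kj jl.
    apply: (@le_eps_mul _ _ _ 2) => // ep ep0.
    have [n ln [g1' _ g3' _]] := approx w ((l + m)%N, j) (l, k) ep (l + m)%N Dw ep0.
    have ln' : (l <= n)%N by apply: leq_trans ln; exact: leq_addr.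
    apply: (le_trans (norm_perturb g1' g3')); rewrite lerD2r !fE//=.
    have [_ _ _ G] := EB n w Dw.
    have := G (n - l)%N k _ (leq_subr _ _) (grid _ _ _ _ _ ln kj) (kle _ _ _ ln jl).
    by rewrite subKn.
  have Z_0 l : Zl w l 0 = xi w.
    apply/eqP; rewrite -subr_eq0 -normr_le0; apply: (@le_eps_mul _ _ 0 1) => // ep ep0.
    have [n ln [g1' _ _ _]] := approx w (l, 0%N) (l, 0%N) ep l Dw ep0.
    by rewrite add0r mulr1; move: g1'; rewrite fE// mul0n.
  have Z_ball l k : (k <= 2 ^ l)%N -> `|Zl w l k - c0| <= rho.
    move=> kl; apply: (@le_eps_mul _ _ _ 1) => // ep ep0.
    have [n ln [g1' _ _ _]] := approx w (l, k) (l, k) ep l Dw ep0.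
    rewrite mulr1 -(subrKA (f n (l, k) w).1 (Zl w l k)) (le_trans (ler_normD _ _))//.
    rewrite addrC lerD// fE//=.
    by have [G _ _ _] := EB n w Dw; have [[/ltW]] := G _ (kle _ _ _ ln kl).
  have Z_F l k : (k <= 2 ^ l)%N -> F (Zl w l k) (Vl w l k).
    move=> kl; apply: (compact_adherent (ballF _ (Z_ball l k kl)).2) => ep ep0.
    have e40 : 0 < ep / 4 by rewrite divr_gt0.
    have [th1 th10 hth1] := powR_small K0 gamma0 e40.
    have half1 : 0 <= (2^-1 : R) < 1 by rewrite invr_ge0 ler0n invf_lt1 ?ltr1n.
    have [N hN] := geometric_lt (B / 6) half1 e40.
    have m0 : 0 < Num.min th1 (ep / 8) by rewrite lt_min th10 divr_gt0.
    have [n ln [g1' g2' _ _]] := approx w (l, k) (l, k) _ (maxn N l) Dw m0.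
    move: g1' g2'; rewrite !le_min => /andP[g1' _] /andP[_ g2'].
    have nl : (l <= n)%N := leq_trans (leq_maxr _ _) ln.
    move: g1' g2'; rewrite fE//= => g1' g2'.
    have [G _ _ _] := EB n w Dw; have [[zr [p' Fp' vp']] _] := G _ (kle _ _ _ nl kl).
    have [p'' Fp'' pp''] := FK _ _ _ _ (ltW zr) (Z_ball l k kl) Fp' e40.
    exists p'' => //.
    have en : eps n < ep / 4.
      apply: le_lt_trans hN; rewrite /eps; apply: ler_wpM2l.
        by apply: divr_ge0 => //; exact: ltW.
      by rewrite ler_wiXn2l ?invr_ge0 ?invf_le1 ?ler1n// (leq_trans (leq_maxl _ _) ln).
    have := hth1 _ (normr_ge0 _) g1'; rewrite distrC => hz.
    rewrite -(subrKA (ev n w (k * 2 ^ (n - l))%N)) (le_lt_trans (ler_normD _ _))//.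
    apply: (le_lt_trans (lerD (lexx _) _)).
      by rewrite -(subrKA p'); exact: ler_normD.
    move: vp' pp'' en hz g2' ep0.
    by move: (K * _) => Kz; rewrite -/(ez n w) -/(ev n w); move=> *; lra.
  have ab01 : 0 <= a < 1 /\ 0 <= b < 1 by rewrite a1 b1 !ltW.
  have [a01 b01] := ab01.
  split.
    have M10 : 0 <= M + 1 by rewrite addr_ge0.
    have Fc z : `|z - c0| <= rho -> compact (F z) by move=> /ballF[].
    exact: (limit_solution_spec Ts0 u_nd u01 u00 u_rc h1 Ynear Ybetween V_even V_odd
      V_bd Z_sew Z_incr Z_0 a01 b01 ab1 (ltW kappa0) (ltW B0) (ltW kappa0) Akappa0 M10
      ballU Fc FK Z_ball Z_F K0 gamma0 q0 apos bq bg p1 pq (ar qp) ar).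
  move=> t t0 tT.
  have hz := limit_z_cvg u01 Z_incr b01 t0 tT.
  have hv := limit_v_cvg u01 V_even V_odd a01 (ltW B0) t0 tT.
  rewrite (_ : (fun l => L (l, cell (u w) l t) w) =
      (fun l => (Zl w l (cell (u w) l t), Vl w l (cell (u w) l t)))).
    exact: cvg_pair hz hv.
  by apply/funext => l; rewrite /Zl /Vl; case: (L _ _).
exists (fun w => limit_z (u w) (Zl w)), (fun w => limit_v (u w) (Vl w)).
split=> [w Dw|t t0 tT]; first exact: (spec w Dw).1.
apply: (tmeas_fun_lim (f := fun l w => L (l, cell (u w) l t) w)) => [l|w Dw].
  apply: (tmeas_fun_sel (J := fun w => cell (u w) l t) (f := fun k w => L (l, k) w)) => //.
  exact: (tmeas_cell q0 T0 mX uX vX TsT l delta0 t0 tT).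
exact: (spec w Dw).2.
Qed.

End piece.

(** * Gluing the pieces *)

Lemma tmeas_sigma_algebra d (S : measurableType d) (D : set S) (T : Type) (g : S -> T) :
  sigma_algebra setT [set Y : set T | tmeas D (fun w => Y (g w))].
Proof.
split=> /=.
- exact: (tmeas_cst D False).
- move=> A mA; apply: tmeas_ext (tmeas_not mA) => w _.
  by split=> [nA|[]].
- move=> A mA; apply: tmeas_ext (tmeas_ex mA) => w _.
  by split=> [[i Ai]|[i _ Ai]]; exists i.
Qed.

Lemma tmeas_borel d (S : measurableType d) (D : set S) (T : ptopologicalType) (g : S -> T) :
  tmeas_fun D g -> forall Y : set (borel T), measurable Y -> tmeas D (fun w => Y (g w)).
Proof.
move=> mg; apply: smallest_sub; first exact: tmeas_sigma_algebra.
by move=> O oO; exact: mg.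
Qed.

(** Generators suffice: evaluations for the path space, open sets for
    the Borel sets. *)
Lemma tmeas_path_space {R : realType} d (S : measurableType d) (D : set S) (E : set R)
    (T : ptopologicalType) (g : S -> R -> T) :
  (forall t, E t -> tmeas_fun D (g^~ t)) ->
  trace_measurable D (g : S -> path_space E T).
Proof.
move=> mg; apply: smallest_sub; first exact: tmeas_sigma_algebra.
move=> A [t Et [B mB <-]].
by apply: tmeas_ext (tmeas_borel (mg t Et) mB) => w _; split=> [|[]].
Qed.

Theorem theoremI1p4 (R : realType) (T : R) (d e : nat) (q gamma : R)
    (U : set 'cV[R]_e) (F : 'cV[R]_e -> set 'M[R]_(e, d)) :
  0 < T -> (1 <= d)%N -> (1 <= e)%N ->
  1 <= q -> q < 2 -> q - 1 < gamma -> gamma <= 1 ->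
  open U ->
  (forall u, U u -> nonempty_compact (F u)) ->
  loc_hoelder_on gamma U F ->
  exists (Ts : input_space R d e T -> borel R)
         (z : input_space R d e T -> R -> 'cV[R]_e)
         (v : input_space R d e T -> R -> 'M[R]_(e, d)),
    [/\ forall w, Omega d q T U w ->
          [/\ 0 < Ts w <= T,
              solution_with_velocity q U F w.1 w.2 (Ts w) (z w) (v w),
              cont_finite_pvar q `[0, Ts w] (z w) &
              cadlag_finite_pvar_plus (q / gamma) `[0, Ts w] (v w)],
        trace_measurable (Omega d q T U) Ts &
        trace_measurable (Omega d q T U)
          (fun w => cut_path (Ts w) (z w) (v w)
             : path_space `[0, T] ('cV[R]_e * 'M[R]_(e, d))%type)].
Proof.
move=> T0 d1 _ q1 _ qg g1 oU Fnc Fh.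
have q0 : 0 < q by apply: lt_le_trans q1.
pose S := (borel 'cV[R]_e * path_space `[0, T] 'cV[R]_d)%type.
pose D : set S := Omega d q T U.
pose xi (w : S) : 'cV[R]_e := w.1.
pose X (w : S) : R -> 'cV[R]_d := w.2.
have mxi : tmeas_fun D xi.
  move=> O oO; exists (fst @^-1` O) => //.
  rewrite -[X in measurable X]setTI; apply: measurable_fst => //.
  exact: sub_sigma_algebra.
have mX t : 0 <= t -> t <= T -> tmeas_fun D (X^~ t).
  move=> t0 tT O oO; exists (snd @^-1` [set x : path_space `[0, T] 'cV[R]_d | O (x t)]) => //.
  rewrite -[X in measurable X]setTI; apply: measurable_snd => //.
  apply: sub_sigma_algebra; exists t; first by rewrite /= in_itv/= t0.
  exists O; last by rewrite setTI.
  exact: sub_sigma_algebra.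
have uX w : D w -> unif_cont_on `[0, T] (X w).
  by move=> [_ [cx _] _]; exact: continuous_unif_cont_on.
have vX w : D w -> finite_pvar q `[0, T] (X w) by move=> [_ [_ vx] _].
pose center j : 'cV[R]_e := rat_matrix e 1 j.
pose radius m : R := m.+1%:R^-1.
have rad0 m : 0 < radius m by rewrite invr_gt0.
pose good jm := forall z, `|z - center jm.1| <= radius jm.2 -> U z.
have /choice[delta hdelta] : forall jm : nat * nat, exists delta : R, 0 < delta /\
    (good jm -> forall (D' : set S) (Ts : R), 0 < Ts -> Ts < T -> D' `<=` D ->
     (forall w, D' w -> `|xi w - center jm.1| < radius jm.2 / 2 /\
        clock q T (X w) Ts < delta) ->
     exists zv : (S -> R -> 'cV[R]_e) * (S -> R -> 'M[R]_(e, d)),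
      (forall w, D' w -> [/\ solution_with_velocity q U F (xi w) (X w) Ts (zv.1 w) (zv.2 w),
         cont_finite_pvar q `[0, Ts] (zv.1 w) &
         cadlag_finite_pvar_plus (q / gamma) `[0, Ts] (zv.2 w)]) /\
      (forall t, 0 <= t -> t <= Ts -> tmeas_fun D' (fun w => (zv.1 w t, zv.2 w t)))).
  move=> jm; have [gjm|ngood] := pselect (good jm); last by exists 1.
  have [delta d0 hd] := local_solution T0 d1 q1 qg g1 Fnc Fh (rad0 jm.2) gjm.
  exists delta; split=> // _ D' Ts Ts0 TsT DD hD'.
  have [z [v [h1 h2]]] := hd _ S D' xi X Ts Ts0 TsT
    (fun O oO => tmeas_sub DD (mxi O oO)) (fun t t0 tT O oO => tmeas_sub DD (mX t t0 tT O oO))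
    (fun w Dw => And4 (uX w (DD w Dw)) (vX w (DD w Dw)) (hD' w Dw).1 (hD' w Dw).2).
  by exists (z, v).
(* Horizons smaller than T leave room for the right limits in the clock. *)
pose horizon k : R := T * 2^-1 ^+ k.+1.
have hor0 k : 0 < horizon k by rewrite mulr_gt0// exprn_gt0// invr_gt0.
have horT k : horizon k < T.
  rewrite gtr_pMr// exprn_ilt1 ?invr_ge0//; last by rewrite invf_lt1 ?ltr1n.
(* A code ((j, m), k) fits an input if the starting point lies in the ball of
   index (j, m) and the clock at the k-th horizon is below the threshold of
   this ball. *)
pose fits w jmk := good jmk.1 /\ (`|xi w - center jmk.1.1| < radius jmk.1.2 / 2 /\
  clock q T (X w) (horizon jmk.2) < delta jmk.1).
pose P w n := if unpickle n is Some jmk then fits w (jmk : nat * nat * nat) else False.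
pose J w := least (P w).
have mJ n : tmeas D (fun w => J w = n).
  apply: tmeas_least => j; rewrite /P; case: unpickle => [jmk|]; last exact: tmeas_cst.
  apply: tmeas_and; first exact: tmeas_cst.
  apply: tmeas_and; last first.
    by apply: tmeas_lt; apply: tmeas_clock => //; exact: ltW.
  apply: (mxi [set z | `|z - center jmk.1.1| < radius jmk.1.2 / 2]).
  apply/open_normP => y /= hy; exists (radius jmk.1.2 / 2 - `|y - center jmk.1.1|).
    by rewrite subr_gt0.
  move=> z yz; rewrite -(subrKA y) (le_lt_trans (ler_normD _ _))//.
  by rewrite [`|z - y|]distrC -ltrBrDr.
have JP w : D w -> P w (J w).
  move=> Dw; suff /leastP[] : exists n, P w n by [].
  have [Uxi _ _] := Dw.
  have /open_normP/(_ _ Uxi)[r r0 hr] := oU.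
  have [m hm] := harmonic_lt (divr_gt0 r0 (ltr0n _ 2)).
  have [j hj] := @dense_rat_matrix R e 1 (xi w) _ (divr_gt0 (rad0 m) (ltr0n _ 2)).
  have [C xC] := (finite_pvarP _ _ q0).1 (vX w Dw).
  have d0 := (hdelta (j, m)).1.
  have [u u0 hu] := clock_right_cont xC T0 d0.
  have half01 : 0 <= (2^-1 : R) < 1 by rewrite invr_ge0 ler0n invf_lt1 ?ltr1n.
  have [k hk] := geometric_lt T half01 u0.
  exists (pickle ((j, m), k)); rewrite /P pickleK; split; last split.
  - move=> z /= zj; apply: hr; rewrite -(subrKA (center j)) (le_lt_trans (ler_normD _ _))//.
    move: hj zj hm; rewrite [`|center j - z|]distrC /center /xi /radius.
    by move: (_^-1) => rm; lra.
  - exact: hj.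
  have := hu (horizon k); rewrite clock0 add0r; apply; rewrite (ltW (hor0 k))/=.
  apply: le_lt_trans hk; rewrite ler_wpM2l ?(ltW T0)// exprS ler_piMl ?exprn_ge0 ?invr_ge0//.
  by have /andP[_ /ltW] := half01.
have /choice[sol hsol] : forall n, exists s : R * ((S -> R -> 'cV[R]_e) * (S -> R -> 'M[R]_(e, d))),
    [/\ 0 < s.1 <= T,
     forall w, D w -> J w = n ->
       [/\ solution_with_velocity q U F (xi w) (X w) s.1 (s.2.1 w) (s.2.2 w),
         cont_finite_pvar q `[0, s.1] (s.2.1 w) &
         cadlag_finite_pvar_plus (q / gamma) `[0, s.1] (s.2.2 w)] &
     forall t, 0 <= t -> t <= s.1 ->
       tmeas_fun (D `&` [set w | J w = n]) (fun w => (s.2.1 w t, s.2.2 w t))].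
  move=> n; have [[jmk [en gjm]]|none] :=
    pselect (exists jmk : nat * nat * nat, unpickle n = Some jmk /\ good jmk.1).
    have DP w : (D `&` [set w | J w = n]) w -> fits w jmk.
      by move=> [Dw Jw]; have := JP w Dw; rewrite Jw /P en.
    have [zv [h1 h2]] := (hdelta jmk.1).2 gjm (D `&` [set w | J w = n]) (horizon jmk.2)
      (hor0 _) (horT _) (@subIsetl _ _ _) (fun w Dw => (DP w Dw).2).
    exists (horizon jmk.2, zv); split=> //=; first by rewrite hor0 ltW.
    by move=> w Dw Jw; exact: h1.
  have empty w : D w -> J w = n -> False.
    move=> Dw Jw; apply: none; have := JP w Dw; rewrite Jw /P.
    by case: (unpickle n) => // jmk [gjm _]; exists jmk.
  exists (T, (fun _ _ => 0, fun _ _ => 0)); split=> /=.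
  - by rewrite T0 lexx.
  - by move=> w Dw /(empty w Dw).
  - by move=> t _ _; exact: tmeas_fun_cst.
pose Ts w := (sol (J w)).1.
exists Ts, (fun w => (sol (J w)).2.1 w), (fun w => (sol (J w)).2.2 w); split.
- move=> w Dw; have [h1 h2 _] := hsol (J w); split=> //; by have [] := h2 w Dw erefl.
- move=> Y _; exact: (tmeas_sel (J := J) (P := fun n _ => Y (sol n).1)) mJ (fun n => tmeas_cst _ _).
apply: tmeas_path_space => t; rewrite /= in_itv/= => /andP[t0 tT] O oO.
apply: (tmeas_glue (J := J) (P := fun n w => O (cut_path (sol n).1 ((sol n).2.1 w) ((sol n).2.2 w) t))) => // n.
rewrite /cut_path; have [_ _ h] := hsol n.
have [tn|tn] := boolP (t \in `[0, (sol n).1]); last exact: tmeas_cst.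
by move: tn; rewrite in_itv/= => /andP[_ tn]; exact: (h t t0 tn O oO).
Qed.
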